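(* There is a universal constant $C$ such that the following holds in every execution of the MonadBFT protocol (specified in the context) with $n=3f+1$ validators of which at most $f$ are Byzantine. Consider any three consecutive post-GST views $v$, $v+1$, $v+2$ such that the leaders of views $v$ and $v+2$ are correct. Let $t$ be the earliest time by which all correct validators have entered a view $>v+1$. Then $$t-\tau(v+1)\le C\delta+\Theta_{view},$$ i.e. $t-\tau(v+1)\le O(\delta)+\Theta_{view}$.
   Context: MODEL. There are $n=3f+1$ validators; at most $f$ are Byzantine (arbitrary behaviour), the others are correct and follow the protocol. Channels are point-to-point, authenticated and reliable. The network is partially synchronous: there are an unknown time GST and a known $\Delta>0$ such that a message sent at time $\tau$ between correct validators is delivered by $\max(\tau,\mathrm{GST})+\Delta$; $\delta\le\Delta$ denotes the actual network delay, i.e. such messages are in fact delivered by $\max(\tau,\mathrm{GST})+\delta$. Local clocks may drift before GST and are accurate after GST. All correct validators start the protocol before GST. ''Broadcast'' means send to all validators (including oneself). Local computation takes no time. Signatures and aggregate signatures are unforgeable; the hash function $H$ is treated as collision-free. An aggregate of $2f+1$ signatures means signatures of $2f+1$ distinct validators. Views are positive integers; leaders are assigned round-robin over the $n$ validators. A validator stores all proposals it receives; on obtaining a QC it is assumed also to obtain the proposal the QC points to (and ancestors as needed). $\bot$ denotes an absent field. A correct leader issues at most one proposal per view. Parameters: $\kappa\ge1$, $\Theta_{interval}$, $\Theta_{recovery}=(\lceil n/\kappa\rceil-1)\cdot\Theta_{interval}+2\Delta$, $\Theta_{view}=3\Delta+\Theta_{recovery}+3\Delta$. DATA. Block $B=\langle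 block\_view, payload, payload\_hash, qc, block\_hash\rangle$ with $block\_hash=H(block\_view,payload\_hash,qc)$; its header is $B$ without $payload$. Vote $\langle view, block\_hash, proposal\_id,\sigma\rangle$, valid if $proposal\_id=H(block\_hash,view)$ and $\sigma$ is a valid signature on the other fields. QC $\langle view, block\_hash, proposal\_id,\Sigma\rangle$, valid if $proposal\_id=H(block\_hash,view)$ and $\Sigma$ aggregates $2f+1$ signatures on the other fields; it points to any proposal with the same $proposal\_id$. Proposal $p=\langle view, proposal\_id, block,\sigma,tc,nec\rangle$ with $proposal\_id=H(block.block\_hash,view)$, $\sigma$ the leader's signature on $proposal\_id$ ($tc,nec$ possibly $\bot$). The tip of $p$ is $p$ with its block replaced by the block header. Timeout message $M=\langle view, tip, tip\_vote, qc, last\_cer,\sigma\rangle$. Timeout certificate (TC) $\langle view, tips\_views, high\_tip, qcs\_views, high\_qc,\Sigma\rangle$, where $tips\_views,qcs\_views$ give for each of $2f+1$ contributing validators the view of the reported tip ($\bot$, counted as $0$ in maxima, if it reported a QC) and the view of the reported QC (of the QC in the tip's header if it reported a tip). No-endorsement certificate (NEC) $\langle view, high\_tip\_qc\_view,\Sigma\rangle$. There are a genesis block and a genesis tip and genesis QC of view $0$, valid without signatures; initially they are $local\_tip$ and $last\_qc$. VALIDITY. A header is valid if its $qc$ is valid and its $block\_hash$ is correct; a block is valid if additionally $payload\_hash=H(payload)$. fresh($p$): $p.block.qc.view=p.view-1$, or $p.nec\ne\bot$, or ($p.tc\neq\bot$ and $p.tc.high\_qc\ne\bot$). Valid fresh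 tip $T$: valid header, correct $proposal\_id$, $\sigma$ by the leader of $T.view$, $header.block\_view=T.view>header.qc.view$, and: if $T.view=header.qc.view+1$ then $T.tc=T.nec=\bot$; otherwise $T.tc\neq\bot$ is valid with $T.view=T.tc.view+1$, and either ($T.nec=\bot$, $T.tc.high\_qc\ne\bot$ and $header.qc=T.tc.high\_qc$) or ($T.nec$ is valid, $T.view=T.nec.view$ and $header.qc.view=T.nec.high\_tip\_qc\_view$). Valid proposal $p$: valid block, correct $proposal\_id$, $\sigma$ by the leader of $p.view$, $p.view\ge p.block.block\_view$, $p.view>p.block.qc.view$, and: if fresh($p$), the tip of $p$ is a valid fresh tip; otherwise (''reproposal'') $p.view>p.block.block\_view$, $p.tc\neq\bot$ is valid, $p.view=p.tc.view+1$, $p.tc.high\_tip\ne\bot$, and the header of $p.block$ equals $p.tc.high\_tip$'s header. (So a valid proposal is fresh iff $p.view=p.block.block\_view$.) Valid timeout message $M$: $last\_cer$ is a valid QC or TC with $last\_cer.view=M.view-1$; exactly one of $tip,qc$ is non-$\bot$; if $tip\neq\bot$: $tip\_vote$ is a valid vote with $tip\_vote.view=M.view$, $tip$ is a valid fresh tip with $tip.view\le M.view$, $\sigma$ signs $(M.view,tip.view,tip.header.qc.view)$; if $qc\ne\bot$: $qc$ is valid, $qc.view<M.view$, $\sigma$ signs $(M.view,\bot,qc.view)$. Valid TC $tc$: $\Sigma$ aggregates $2f+1$ timeout signatures certifying $view,tips\_views,qcs\_views$; and either ($high\_qc\ne\bot$ is valid, $high\_tip=\bot$, $high\_qc.view<tc.view$,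 $\max(tips\_views)\le high\_qc.view=\max(qcs\_views)$) or ($high\_qc=\bot$, $high\_tip$ is a valid fresh tip, $high\_tip.view\le tc.view$, $qcs\_views[i]<tips\_views[i]$ whenever $tips\_views[i]\ne\bot$, no $tips\_views[i]>high\_tip.view$, no $i$ with $tips\_views[i]=high\_tip.view$ and $qcs\_views[i]>high\_tip.header.qc.view$, and $high\_tip.view>\max(qcs\_views)$). Valid NEC: $high\_tip\_qc\_view<view-1$ and $\Sigma$ aggregates $2f+1$ signatures on $(view,high\_tip\_qc\_view)$. LOCAL STATE of validator $i$: $cur\_view$, $local\_tip$, $highest\_voted\_view$, $last\_qc$, $last\_tc$, collected votes and timeouts, and a timer. At start every validator performs Enter(genesis QC), entering view $1$, and the leader of view 1 performs ProposeQC(genesis QC). PROCEDURES. Enter($c$) ($c$ a QC or TC): if $c.view\ge cur\_view$, set $cur\_view:=c.view+1$, restart the timer, and set $last\_qc:=c$ (QC) or $last\_tc:=c$ (TC). Commit($qc$): let $parent$ be the proposal $qc$ points to and $gp$ the proposal $parent.block.qc$ points to; if fresh($parent$), speculatively commit $parent.block$; if $qc.view=parent.block.qc.view+1$, commit $gp.block$ (and all its ancestors). ProposeQC($qc$): broadcast a proposal for $cur\_view$ with a new block $B$, $B.block\_view=cur\_view$, $B.qc=qc$, and $tc=nec=\bot$. ProposeTC($tc$): if $tc.high\_qc\neq\bot$, broadcast a proposal for $cur\_view$ with a new block with $qc=tc.high\_qc$, this $tc$, $nec=\bot$; else if the block of $tc.high\_tip$ is available, broadcast a proposal for $cur\_view$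 containing that same block, this $tc$, $nec=\bot$; else run Recover($tc$): if it returns a proposal, repropose its block as before; if it returns an NEC, broadcast a proposal with a new block with $qc=tc.high\_tip.header.qc$, this $tc$, and this $nec$. Recover($tc$): broadcast $\langle\mathsf{NERequest},tc\rangle$, send $\langle\mathsf{ProposalRequest},tc\rangle$ to $\kappa$ validators and, every $\Theta_{interval}$ time, to $\kappa$ further ones; return the first received proposal with $proposal\_id=tc.high\_tip.proposal\_id$, or an NEC with view $tc.view+1$ and $high\_tip\_qc\_view=tc.high\_tip.header.qc.view$ once $2f+1$ validators sent valid NE signatures on this pair; abort if Recover is called for a higher view. BroadcastQC($qc$): broadcast $qc$ if not yet done. HANDLERS (messages of a view smaller than indicated, or invalid, are ignored). (1) On a valid proposal $p$ from the leader of $p.view\ge cur\_view$: Enter($p.tc$) if $p.tc\ne\bot$, else Enter($p.block.qc$); if $p.block.qc.view=p.view-1$, then BroadcastQC($p.block.qc$) if $i$ is the leader of view $p.block.qc.view$, and send $p.block.qc$ to that leader; Commit($p.block.qc$); if $p.view>highest\_voted\_view$: set $local\_tip$ to the tip of $p$ if fresh($p$) and to $p.tc.high\_tip$ otherwise, send a vote for ($cur\_view$, block hash of $local\_tip$) to the leaders of views $cur\_view$ and $cur\_view+1$, and set $highest\_voted\_view:=cur\_view$. (2) On a valid vote with view $v\ge cur\_view$, if $i$ leads $v$ or $v+1$: once $2f+1$ votes with the same $proposal\_id$ are collected, form the QC $qc$; Enter($qc$); Commit($qc$); BroadcastQC($qc$) if $i$ leads $v$, else ProposeQC($qc$). (3)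 On a valid QC $qc$ from $j$ with $qc.view\ge cur\_view$: if $j$ leads $qc.view$: Enter($qc$), Commit($qc$), send $qc$ to the leader of $qc.view+1$; if $i$ leads $qc.view$: BroadcastQC($qc$); if $i$ leads $qc.view+1$: Enter($qc$), Commit($qc$), ProposeQC($qc$). (4) On timing out in $cur\_view=v$ (at most once per view; when the timer reaches $\Theta_{view}$ or when triggered in (5)): $highest\_voted\_view:=v$; broadcast a timeout message for view $v$ with $last\_cer=last\_qc$ if $last\_qc.view=v-1$ and $last\_cer=last\_tc$ otherwise; if $local\_tip.view\le last\_qc.view$ it has $qc=last\_qc$, $tip=tip\_vote=\bot$; otherwise $tip=local\_tip$, $tip\_vote$ a vote for ($v$, block hash of $local\_tip$), $qc=\bot$. (5) On a valid timeout message $M$ with $M.view\ge cur\_view$: let $c=M.last\_cer$; if $c$ is a TC and $i$ has broadcast neither a timeout message nor a TC for $c.view$, broadcast $c$; Enter($c$); if $i$ leads $c.view+1$ and has issued no proposal for it, ProposeQC($c$) or ProposeTC($c$) according to the type of $c$; if $c$ is a QC: BroadcastQC($c$) if $i$ leads $c.view$, send $c$ to the leaders of $c.view$ and $c.view+1$, Commit($c$). Then: if $M.tip\neq\bot$, record $M.tip\_vote$; if $2f+1$ tip votes with the same $proposal\_id$ are recorded, form the QC $qc$, Enter($qc$), Commit($qc$), ProposeQC($qc$) if $i$ leads $qc.view+1$, and stop. Otherwise record $M$; when $f+1$ timeout messages for $M.view$ are recorded, trigger the timeout of view $M.view$ if not yet triggered; when $2f+1$ are recorded, form a TC $tc$ (with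 $high\_tip$ the reported tip of highest view, ties broken by highest $header.qc.view$, if this view exceeds all reported QC views; otherwise with $high\_qc$ the highest reported QC), Enter($tc$), and ProposeTC($tc$) if $i$ leads $tc.view+1$. (6) On a valid TC $tc$ with $tc.view\ge cur\_view$: Enter($tc$); broadcast $tc$ if no TC and no timeout message was broadcast for $tc.view$; ProposeTC($tc$) if $i$ leads $tc.view+1$. (7) On $\langle\mathsf{ProposalRequest},tc\rangle$ or $\langle\mathsf{NERequest},tc\rangle$ from the leader of $tc.view+1\ge cur\_view$, with $tc$ valid and $tc.high\_tip\neq\bot$: Enter($tc$); for a ProposalRequest, if $i$ has a proposal with $proposal\_id=tc.high\_tip.proposal\_id$, send it to that leader; for an NERequest, if $i$ has not voted for a proposal with that $proposal\_id$ and has sent no NE message in view $tc.view+1$, send that leader an NE signature on $(tc.view+1,tc.high\_tip.header.qc.view)$. TERMINOLOGY. A correct validator enters view $w$ at the time it sets $cur\_view:=w$. $\tau(w)$ is the time at which the first correct validator enters view $w$ (every view is entered by some correct validator). A view $w$ is a post-GST view if $\tau(w)\ge\mathrm{GST}$. *)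

(* Defs.v *)
From Stdlib Require List.
From HB Require Import structures.
From mathcomp Require Import all_boot all_order all_fingroup all_algebra.
From mathcomp Require Import reals.

Set Implicit Arguments.
Unset Strict Implicit.
Unset Printing Implicit Defensive.

Import Order.TTheory GRing.Theory Num.Theory.

(* An execution is a sequence of atomic events.  In one event a correct
   validator consumes one input (start, message, timer, ...), runs the whole
   corresponding handler, and queues messages on the channels; the network and
   the Byzantine validators are constrained only by [admissible] below. *)

Section MonadBFT.

Variables (R : realType) (f : nat) (digest : eqType) (payload : Type).

Definition n_validators : nat := (3 * f).+1.
Definition quorum : nat := (2 * f).+1.
Definition validator := 'I_(3 * f).+1.

Definition leader (w : nat) : validator := inord (w %% n_validators).

(* Signatures are ideal: a signature is the pair of its signer and of the
   signed content.  Unforgeability is [unforged] below. *)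
Inductive content :=
| SVote of nat & digest & digest        (* view, block_hash, proposal_id *)
| SProposal of digest                   (* proposal_id *)
| STimeout of nat & option nat & nat    (* view, tip.view, qc.view *)
| SNE of nat & nat.                     (* view, high_tip_qc_view *)

Definition content_code (c : content) :
    (nat * digest * digest) + digest + (nat * option nat * nat) + (nat * nat) :=
  match c with
  | SVote v b p => inl (inl (inl (v, b, p)))
  | SProposal p => inl (inl (inr p))
  | STimeout v t q => inl (inr (v, t, q))
  | SNE v q => inr (v, q)
  end.
Definition content_decode
    (x : (nat * digest * digest) + digest + (nat * option nat * nat) + (nat * nat)) :=
  match x with
  | inl (inl (inl (v, b, p))) => SVote v b p
  | inl (inl (inr p)) => SProposal p
  | inl (inr (v, t, q)) => STimeout v t q
  | inr (v, q) => SNE v q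
  end.
Lemma content_codeK : cancel content_code content_decode.
Proof. by case. Qed.
HB.instance Definition _ := Equality.copy content (can_type content_codeK).

Definition sig : Type := validator * content.

Record QC := MkQC {
  q_view : nat; q_block : digest; q_id : digest; q_agg : seq sig }.

Definition QC_code q := (q_view q, q_block q, q_id q, q_agg q).
Definition QC_decode (x : nat * digest * digest * seq (validator * content)) :=
  let: (v, b, p, s) := x in MkQC v b p s.
Lemma QC_codeK : cancel QC_code QC_decode.
Proof. by case. Qed.
HB.instance Definition _ := Equality.copy QC (can_type QC_codeK).

Record NEC := MkNEC { nec_view : nat; nec_qc_view : nat; nec_agg : seq sig }.

Record header := MkHeader {
  h_view : nat; h_payload_hash : digest; h_qc : QC; h_hash : digest }.

Definition header_code h := (h_view h, h_payload_hash h, h_qc h, h_hash h).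
Definition header_decode (x : nat * digest * QC * digest) :=
  let: (v, p, q, b) := x in MkHeader v p q b.
Lemma header_codeK : cancel header_code header_decode.
Proof. by case. Qed.
HB.instance Definition _ := Equality.copy header (can_type header_codeK).

Record block := MkBlock {
  b_view : nat; b_payload : payload; b_payload_hash : digest;
  b_qc : QC; b_hash : digest }.

Definition header_of (b : block) : header :=
  MkHeader (b_view b) (b_payload_hash b) (b_qc b) (b_hash b).

(* [None] is the absent field.  Position [k] of the two lists of views of a TC
   belongs to the signer of position [k] of its aggregate. *)
Inductive tip :=
  Tip of nat & digest & header & sig & option TC & option NEC
  (* view, proposal_id, header, signature, tc, nec *)
with TC :=
  MkTC of nat & seq (option nat) & option tip & seq nat & option QC & seq sig.
  (* view, tips_views, high_tip, qcs_views, high_qc, aggregate *)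

Definition tip_view (T : tip) := let: Tip v _ _ _ _ _ := T in v.
Definition tip_id (T : tip) := let: Tip _ d _ _ _ _ := T in d.
Definition tip_header (T : tip) := let: Tip _ _ h _ _ _ := T in h.
Definition tip_qc (T : tip) := h_qc (tip_header T).

Definition tc_view (c : TC) := let: MkTC v _ _ _ _ _ := c in v.
Definition tc_high_tip (c : TC) := let: MkTC _ _ T _ _ _ := c in T.
Definition tc_high_qc (c : TC) := let: MkTC _ _ _ _ q _ := c in q.

Record proposal := MkProposal {
  p_view : nat; p_id : digest; p_block : block; p_sig : sig;
  p_tc : option TC; p_nec : option NEC }.

Definition tip_of (p : proposal) : tip :=
  Tip (p_view p) (p_id p) (header_of (p_block p)) (p_sig p) (p_tc p) (p_nec p).

Record vote := MkVote {
  vt_view : nat; vt_block : digest; vt_id : digest; vt_sig : sig }.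

Inductive cert := CertQC of QC | CertTC of TC.

Definition cert_view (c : cert) : nat :=
  match c with CertQC q => q_view q | CertTC c => tc_view c end.

Record timeout := MkTimeout {
  m_view : nat; m_tip : option tip; m_tip_vote : option vote;
  m_qc : option QC; m_cer : cert; m_sig : sig }.

(* The view of the QC reported by a timeout message: of the QC in the header of
   the tip if a tip is reported. *)
Definition m_qc_view (M : timeout) : nat :=
  if m_tip M is Some T then q_view (tip_qc T)
  else if m_qc M is Some q then q_view q else 0.

Record ne_vote := MkNE { ne_view : nat; ne_qc_view : nat; ne_sig : sig }.

Inductive msg :=
| MProposal of proposal
| MVote of vote
| MQC of QC
| MTimeout of timeout
| MTC of TC
| MProposalRequest of TC
| MNERequest of TC
| MNE of ne_vote.

Fixpoint tip_sigs (T : tip) : seq sig :=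
  let: Tip _ _ h s otc onec := T in
  s :: q_agg (h_qc h) ++ (if otc is Some tc then tc_sigs tc else [::])
    ++ (if onec is Some nec then nec_agg nec else [::])
with tc_sigs (tc : TC) : seq sig :=
  let: MkTC _ _ oT _ oq s := tc in
  s ++ (if oT is Some T then tip_sigs T else [::])
    ++ (if oq is Some q then q_agg q else [::]).

Definition cert_sigs (c : cert) : seq sig :=
  match c with CertQC q => q_agg q | CertTC c => tc_sigs c end.

Definition timeout_sigs (M : timeout) : seq sig :=
  m_sig M :: oapp tip_sigs [::] (m_tip M)
    ++ oapp (fun vt => [:: vt_sig vt]) [::] (m_tip_vote M)
    ++ oapp q_agg [::] (m_qc M) ++ cert_sigs (m_cer M).

Definition msg_sigs (m : msg) : seq sig :=
  match m with
  | MProposal p => tip_sigs (tip_of p)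
  | MVote vt => [:: vt_sig vt]
  | MQC q => q_agg q
  | MTimeout M => timeout_sigs M
  | MTC c | MProposalRequest c | MNERequest c => tc_sigs c
  | MNE ne => [:: ne_sig ne]
  end.

Inductive hash_input :=
| HPayload of payload
| HHeader of nat & digest & QC      (* block_view, payload_hash, qc *)
| HProposal of digest & nat.        (* block_hash, view *)

Record params := Params {
  H : hash_input -> digest;
  H_inj : injective H;
  genesis_block : block;
  genesis_view : b_view genesis_block = 0;
  genesis_payload_hash :
    b_payload_hash genesis_block = H (HPayload (b_payload genesis_block));
  genesis_hash :
    b_hash genesis_block =
      H (HHeader 0 (b_payload_hash genesis_block) (b_qc genesis_block));
  kappa : nat;
  kappa_gt0 : 0 < kappa;
  theta_interval : R;
  theta_interval_ge0 : (0 <= theta_interval)%R;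
  Delta : R;
  Delta_gt0 : (0 < Delta)%R }.

Variable P : params.

Definition ceil_div (a b : nat) : nat := (a + b.-1) %/ b.

Definition theta_recovery : R :=
  ((ceil_div n_validators (kappa P)).-1%:R * theta_interval P + 2%:R * Delta P)%R.
Definition theta_view : R :=
  (3%:R * Delta P + theta_recovery + 3%:R * Delta P)%R.

Definition proposal_id (bh : digest) (w : nat) : digest := H P (HProposal bh w).

Definition genesis_qc : QC :=
  let bh := b_hash (genesis_block P) in MkQC 0 bh (proposal_id bh 0) [::].

(* The signature field is a filler: having view 0, this tip is never sent. *)
Definition genesis_tip : tip :=
  let pid := proposal_id (b_hash (genesis_block P)) 0 in
  Tip 0 pid (header_of (genesis_block P)) (leader 0, SProposal pid) None None.

Definition valid_agg (c : content) (s : seq sig) : bool :=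
  [&& size s == quorum, uniq [seq x.1 | x <- s] & all (fun x => x.2 == c) s].

Definition valid_qc (q : QC) : bool :=
  (q == genesis_qc) ||
  (q_id q == proposal_id (q_block q) (q_view q)) &&
  valid_agg (SVote (q_view q) (q_block q) (q_id q)) (q_agg q).

Definition valid_vote (vt : vote) : bool :=
  (vt_id vt == proposal_id (vt_block vt) (vt_view vt)) &&
  ((vt_sig vt).2 == SVote (vt_view vt) (vt_block vt) (vt_id vt)).

Definition valid_ne (ne : ne_vote) : bool :=
  (ne_sig ne).2 == SNE (ne_view ne) (ne_qc_view ne).

Definition valid_nec (nec : NEC) : bool :=
  ((nec_qc_view nec).+1 < nec_view nec) &&
  valid_agg (SNE (nec_view nec) (nec_qc_view nec)) (nec_agg nec).

Definition valid_header (h : header) : bool :=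
  valid_qc (h_qc h) &&
  (h_hash h == H P (HHeader (h_view h) (h_payload_hash h) (h_qc h))).

Definition valid_block (b : block) : bool :=
  valid_header (header_of b) && (b_payload_hash b == H P (HPayload (b_payload b))).

Definition max_tips (ts : seq (option nat)) : nat := \max_(x <- ts) odflt 0 x.
Definition max_qcs (qs : seq nat) : nat := \max_(x <- qs) x.

(* [valid_tip] is validity as a fresh tip. *)
Fixpoint valid_tip (T : tip) : bool :=
  let: Tip v pid h s otc onec := T in
  [&& valid_header h, pid == proposal_id (h_hash h) v,
      s == (leader v, SProposal pid), h_view h == v, q_view (h_qc h) < v &
      if v == (q_view (h_qc h)).+1 then ~~ isSome otc && ~~ isSome onec
      else if otc is Some tc then
        [&& valid_tc tc, v == (tc_view tc).+1 &
            if onec is Some nec then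
              [&& valid_nec nec, v == nec_view nec &
                  q_view (h_qc h) == nec_qc_view nec]
            else tc_high_qc tc == Some (h_qc h)]
      else false]
with valid_tc (tc : TC) : bool :=
  let: MkTC v ts oT qs oq s := tc in
  [&& size s == quorum, size ts == quorum, size qs == quorum,
      uniq [seq x.1 | x <- s],
      [seq x.2 | x <- s] == [seq STimeout v x.1 x.2 | x <- zip ts qs] &
      match oT, oq with
      | None, Some q =>
          [&& valid_qc q, q_view q < v, max_tips ts <= q_view q &
              q_view q == max_qcs qs]
      | Some T, None =>
          [&& valid_tip T, tip_view T <= v,
              all (fun x => if x.1 is Some t then x.2 < t else true) (zip ts qs),
              all (fun t => odflt 0 t <= tip_view T) ts,
              all (fun x => (x.1 == Some (tip_view T)) ==>
                            (x.2 <= q_view (tip_qc T))) (zip ts qs) &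
              max_qcs qs < tip_view T]
      | _, _ => false
      end].

Definition fresh (p : proposal) : bool :=
  [|| (q_view (b_qc (p_block p))).+1 == p_view p, isSome (p_nec p) |
      isSome (obind tc_high_qc (p_tc p))].

Definition valid_proposal (p : proposal) : bool :=
  let b := p_block p in
  [&& valid_block b, p_id p == proposal_id (b_hash b) (p_view p),
      p_sig p == (leader (p_view p), SProposal (p_id p)),
      b_view b <= p_view p, q_view (b_qc b) < p_view p &
      if fresh p then valid_tip (tip_of p)
      else (b_view b < p_view p) &&
        (if p_tc p is Some tc then
           [&& valid_tc tc, p_view p == (tc_view tc).+1 &
               omap tip_header (tc_high_tip tc) == Some (header_of b)]
         else false)].

Definition valid_cert (c : cert) : bool :=
  match c with CertQC q => valid_qc q | CertTC c => valid_tc c end.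

(* The tip vote of a timeout message is a vote of the author of the message. *)
Definition valid_timeout (M : timeout) : bool :=
  [&& valid_cert (m_cer M), (cert_view (m_cer M)).+1 == m_view M &
      match m_tip M, m_qc M with
      | Some T, None =>
          if m_tip_vote M is Some vt then
            [&& valid_vote vt, vt_view vt == m_view M,
                (vt_sig vt).1 == (m_sig M).1, valid_tip T,
                tip_view T <= m_view M &
                (m_sig M).2 ==
                  STimeout (m_view M) (Some (tip_view T)) (q_view (tip_qc T))]
          else false
      | None, Some q =>
          [&& valid_qc q, q_view q < m_view M &
              (m_sig M).2 == STimeout (m_view M) None (q_view q)]
      | _, _ => false
      end].

Record recovery_state := MkRecovery {
  r_tc : TC; r_tip : tip;
  r_start : R;                (* local time at which Recover was called *)
  r_batches : nat;            (* number of batches of requests already sent *)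
  r_asked : seq validator }.  (* recipients of these requests *)

(* [timer] is the reading of the local clock when the timer was last restarted;
   [cur_view] is 0 until the validator starts.  [entered] lists the values taken
   by [cur_view] and [sent] all messages sent, with their recipients; "has
   voted", "has broadcast", "has issued" are read off [sent]. *)
Record lstate := LState {
  cur_view : nat;
  timer : R;
  entered : seq nat;
  last_qc : QC;
  last_tc : option TC;
  local_tip : tip;
  highest_voted_view : nat;
  votes : seq vote;
  tip_votes : seq vote;
  timeouts : seq timeout;
  ne_votes : seq ne_vote;
  proposals : seq proposal;
  recovery : option recovery_state;
  committed : seq block;
  spec_committed : seq block;
  sent : seq (validator * msg) }.

Definition init_state : lstate :=
  LState 0 0%R [::] genesis_qc None genesis_tip 0 [::] [::] [::] [::] [::] None
    [:: genesis_block P] [::] [::].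

Definition proc := lstate -> lstate.

Definition set_local_tip (T : tip) : proc := fun s =>
  LState (cur_view s) (timer s) (entered s) (last_qc s) (last_tc s)
    T (highest_voted_view s) (votes s) (tip_votes s) (timeouts s) (ne_votes s)
    (proposals s) (recovery s) (committed s) (spec_committed s) (sent s).
Definition set_voted_view (w : nat) : proc := fun s =>
  LState (cur_view s) (timer s) (entered s) (last_qc s) (last_tc s)
    (local_tip s) w (votes s) (tip_votes s) (timeouts s) (ne_votes s)
    (proposals s) (recovery s) (committed s) (spec_committed s) (sent s).
Definition add_vote (vt : vote) : proc := fun s =>
  LState (cur_view s) (timer s) (entered s) (last_qc s) (last_tc s)
    (local_tip s) (highest_voted_view s) (rcons (votes s) vt) (tip_votes s)
    (timeouts s) (ne_votes s) (proposals s) (recovery s) (committed s)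
    (spec_committed s) (sent s).
Definition add_tip_vote (vt : vote) : proc := fun s =>
  LState (cur_view s) (timer s) (entered s) (last_qc s) (last_tc s)
    (local_tip s) (highest_voted_view s) (votes s) (rcons (tip_votes s) vt)
    (timeouts s) (ne_votes s) (proposals s) (recovery s) (committed s)
    (spec_committed s) (sent s).
Definition add_timeout (M : timeout) : proc := fun s =>
  LState (cur_view s) (timer s) (entered s) (last_qc s) (last_tc s)
    (local_tip s) (highest_voted_view s) (votes s) (tip_votes s)
    (rcons (timeouts s) M) (ne_votes s) (proposals s) (recovery s)
    (committed s) (spec_committed s) (sent s).
Definition add_ne (ne : ne_vote) : proc := fun s =>
  LState (cur_view s) (timer s) (entered s) (last_qc s) (last_tc s)
    (local_tip s) (highest_voted_view s) (votes s) (tip_votes s) (timeouts s)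
    (rcons (ne_votes s) ne) (proposals s) (recovery s) (committed s)
    (spec_committed s) (sent s).
Definition add_proposal (p : proposal) : proc := fun s =>
  LState (cur_view s) (timer s) (entered s) (last_qc s) (last_tc s)
    (local_tip s) (highest_voted_view s) (votes s) (tip_votes s) (timeouts s)
    (ne_votes s) (rcons (proposals s) p) (recovery s) (committed s)
    (spec_committed s) (sent s).
Definition set_recovery (r : option recovery_state) : proc := fun s =>
  LState (cur_view s) (timer s) (entered s) (last_qc s) (last_tc s)
    (local_tip s) (highest_voted_view s) (votes s) (tip_votes s) (timeouts s)
    (ne_votes s) (proposals s) r (committed s) (spec_committed s) (sent s).
Definition add_committed (bs : seq block) : proc := fun s =>
  LState (cur_view s) (timer s) (entered s) (last_qc s) (last_tc s)
    (local_tip s) (highest_voted_view s) (votes s) (tip_votes s) (timeouts s)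
    (ne_votes s) (proposals s) (recovery s) (committed s ++ bs)
    (spec_committed s) (sent s).
Definition add_spec_committed (bs : seq block) : proc := fun s =>
  LState (cur_view s) (timer s) (entered s) (last_qc s) (last_tc s)
    (local_tip s) (highest_voted_view s) (votes s) (tip_votes s) (timeouts s)
    (ne_votes s) (proposals s) (recovery s) (committed s)
    (spec_committed s ++ bs) (sent s).
Definition add_sent (ms : seq (validator * msg)) : proc := fun s =>
  LState (cur_view s) (timer s) (entered s) (last_qc s) (last_tc s)
    (local_tip s) (highest_voted_view s) (votes s) (tip_votes s) (timeouts s)
    (ne_votes s) (proposals s) (recovery s) (committed s) (spec_committed s)
    (sent s ++ ms).

Definition sent_timeout (w : nat) (s : lstate) : bool :=
  has (fun x => if x.2 is MTimeout M then m_view M == w else false) (sent s).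
Definition sent_tc (w : nat) (s : lstate) : bool :=
  has (fun x => if x.2 is MTC c then tc_view c == w else false) (sent s).
Definition sent_qc_to_all (q : QC) (s : lstate) : bool :=
  all (fun j => has (fun x =>
         if x.2 is MQC q' then (x.1 == j) && (q' == q) else false) (sent s))
      (enum validator).
Definition voted_for (d : digest) (s : lstate) : bool :=
  has (fun x => if x.2 is MVote vt then vt_id vt == d else false) (sent s).
Definition sent_ne (w : nat) (s : lstate) : bool :=
  has (fun x => if x.2 is MNE ne then ne_view ne == w else false) (sent s).
Definition issued (i : validator) (w : nat) (s : lstate) : bool :=
  has (fun x => if x.2 is MProposal p then
                  (p_view p == w) && ((p_sig p).1 == i) else false) (sent s).

Definition stored (d : digest) (s : lstate) : option proposal :=
  ohead [seq p <- proposals s | p_id p == d].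
Definition stored_block (h : header) (s : lstate) : option block :=
  ohead [seq b <- [seq p_block p | p <- proposals s] | header_of b == h].

(* The choices left open by the protocol: the payload of new blocks and the
   order in which validators are asked for a missing proposal. *)
Record choices := MkChoices { ch_payload : payload; ch_order : {perm validator} }.

Section Handlers.

(* The validator that acts, the reading of its local clock, its choices. *)
Variables (i : validator) (now : R) (ch : choices).

Definition andthen (p q : proc) : proc := fun s => q (p s).
Local Notation "p ;; q" := (andthen p q) (at level 51, right associativity).
Definition when (b : bool) (p : proc) : proc := fun s => if b then p s else s.

Definition send (j : validator) (m : msg) : proc := add_sent [:: (j, m)].
Definition broadcast (m : msg) : proc :=
  add_sent [seq (j, m) | j <- enum validator].

Definition enter (c : cert) : proc := fun s =>
  if cur_view s <= cert_view c then
    let w := (cert_view c).+1 in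
    LState w now (rcons (entered s) w)
      (if c is CertQC q then q else last_qc s)
      (if c is CertTC c' then Some c' else last_tc s)
      (local_tip s) (highest_voted_view s) (votes s) (tip_votes s) (timeouts s)
      (ne_votes s) (proposals s) (recovery s) (committed s) (spec_committed s)
      (sent s)
  else s.

Fixpoint with_ancestors (fuel : nat) (s : lstate) (b : block) : seq block :=
  b :: if fuel is k.+1 then
         if stored (q_id (b_qc b)) s is Some p
         then with_ancestors k s (p_block p) else [::]
       else [::].

(* Views strictly decrease along ancestors, hence the fuel. *)
Definition commit (q : QC) : proc := fun s =>
  if stored (q_id q) s is Some parent then
    let b := p_block parent in
    let s1 := when (fresh parent) (add_spec_committed [:: b]) s in
    if q_view q == (q_view (b_qc b)).+1 then
      if stored (q_id (b_qc b)) s is Some gp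
      then add_committed (with_ancestors (b_view (p_block gp)) s (p_block gp)) s1
      else s1
    else s1
  else s.

Definition broadcast_qc (q : QC) : proc := fun s =>
  if sent_qc_to_all q s then s else broadcast (MQC q) s.

Definition new_block (w : nat) (q : QC) : block :=
  let ph := H P (HPayload (ch_payload ch)) in
  MkBlock w (ch_payload ch) ph q (H P (HHeader w ph q)).

(* At most one proposal is issued per view. *)
Definition propose (b : block) (otc : option TC) (onec : option NEC) : proc :=
  fun s =>
    let w := cur_view s in
    let pid := proposal_id (b_hash b) w in
    if issued i w s then s
    else broadcast (MProposal (MkProposal w pid b (i, SProposal pid) otc onec)) s.

Definition propose_qc (q : QC) : proc := fun s =>
  propose (new_block (cur_view s) q) None None s.

(* The next [kappa] validators, or all the remaining ones if they are fewer. *)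
Definition request_batch : proc := fun s =>
  if recovery s is Some r then
    let js := take (kappa P)
      [seq j <- [seq ch_order ch j | j <- enum validator] | j \notin r_asked r] in
    (add_sent [seq (j, MProposalRequest (r_tc r)) | j <- js] ;;
     set_recovery (Some (MkRecovery (r_tc r) (r_tip r) (r_start r)
                           (r_batches r).+1 (r_asked r ++ js)))) s
  else s.

(* A call for a view higher than that of the running Recover replaces it; a call
   for the same view is subsumed by it. *)
Definition recover (tc : TC) (T : tip) : proc := fun s =>
  if (if recovery s is Some r then tc_view tc <= tc_view (r_tc r) else false)
  then s
  else (broadcast (MNERequest tc) ;;
        set_recovery (Some (MkRecovery tc T now 0 [::])) ;;
        request_batch) s.

Definition propose_tc (tc : TC) : proc := fun s =>
  if tc_high_qc tc is Some q then
    propose (new_block (cur_view s) q) (Some tc) None s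
  else if tc_high_tip tc is Some T then
    if stored_block (tip_header T) s is Some b then propose b (Some tc) None s
    else recover tc T s
  else s.

Definition propose_cert (c : cert) : proc :=
  match c with CertQC q => propose_qc q | CertTC c => propose_tc c end.

(* Recover returns: the result is used if the validator is still in the view it
   was going to propose for. *)
Definition recover_return (r : recovery_state) (p : proc) : proc := fun s =>
  (set_recovery None ;; when (cur_view s == (tc_view (r_tc r)).+1) p) s.

Definition recover_on_proposal (p : proposal) : proc := fun s =>
  if recovery s is Some r then
    when (p_id p == tip_id (r_tip r))
      (recover_return r (propose (p_block p) (Some (r_tc r)) None)) s
  else s.

Definition recover_on_ne : proc := fun s =>
  if recovery s is Some r then
    let w := (tc_view (r_tc r)).+1 in
    let q := tip_qc (r_tip r) in
    let sigs := undup [seq ne_sig ne | ne <- ne_votes s &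
                  (ne_view ne == w) && (ne_qc_view ne == q_view q)] in
    when (quorum <= size sigs)
      (recover_return r
         (propose (new_block w q) (Some (r_tc r))
            (Some (MkNEC w (q_view q) (take quorum sigs))))) s
  else s.

(* The QC for the proposal identifier of [vt], once a quorum of [vs] votes for it. *)
Definition form_qc (vt : vote) (vs : seq vote) : option QC :=
  let sigs := undup [seq vt_sig x | x <- vs & vt_id x == vt_id vt] in
  if quorum <= size sigs
  then Some (MkQC (vt_view vt) (vt_block vt) (vt_id vt) (take quorum sigs))
  else None.

Definition better_tip (T T' : tip) : bool :=
  (tip_view T' < tip_view T) ||
  (tip_view T' == tip_view T) && (q_view (tip_qc T') <= q_view (tip_qc T)).
Definition best_tip (Ts : seq tip) : option tip :=
  foldr (fun T o => if o is Some T' then Some (if better_tip T T' then T else T')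
                    else Some T) None Ts.
Definition best_qc (qs : seq QC) : option QC :=
  foldr (fun q o => if o is Some q' then
                      Some (if q_view q' <= q_view q then q else q')
                    else Some q) None qs.

Definition form_tc (w : nat) (Ms : seq timeout) : TC :=
  let ts := [seq omap tip_view (m_tip M) | M <- Ms] in
  let qs := [seq m_qc_view M | M <- Ms] in
  let oT := best_tip (pmap m_tip Ms) in
  let use_tip := if oT is Some T then max_qcs qs < tip_view T else false in
  MkTC w ts (if use_tip then oT else None) qs
    (if use_tip then None else best_qc (pmap m_qc Ms)) [seq m_sig M | M <- Ms].

Definition make_vote (w : nat) (bh : digest) : vote :=
  let pid := proposal_id bh w in MkVote w bh pid (i, SVote w bh pid).

Definition tip_hash (T : tip) : digest := h_hash (tip_header T).

Definition start : proc :=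
  enter (CertQC genesis_qc) ;; when (i == leader 1) (propose_qc genesis_qc).

Definition vote_for (p : proposal) : proc := fun s =>
  if highest_voted_view s < p_view p then
    let T := if fresh p then tip_of p
             else odflt (local_tip s) (obind tc_high_tip (p_tc p)) in
    let w := cur_view s in
    let m := MVote (make_vote w (tip_hash T)) in
    (set_local_tip T ;; send (leader w) m ;; send (leader w.+1) m ;;
     set_voted_view w) s
  else s.

(* Every valid proposal is stored and offered to a running Recover,
   even if its view is over or its sender is not its leader. *)
Definition on_proposal (j : validator) (p : proposal) : proc := fun s =>
  let q := b_qc (p_block p) in
  if valid_proposal p then
    (add_proposal p ;; recover_on_proposal p ;;
     when ((j == leader (p_view p)) && (cur_view s <= p_view p))
       (enter (if p_tc p is Some tc then CertTC tc else CertQC q) ;;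
        when ((q_view q).+1 == p_view p)
          (when (i == leader (q_view q)) (broadcast_qc q) ;;
           send (leader (q_view q)) (MQC q)) ;;
        commit q ;;
        vote_for p)) s
  else s.

Definition on_vote (vt : vote) : proc := fun s =>
  let w := vt_view vt in
  if [&& valid_vote vt, cur_view s <= w &
         (i == leader w) || (i == leader w.+1)] then
    let s1 := add_vote vt s in
    if form_qc vt (votes s1) is Some q then
      (enter (CertQC q) ;; commit q ;;
       (if i == leader w then broadcast_qc q else propose_qc q)) s1
    else s1
  else s.

Definition on_qc (j : validator) (q : QC) : proc := fun s =>
  if valid_qc q && (cur_view s <= q_view q) then
    (when (j == leader (q_view q))
       (enter (CertQC q) ;; commit q ;; send (leader (q_view q).+1) (MQC q)) ;;
     when (i == leader (q_view q)) (broadcast_qc q) ;;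
     when (i == leader (q_view q).+1)
       (enter (CertQC q) ;; commit q ;; propose_qc q)) s
  else s.

Definition timeout_msg (s : lstate) : timeout :=
  let w := cur_view s in
  let T := local_tip s in
  let q := last_qc s in
  let cer := if (q_view q).+1 == w then CertQC q
             else if last_tc s is Some tc then CertTC tc else CertQC q in
  if tip_view T <= q_view q then
    MkTimeout w None None (Some q) cer (i, STimeout w None (q_view q))
  else
    MkTimeout w (Some T) (Some (make_vote w (tip_hash T))) None cer
      (i, STimeout w (Some (tip_view T)) (q_view (tip_qc T))).
Definition time_out : proc := fun s =>
  if sent_timeout (cur_view s) s then s
  else (set_voted_view (cur_view s) ;; broadcast (MTimeout (timeout_msg s))) s.

Definition process_cer (c : cert) : proc := fun s =>
  let w := cert_view c in
  (when (if c is CertTC _ then ~~ sent_timeout w s && ~~ sent_tc w s else false)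
     (if c is CertTC tc then broadcast (MTC tc) else id) ;;
   enter c ;;
   (fun s' => when ((i == leader w.+1) && ~~ issued i w.+1 s')
                (propose_cert c) s') ;;
   (if c is CertQC q then
      when (i == leader w) (broadcast_qc q) ;;
      send (leader w) (MQC q) ;; send (leader w.+1) (MQC q) ;; commit q
    else id)) s.
Definition record_timeout (M : timeout) : proc := fun s =>
  let w := m_view M in
  let known := has (fun M' => (m_view M' == w) && ((m_sig M').1 == (m_sig M).1))
                   (timeouts s) in
  let s1 := when (~~ known) (add_timeout M) s in
  let Ms := [seq M' <- timeouts s1 | m_view M' == w] in
  let tc := form_tc w (take quorum Ms) in
  (when (f.+1 <= size Ms) time_out ;;
   when (quorum <= size Ms)
     (enter (CertTC tc) ;; when (i == leader w.+1) (propose_tc tc))) s1.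
Definition record_tip_vote (M : timeout) : lstate -> lstate * option QC := fun s =>
  if m_tip_vote M is Some vt then
    if isSome (m_tip M) then
      let s1 := add_tip_vote vt s in (s1, form_qc vt (tip_votes s1))
    else (s, None)
  else (s, None).
Definition on_timeout (M : timeout) : proc := fun s =>
  if valid_timeout M && (cur_view s <= m_view M) then
    let: (s1, oq) := record_tip_vote M (process_cer (m_cer M) s) in
    if oq is Some q then
      (enter (CertQC q) ;; commit q ;;
       when (i == leader (q_view q).+1) (propose_qc q)) s1
    else record_timeout M s1
  else s.

Definition on_tc (tc : TC) : proc := fun s =>
  let w := tc_view tc in
  if valid_tc tc && (cur_view s <= w) then
    (enter (CertTC tc) ;;
     when (~~ sent_tc w s && ~~ sent_timeout w s) (broadcast (MTC tc)) ;;
     when (i == leader w.+1) (propose_tc tc)) s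
  else s.

Definition on_request (j : validator) (tc : TC) (reply : tip -> proc) : proc :=
  fun s =>
    if tc_high_tip tc is Some T then
      if [&& valid_tc tc, j == leader (tc_view tc).+1 &
             cur_view s <= (tc_view tc).+1]
      then (enter (CertTC tc) ;; reply T) s
      else s
    else s.
Definition on_proposal_request (j : validator) (tc : TC) : proc :=
  on_request j tc (fun T s =>
    if stored (tip_id T) s is Some p then send j (MProposal p) s else s).
Definition on_ne_request (j : validator) (tc : TC) : proc :=
  on_request j tc (fun T s =>
    let w := (tc_view tc).+1 in
    let qv := q_view (tip_qc T) in
    if ~~ voted_for (tip_id T) s && ~~ sent_ne w s
    then send j (MNE (MkNE w qv (i, SNE w qv))) s else s).

Definition on_ne (ne : ne_vote) : proc :=
  when (valid_ne ne) (add_ne ne ;; recover_on_ne).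

Definition on_msg (j : validator) (m : msg) : proc :=
  match m with
  | MProposal p => on_proposal j p
  | MVote vt => on_vote vt
  | MQC q => on_qc j q
  | MTimeout M => on_timeout M
  | MTC tc => on_tc tc
  | MProposalRequest tc => on_proposal_request j tc
  | MNERequest tc => on_ne_request j tc
  | MNE ne => on_ne ne
  end.

End Handlers.

(* [InFetch p]: the validator obtains a proposal pointed to by a QC it holds (or
   an ancestor) by means outside the protocol; allowed at any time, for any
   genuine proposal, and never required. *)
Inductive input :=
| InStart
| InMsg of validator & msg
| InTimer
| InBatch
| InFetch of proposal.

Definition step (i : validator) (now : R) (a : input) (ch : choices) : proc :=
  match a with
  | InStart => start i now ch
  | InMsg j m => on_msg i now ch j m
  | InTimer => time_out i
  | InBatch => request_batch ch
  | InFetch p => add_proposal p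
  end.

Definition started (s : lstate) : bool := 0 < cur_view s.

Definition timer_due (s : lstate) (now : R) : bool :=
  [&& started s, ~~ sent_timeout (cur_view s) s & (theta_view <= now - timer s)%R].

Definition batch_due (s : lstate) (now : R) : bool :=
  if recovery s is Some r then
    (size (r_asked r) < n_validators) &&
    ((r_batches r)%:R * theta_interval P <= now - r_start r)%R
  else false.

Definition enabled (s : lstate) (now : R) (a : input) : bool :=
  match a with
  | InStart => ~~ started s
  | InMsg _ _ => started s
  | InTimer => timer_due s now
  | InBatch => batch_due s now
  | InFetch p => started s && valid_proposal p
  end.

(* [ev k] is the [k]-th event ([None]: nothing happens), [time k] the real time
   at which it occurs, [st k] the local states just before it; [clock i] is the
   local clock of [i] as a function of real time. *)
Record execution := Execution {
  byz : {set validator};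
  GST : R;
  delta : R;
  clock : validator -> R -> R;
  time : nat -> R;
  ev : nat -> option (validator * input * choices);
  st : nat -> validator -> lstate }.

Section Executions.

Variable E : execution.

Definition correct (i : validator) : bool := i \notin byz E.

(* The messages sent during event [k] by validator [i]. *)
Definition new_sent (k : nat) (i : validator) : seq (validator * msg) :=
  drop (size (sent (st E k i))) (sent (st E k.+1 i)).

(* Each signature of a correct validator in [ss] occurs in a message which that
   validator has sent before event [k]. *)
Definition unforged (k : nat) (ss : seq sig) : Prop :=
  forall x : sig, x \in ss -> correct x.1 ->
    exists2 y, List.In y (sent (st E k x.1)) & x \in msg_sigs y.2.

(* Nothing is assumed about Byzantine validators except that their number is at
   most [f] and that they cannot forge signatures. Messages between correct
   validators may be duplicated and reordered. *)
Record admissible : Prop := {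
  adm_byz : #|byz E| <= f;
  adm_delta : (0 <= delta E <= Delta P)%R;
  adm_init : forall i, st E 0 i = init_state;
  adm_time : forall k, (time E k <= time E k.+1)%R;
  adm_nonzeno : forall t : R, exists k, (t <= time E k)%R;
  adm_clock : forall i s t, (s <= t)%R -> (clock E i s <= clock E i t)%R;
  adm_clock_gst : forall i s t, (GST E <= s)%R -> (s <= t)%R ->
    (clock E i t - clock E i s = t - s)%R;
  adm_step : forall k,
    match ev E k with
    | None => forall i, st E k.+1 i = st E k i
    | Some (i, a, ch) =>
        let now := clock E i (time E k) in
        [/\ correct i, enabled (st E k i) now a,
            st E k.+1 i = step i now a ch (st E k i) &
            forall j, j != i -> st E k.+1 j = st E k j]
    end;
  adm_start : forall i, correct i ->
    exists k ch, ev E k = Some (i, InStart, ch) /\ (time E k < GST E)%R;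
  adm_authentic : forall k i j m ch, ev E k = Some (i, InMsg j m, ch) ->
    if correct j then List.In (i, m) (sent (st E k j))
    else unforged k (msg_sigs m);
  adm_fetch : forall k i p ch, ev E k = Some (i, InFetch p, ch) ->
    unforged k (msg_sigs (MProposal p));
  adm_delivery : forall k i j m, correct i -> correct j ->
    List.In (j, m) (new_sent k i) ->
    exists k' ch, [/\ k < k', ev E k' = Some (j, InMsg i m, ch) &
      (time E k' <= Num.max (time E k) (GST E) + delta E)%R];
  (* [st k.+1] is the state during the real-time interval [time k, time k.+1):
     timers act as soon as they are due. *)
  adm_timers : forall k i t, correct i ->
    (time E k <= t)%R -> (t < time E k.+1)%R ->
    ~~ timer_due (st E k.+1 i) (clock E i t) &&
    ~~ batch_due (st E k.+1 i) (clock E i t) }.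

(* Validator [i] enters view [w] during event [k]; an event may go through
   several views, hence [entered] and not just [cur_view]. *)
Definition enters (k : nat) (i : validator) (w : nat) : bool :=
  [&& correct i, w \notin entered (st E k i) & w \in entered (st E k.+1 i)].

(* [first_entry w t]: the time tau(w) is [t]. *)
Definition first_entry (w : nat) (t : R) : Prop :=
  (exists k i, enters k i w /\ time E k = t) /\
  (forall k i, enters k i w -> (t <= time E k)%R).

(* tau(w) >= GST, without presupposing that [w] is ever entered. *)
Definition post_gst (w : nat) : Prop :=
  forall t, first_entry w t -> (GST E <= t)%R.

Definition all_entered_above (w : nat) (t : R) : Prop :=
  forall i, correct i ->
    exists k w', [/\ enters k i w', w < w' & (time E k <= t)%R].

Definition earliest_all_above (w : nat) (t : R) : Prop :=
  all_entered_above w t /\ (forall t', all_entered_above w t' -> (t <= t')%R).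

End Executions.

End MonadBFT.

(* Main.v *)
(** Let [tau w] be the first entry of a correct validator into view [w].  It requires a QC
    or a TC of view [w.-1], hence a vote or a timeout of a correct validator in [w.-1]; and
    no correct validator times out in a post-GST view [w] before [tau w + theta_view].

    If [w] is post-GST with a correct leader, nobody leaves [w] before the leader acts in it
    or the timers expire.  Each way of entering [w] reaches the leader: a QC is sent to it,
    a TC is either broadcast or known to a validator which has itself sent a timeout, and in
    the latter case [f + 1] timeouts of correct validators make all the others time out.  So
    the leader acts by [tau w + 2 delta], and everybody is in [w] by [tau w + 3 delta].

    In view [v] the proposal or the recovery, which ends two delays after the last batch of
    requests (either some correct validator returns the block, or none has voted for it and
    all sign the NEC), leads to a QC by
    [tau v + 6 delta + (ceil (n / kappa) - 1) theta_interval], before any timeout of [v].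
    Hence [v.+1] is first entered through a QC of [v], which the correct leader of [v]
    spreads within [2 delta].  After [theta_view] more, either all have timed out and a TC is
    formed within [delta], or somebody is already in [v.+2], whose correct leader brings
    everybody there within [3 delta]; so [C = 5] works. *)

Require Import Defs.
From mathcomp Require Import all_boot all_order all_fingroup all_algebra.
From mathcomp Require Import reals zify lra.
From Stdlib Require List.

Set Implicit Arguments.
Unset Strict Implicit.
Unset Printing Implicit Defensive.

Import Order.TTheory GRing.Theory Num.Theory.

(** * Validity of certificates and proposals *)

(** Each handler is analysed once, for a single event: [ok] compares a state inside the handler with
    the state before it, and the rest of the execution enters only through an [event_context].
    Signatures are the link between validators: a genuine signature of a correct validator tells,
    through [origin], what that validator's own state already shows. The obstacle is that a
    validator may enter a view silently, for instance after forming a TC, or a QC out of tip votes;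
    [evidence] records what such an entry has left behind, and each handler has to supply it. The
    timing arguments run by contradiction: assuming that nobody has moved on by the deadline keeps
    the current views low, so the relevant messages are not discarded as old, and a quorum that
    should have been completed contradicts [counted]. Consecutive leaders differ only for [0 < f];
    the case [f = 0] is treated apart with the lemma below. *)

Lemma single_validator f (i j : validator f) : f = 0 -> i = j.
Proof. by move=> f0; apply: val_inj; move: i j; rewrite f0 => -[[|?] ?] [[|?] ?]. Qed.

Section Validity.

Variables (R : realType) (f : nat) (digest : eqType) (payload : Type).
Variable P : params R f digest payload.

Implicit Types (T : tip f digest) (tc : TC f digest) (q : QC f digest).
Implicit Types (p : proposal f digest payload) (vt : vote f digest).
Implicit Types (M : timeout f digest).

Lemma proposal_id_inj b w b' w' :
  proposal_id P b w = proposal_id P b' w' -> b = b' /\ w = w'.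
Proof. by move=> /(@H_inj _ _ _ _ P) [-> ->]. Qed.

Lemma valid_tipP T : valid_tip P T ->
  [/\ valid_header P (tip_header T),
      tip_id T = proposal_id P (tip_hash T) (tip_view T),
      h_view (tip_header T) = tip_view T & q_view (tip_qc T) < tip_view T].
Proof. by case: T => v d h s otc onec /= /and5P [-> /eqP -> _ /eqP -> /andP []]. Qed.

Lemma valid_tcP tc : valid_tc P tc ->
  (exists q, [/\ tc_high_tip tc = None, tc_high_qc tc = Some q, valid_qc P q &
                 q_view q < tc_view tc]) \/
  (exists T, [/\ tc_high_tip tc = Some T, tc_high_qc tc = None, valid_tip P T &
                 tip_view T <= tc_view tc]).
Proof.
case: tc => v ts [T|] qs [q|] s /= /and5P [_ _ _ _ /andP [_]] //.
  by case/and3P => vT le _; right; exists T.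
by case/and3P => vq le _; left; exists q.
Qed.

Lemma valid_tc_agg tc : valid_tc P tc -> exists ss : seq (sig f digest),
  [/\ size ss = quorum f, uniq [seq x.1 | x <- ss], {subset ss <= tc_sigs tc} &
      forall x, x \in ss -> exists t k, x.2 = STimeout digest (tc_view tc) t k].
Proof.
case: tc => v ts oT qs oq s vtc.
have : [/\ size s = quorum f, size ts = quorum f, size qs = quorum f,
  uniq [seq x.1 | x <- s] &
  [seq x.2 | x <- s] = [seq STimeout digest v x.1 x.2 | x <- zip ts qs]].
  by move: vtc => /= /and5P [/eqP ? /eqP ? /eqP ? ? /andP [/eqP ? _]].
case=> ss st sq us es; exists s; split=> //.
  by move=> x /=; rewrite mem_cat => ->.
move=> x xs; have : x.2 \in [seq x.2 | x <- s] by apply: map_f.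
by rewrite es => /mapP [[t k] _ ->]; exists t, k.
Qed.

Lemma valid_proposal_id p : valid_proposal P p ->
  p_id p = proposal_id P (b_hash (p_block p)) (p_view p) /\
  p_sig p = (leader f (p_view p), SProposal (p_id p)).
Proof. by case/and5P => _ /eqP ? /eqP ?. Qed.

Lemma valid_proposal_header p : valid_proposal P p ->
  valid_header P (header_of (p_block p)).
Proof. by case/and5P => /andP []. Qed.

(** The certificate with which [on_proposal] enters the view of [p]. *)
Definition proposal_cert p : cert f digest :=
  if p_tc p is Some tc then CertTC tc else CertQC (b_qc (p_block p)).

Lemma valid_proposal_cert p : valid_proposal P p ->
  valid_cert P (proposal_cert p) /\ (cert_view (proposal_cert p)).+1 = p_view p.
Proof.
case/and5P => /andP [/andP [vq _] _] _ _ _ /andP [lt].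
rewrite /proposal_cert; case: ifP => _.
  move=> /= /and5P [_ _ _ _ /andP [_]].
  case: eqP => [e /andP [ntc _]|_].
    by move: ntc vq e => /=; case: (p_tc p) => // _.
  by case: (p_tc p) => //= tc /and3P [-> /eqP -> _].
by case/andP => _; case: (p_tc p) => //= tc /and3P [-> /eqP ->].
Qed.

(** This is the tip that [vote_for] votes on. The default [T0] never shows: a valid proposal that is
    not fresh carries a TC with a high tip, whose header is that of its block. *)
Lemma valid_proposal_tip p T0 : valid_proposal P p ->
  let T := if fresh p then tip_of p else odflt T0 (obind (@tc_high_tip _ _) (p_tc p)) in
  [/\ valid_tip P T, tip_view T <= p_view p & tip_hash T = b_hash (p_block p)].
Proof.
move=> /and5P [_ _ _ _ /andP [lt]]; case: ifP => fr /=.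
  by move=> v; split.
case/andP => _; case: (p_tc p) => // tc /and3P [vtc /eqP ew].
have [[q [-> //]]|[T [eT _ vT le]]] := valid_tcP vtc.
rewrite /= eT /= => /eqP [e]; split=> //; first by rewrite ew ltnW.
by rewrite /tip_hash e.
Qed.

(** An ideal signature is the pair of its signer and its content, so distinct signatures of one
    content have distinct signers. *)
Lemma mem_undup_uniq_fst (ss : seq (sig f digest)) c :
  uniq ss -> (forall x, x \in ss -> x.2 = c) -> uniq [seq x.1 | x <- ss].
Proof.
move=> us h; rewrite map_inj_in_uniq // => x y xs ys e.
by rewrite [x]surjective_pairing [y]surjective_pairing e !h.
Qed.

(** By collision freeness the identifier fixes block hash and view, hence the whole signed content;
    this is why [form_qc] may group votes by identifier alone. *)
Lemma valid_vote_id vt vt' : valid_vote P vt -> valid_vote P vt' ->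
  vt_id vt = vt_id vt' ->
  vt_view vt = vt_view vt' /\ (vt_sig vt).2 = (vt_sig vt').2.
Proof.
move=> /andP [/eqP e1 /eqP ->] /andP [/eqP e2 /eqP ->] e.
by move: (e); rewrite e1 e2 => /proposal_id_inj [-> ->].
Qed.

(** * Quorum certificates formed from votes *)

Definition id_sigs d (vs : seq (vote f digest)) : seq (sig f digest) :=
  undup [seq vt_sig x | x <- vs & vt_id x == d].

Lemma id_sigsP x d vs : reflect (exists2 vt, List.In vt vs & vt_id vt = d /\ x = vt_sig vt)
  (x \in id_sigs d vs).
Proof.
rewrite mem_undup; apply: (iffP idP).
  elim: vs => //= vt vs IH; case: eqP => [e|_].
    rewrite /= inE => /orP [/eqP ->|/IH [vt' ? ?]]; first by exists vt => //; left.
    by exists vt' => //; right.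
  by move=> /IH [vt' ? ?]; exists vt' => //; right.
case=> vt + [e ->]; elim: vs => //= vt' vs IH [->|/IH h].
  by rewrite e eqxx /= mem_head.
by case: ifP => _ //=; rewrite inE h orbT.
Qed.

Lemma all_In (A : Type) (a : pred A) s x : all a s -> List.In x s -> a x.
Proof. by elim: s => //= y s IH /andP [ay /IH h] [<-|/h]. Qed.

Lemma In_all (A : Type) (a : pred A) s : (forall x, List.In x s -> a x) -> all a s.
Proof.
elim: s => //= y s IH h; rewrite h ?IH //; last by left.
by move=> x xs; apply: h; right.
Qed.

Lemma form_qcP vt vs q : valid_vote P vt -> all (valid_vote P) vs ->
  form_qc vt vs = Some q ->
  [/\ valid_qc P q, q_view q = vt_view vt, quorum f <= size (id_sigs (vt_id vt) vs) &
      {subset q_agg q <= id_sigs (vt_id vt) vs}].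
Proof.
move=> vv vvs; rewrite /form_qc -/(id_sigs _ _); case: ifP => // le [<-] /=.
split=> //; last by move=> x /mem_take.
have h x : x \in id_sigs (vt_id vt) vs -> x.2 = SVote (vt_view vt) (vt_block vt) (vt_id vt).
  move=> /id_sigsP [vt' /(all_In vvs) v' [e ->]].
  have [_ ->] := valid_vote_id v' vv e.
  by case/andP: vv => _ /eqP.
rewrite /valid_qc /=; apply/orP; right.
have/andP [-> _] := vv; rewrite /valid_agg size_takel // eqxx /=.
apply/andP; split.
  apply: (@mem_undup_uniq_fst _ (SVote (vt_view vt) (vt_block vt) (vt_id vt))).
    by rewrite take_uniq // undup_uniq.
  by move=> x /mem_take; apply: h.
by apply/allP => x /mem_take /h ->.
Qed.

Lemma form_qc_none vt vs :
  form_qc vt vs = None -> size (id_sigs (vt_id vt) vs) < quorum f.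
Proof. by rewrite /form_qc -/(id_sigs _ _); case: ltnP. Qed.

Lemma valid_qc_agg q : valid_qc P q -> 0 < q_view q -> exists d,
  [/\ size (q_agg q) = quorum f, uniq [seq x.1 | x <- q_agg q] &
      forall x, x \in q_agg q -> x.2 = SVote (q_view q) (q_block q) d].
Proof.
rewrite /valid_qc; case: eqP => [-> //|_] /= /andP [_ /and3P [/eqP s u /allP h]] _.
by exists (q_id q); split=> // x /h /eqP.
Qed.

Lemma valid_timeout_sig M : valid_timeout P M ->
  exists t k, (m_sig M).2 = STimeout digest (m_view M) t k.
Proof.
case/and3P => _ _; case: (m_tip M) => [T|]; case: (m_qc M) => [q|] //.
  by case: (m_tip_vote M) => // vt /and5P [_ _ _ _ /andP [_ /eqP ->]]; do 2!eexists.
by case/and3P => _ _ /eqP ->; do 2!eexists.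
Qed.

Lemma valid_timeout_vote M vt : valid_timeout P M -> m_tip M -> m_tip_vote M = Some vt ->
  [/\ valid_vote P vt, vt_view vt = m_view M & (vt_sig vt).1 = (m_sig M).1].
Proof.
case/and3P => _ _; case: (m_tip M) => [T|] //; case: (m_qc M) => [q|] //.
by case: (m_tip_vote M) => // vt' /and5P [? /eqP ? /eqP ? _ _] _ [<-].
Qed.

(** * Timeout certificates formed from timeout messages *)

Lemma best_qc_none (qs : seq (QC f digest)) : best_qc qs = None -> qs = [::].
Proof. by rewrite /best_qc; case: qs => //= q qs; case: (foldr _ _ _). Qed.

Lemma best_tip_none (Ts : seq (tip f digest)) : best_tip Ts = None -> Ts = [::].
Proof. by rewrite /best_tip; case: Ts => //= T Ts; case: (foldr _ _ _). Qed.

Lemma best_tip_spec (Ts : seq (tip f digest)) T : best_tip Ts = Some T ->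
  List.In T Ts /\ forall T', List.In T' Ts -> tip_view T' <= tip_view T /\
    (tip_view T' = tip_view T -> q_view (tip_qc T') <= q_view (tip_qc T)).
Proof.
elim: Ts T => //= T0 Ts IH T; rewrite /best_tip /= -/(best_tip Ts).
case e: (best_tip Ts) => [T1|]; last first.
  move=> [<-]; split; first by left.
  by rewrite (best_tip_none e) => T' [<- //|[]].
have [in1 h1] := IH _ e.
rewrite /better_tip; case: ifP => [c|/negbT c] [<-]; split.
- by left.
- move=> T' [<-|/h1 [l1 l2]]; first by split.
  case/orP: c => [lt|/andP [/eqP e1 le]]; first by split; lia.
  by split=> [|e2]; [lia|apply: leq_trans le; apply: l2; lia].
- by right.
- move=> T' [<-|/h1 //]; rewrite negb_or negb_and -!leqNgt -ltnNge in c.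
  case/andP: c => c1 /orP [/eqP c2|c2]; split=> //; try lia.
Qed.

Lemma best_qc_spec (qs : seq (QC f digest)) q : best_qc qs = Some q ->
  q \in qs /\ forall q', q' \in qs -> q_view q' <= q_view q.
Proof.
elim: qs q => //= q0 qs IH q; rewrite /best_qc /= -/(best_qc qs).
case e: (best_qc qs) => [q1|]; last first.
  move=> [<-]; rewrite mem_head; split=> // q'.
  by rewrite (best_qc_none e) inE => /eqP ->.
have [in1 h1] := IH _ e.
case: leqP => c [<-]; rewrite inE ?eqxx ?in1 ?orbT; split=> // q'.
  by rewrite inE => /orP [/eqP -> //|/h1 le]; apply: leq_trans c.
by rewrite inE => /orP [/eqP ->|/h1 //]; apply: ltnW.
Qed.

Lemma max_leq_In (A : Type) (s : seq A) (h : A -> nat) b :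
  (forall x, List.In x s -> h x <= b) -> \max_(x <- s) h x <= b.
Proof.
elim: s => [|x s IH] le; first by rewrite big_nil.
rewrite big_cons geq_max le ?IH //=; last by left.
by move=> y ys; apply: le; right.
Qed.

Lemma In_pmap (A B : Type) (h : A -> option B) s y :
  List.In y (pmap h s) <-> exists2 x, List.In x s & h x = Some y.
Proof.
elim: s => [|x s IH] /=; first by split=> // -[].
case e: (h x) => [z|] /=; split.
- by case=> [<-|/IH [x' ? ?]]; [exists x; [left|]|exists x'; [right|]].
- by case=> x' [<-|xs]; rewrite ?e; [case=> ->; left|move=> e'; right; apply/IH; exists x'].
- by move=> /IH [x' ? ?]; exists x'; [right|].
- by case=> x' [<-|xs]; [rewrite e|move=> e'; apply/IH; exists x'].
Qed.

Lemma In_mem (A : eqType) (s : seq A) x : List.In x s <-> x \in s.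
Proof.
elim: s => //= y s IH; rewrite inE; split.
  by case=> [->|/IH ->]; rewrite ?eqxx ?orbT.
by case/orP => [/eqP ->|/IH]; [left|right].
Qed.

(** Two maxima compete, that of the reported tips and that of the reported QC views. A reported tip
    lies strictly above the QC in its header; so when the tips do not win, the highest QC view is
    attained by a message reporting a bare QC, and this QC is available for the TC. *)
Lemma form_tc_valid w (Ms : seq (timeout f digest)) :
  size Ms = quorum f -> all (valid_timeout P) Ms -> all (fun M => m_view M == w) Ms ->
  uniq [seq (m_sig M).1 | M <- Ms] -> valid_tc P (form_tc w Ms).
Proof.
move=> sz va vw un.
pose ts := [seq omap (@tip_view _ _) (m_tip M) | M <- Ms].
pose qs := [seq m_qc_view M | M <- Ms].
have hM M : List.In M Ms -> m_view M = w /\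
   ((exists T, [/\ m_tip M = Some T, m_qc M = None, valid_tip P T, tip_view T <= w &
     [/\ m_qc_view M = q_view (tip_qc T), m_qc_view M < tip_view T &
       (m_sig M).2 = STimeout digest w (omap (@tip_view _ _) (m_tip M)) (m_qc_view M)]])
   \/ (exists q, [/\ m_tip M = None, m_qc M = Some q, valid_qc P q, q_view q < w &
     m_qc_view M = q_view q /\
      (m_sig M).2 = STimeout digest w (omap (@tip_view _ _) (m_tip M)) (m_qc_view M)])).
  move=> inM; have /eqP ew := all_In vw inM; split=> //.
  have /and3P [_ _] := all_In va inM; rewrite /m_qc_view.
  case: (m_tip M) => [T|]; case: (m_qc M) => [q|] //.
    case: (m_tip_vote M) => // vt /and5P [_ _ _ vT /andP [le /eqP es]]; left; exists T.
    by have [_ _ _ lt] := valid_tipP vT; split; rewrite // ?es -?ew //; split; rewrite // ew.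
  by case/and3P => vq lt /eqP es; right; exists q; split; rewrite // ?es -?ew //; split; rewrite // ew.
have zE : zip ts qs = [seq (omap (@tip_view _ _) (m_tip M), m_qc_view M) | M <- Ms].
  by rewrite /ts /qs; elim: (Ms) => //= M Ms' ->.
have qsle b : (forall M, List.In M Ms -> m_qc_view M <= b) -> max_qcs qs <= b.
  by move=> h; rewrite /max_qcs /qs big_map; apply: max_leq_In.
have leqs M : List.In M Ms -> m_qc_view M <= max_qcs qs.
  rewrite /max_qcs /qs; elim: (Ms) => //= M' Ms' IH; rewrite big_cons.
  by case=> [<-|/IH le]; rewrite leq_max ?leqnn // le orbT.
rewrite /form_tc -/ts -/qs /= !size_map sz eqxx /=.
have -> : uniq [seq x.1 | x <- [seq m_sig M | M <- Ms]] by rewrite -map_comp.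
have -> /= : [seq x.2 | x <- [seq m_sig M | M <- Ms]] ==
    [seq STimeout digest w x.1 x.2 | x <- zip ts qs].
  rewrite zE -!map_comp /comp /=; apply/eqP.
  elim: (Ms) hM => //= M Ms' IH h; rewrite IH; last by move=> M' ?; apply: h; right.
  by have [_ [[T [_ _ _ _ [_ _ ->]]]|[q [_ _ _ _ [_ ->]]]]] := h M (or_introl erefl).
have tsle T : (forall M T', List.In M Ms -> m_tip M = Some T' -> tip_view T' <= tip_view T) ->
    all (fun t => odflt 0 t <= tip_view T) ts.
  by move=> h; rewrite all_map; apply: In_all => M inM /=; case e: (m_tip M) => //=; apply: h e.
have mtle b : (forall M T', List.In M Ms -> m_tip M = Some T' -> tip_view T' <= b) ->
   max_tips ts <= b.
  move=> h; rewrite /max_tips /ts big_map; apply: max_leq_In => M inM.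
  by case e: (m_tip M) => //=; apply: h e.
case eT: (best_tip _) => [T|].
  have [inT hT] := best_tip_spec eT.
  have [M0 inM0 eM0] : exists2 M, List.In M Ms & m_tip M = Some T by apply/In_pmap.
  have hT' M T' : List.In M Ms -> m_tip M = Some T' -> tip_view T' <= tip_view T /\
    (tip_view T' = tip_view T -> q_view (tip_qc T') <= q_view (tip_qc T)).
    by move=> inM e; apply: hT; apply/In_pmap; exists M.
  have [_ [[T1 [e1 _ vT leT _]]|[q [e1 //]]]] := hM _ inM0; last by rewrite eM0 in e1.
  move: e1; rewrite eM0 => -[?]; subst T1.
  case: ltnP => lt.
    rewrite vT leT lt /= tsle; last by move=> M T' i1 i2; have [] := hT' _ _ i1 i2.
    rewrite zE !all_map /= andbT; apply/andP; split; apply: In_all => M inM /=.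
      have [_ [[T' [-> _ _ _ [_]]]|[q [-> //]]]] := hM _ inM.
      by [].
    apply/implyP; have [_ [[T' [e _ _ _ [-> _ _]]]|[q [-> //]]]] := hM _ inM.
    by rewrite e /= => /eqP [e']; apply: (hT' _ _ inM e).2.
  have T0 : 0 < tip_view T by have [_ _ _] := valid_tipP vT; lia.
  (* Here no tip exceeds [max_qcs qs], and a message with a tip reports a QC view strictly below
     that tip, so it contributes at most the predecessor of the maximum. *)
  have key b : (forall M q, List.In M Ms -> m_qc M = Some q -> q_view q <= b) ->
      max_qcs qs <= maxn b (max_qcs qs).-1.
    move=> h; apply: qsle => M inM.
    have [_ [[T' [e _ _ _ [_ l _]]]|[q [_ e _ _ [-> _]]]]] := hM _ inM.
      by have [l' _] := hT' _ _ inM e; rewrite leq_max; apply/orP; right; lia.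
    by rewrite leq_max (h _ _ inM e).
  case eq: (best_qc _) => [q|]; last first.
    suff : max_qcs qs <= maxn 0 (max_qcs qs).-1 by rewrite max0n; move: T0 lt; lia.
    apply: key => M q inM e; have : List.In q (pmap (@m_qc _ _) Ms) by apply/In_pmap; exists M.
    by rewrite (best_qc_none eq).
  have [inq hq] := best_qc_spec eq.
  have [M1 inM1 eM1] : exists2 M, List.In M Ms & m_qc M = Some q.
    by apply/In_pmap/In_mem.
  have [_ [[T1 [_ e1]]|[q1 [_ e1 vq ltq [e2 _]]]]] := hM _ inM1; first by rewrite eM1 in e1.
  move: e1; rewrite eM1 => -[?]; subst q1.
  have l1 : max_qcs qs <= maxn (q_view q) (max_qcs qs).-1.
    apply: key => M q' inM e; apply: hq; apply/In_mem/In_pmap; by exists M.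
  have l2 := leqs _ inM1.
  have e : q_view q = max_qcs qs by rewrite e2 in l2; move: l1; rewrite leq_max; lia.
  rewrite vq ltq e eqxx andbT /=; apply: leq_trans lt.
  by apply: mtle => M T' i1 i2; have [] := hT' _ _ i1 i2.
have nt M : List.In M Ms -> m_tip M = None.
  move=> inM; case e: (m_tip M) => [T|] //.
  have : List.In T (pmap (@m_tip _ _) Ms) by apply/In_pmap; exists M.
  by rewrite (best_tip_none eT).
case eq: (best_qc _) => [q|]; last first.
  have [M inM] : exists M, List.In M Ms.
    by move: sz; case: (Ms) => // M ? _; exists M; left.
  have [_ [[T [e]]|[q [_ e _ _ _]]]] := hM _ inM; first by rewrite (nt _ inM) in e.
  have : List.In q (pmap (@m_qc _ _) Ms) by apply/In_pmap; exists M.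
  by rewrite (best_qc_none eq).
have [inq hq] := best_qc_spec eq.
have [M1 inM1 eM1] : exists2 M, List.In M Ms & m_qc M = Some q.
  by apply/In_pmap/In_mem.
have [_ [[T1 [_ e1]]|[q1 [_ e1 vq ltq [e2 _]]]]] := hM _ inM1; first by rewrite eM1 in e1.
move: e1; rewrite eM1 => -[?]; subst q1.
have e : q_view q = max_qcs qs.
  apply/eqP; rewrite eqn_leq -{1}e2 leqs //=; apply: qsle => M inM.
  have [_ [[T' [e]]|[q' [_ e _ _ [-> _]]]]] := hM _ inM; first by rewrite (nt _ inM) in e.
  by apply: hq; apply/In_mem/In_pmap; exists M.
rewrite vq ltq e eqxx andbT /=; apply: leq_trans (leq0n _).
by apply: mtle => M T' i1 i2; rewrite (nt _ i1) in i2.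
Qed.

Lemma form_tc_sigs w (Ms : seq (timeout f digest)) x : x \in tc_sigs (form_tc w Ms) ->
  exists2 M, List.In M Ms & x \in timeout_sigs M.
Proof.
rewrite /form_tc /= !mem_cat => /or3P [|h|h].
- elim: Ms => //= M Ms IH; rewrite inE => /orP [/eqP ->|/IH [M' ? ?]].
    by exists M; [left|rewrite mem_head].
  by exists M'; [right|].
- move: h; case: ifP => _ //; case e: (best_tip _) => [T|] // xT.
  have [/In_pmap [M inM eM] _] := best_tip_spec e.
  by exists M; rewrite // /timeout_sigs inE !mem_cat eM /= xT orbT.
move: h; case: ifP => _ //; case e: (best_qc _) => [q|] // xq.
have [/In_mem/In_pmap [M inM eM] _] := best_qc_spec e.
by exists M; rewrite // /timeout_sigs inE !mem_cat eM /= xq !orbT.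
Qed.

(** Pigeonhole; with [B] the set of Byzantine validators, more than [f] signers include a correct
    one. *)
Lemma size_uniq_card (A : finType) (T : eqType) (h : T -> A) (ss : seq T) (B : {set A}) :
  uniq [seq h x | x <- ss] -> #|B| < size ss -> exists2 x, x \in ss & h x \notin B.
Proof.
move=> u lt; case e: (has (fun x => h x \notin B) ss); first by have /hasP := e.
suff : size ss <= #|B| by rewrite leqNgt lt.
rewrite -(size_map h) cardE; apply: uniq_leq_size => // y /mapP [x xs ->].
rewrite mem_enum; move/negbT: e; rewrite -all_predC => /allP /(_ _ xs) /=.
by rewrite negbK.
Qed.

(** * Validity of the proposals issued by a correct leader *)

Lemma valid_new_block ch w q : valid_qc P q -> valid_block P (new_block P ch w q).
Proof. by move=> v; rewrite /valid_block /valid_header /= v !eqxx. Qed.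

Definition own_proposal w (b : block f digest payload) otc onec :=
  let pid := proposal_id P (b_hash b) w in
  MkProposal w pid b (leader f w, SProposal pid) otc onec.

Lemma valid_propose_qc ch w q : valid_qc P q -> (q_view q).+1 = w ->
  valid_proposal P (own_proposal w (new_block P ch w q) None None).
Proof.
move=> v e; rewrite /valid_proposal valid_new_block //= !eqxx leqnn.
have -> : fresh (own_proposal w (new_block P ch w q) None None).
  by rewrite /fresh /= e eqxx.
by rewrite /valid_header /= v e -e ltnS leqnn !eqxx.
Qed.

Lemma valid_propose_high_qc ch tc q : valid_tc P tc -> tc_high_qc tc = Some q ->
  let w := (tc_view tc).+1 in
  valid_proposal P (own_proposal w (new_block P ch w q) (Some tc) None).
Proof.
move=> v e /=; have [[q' []]|[T []]] := valid_tcP v; rewrite e //.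
move=> _ [<-] vq lt; rewrite /valid_proposal valid_new_block //= !eqxx leqnn.
set p := own_proposal _ _ _ _; have -> : fresh p by rewrite /fresh /= e orbT.
rewrite /valid_header /= vq !eqxx leqW //= eqSS.
by rewrite eq_sym (ltn_eqF lt) v e !eqxx.
Qed.

(** The QC of the block lies below the tip, and the tip is at most at the view of the TC; so the
    proposal is not fresh in the new view, and its header only has to match that of the high tip. *)
Lemma valid_repropose tc T b : valid_tc P tc -> tc_high_tip tc = Some T ->
  valid_block P b -> header_of b = tip_header T ->
  valid_proposal P (own_proposal (tc_view tc).+1 b (Some tc) None).
Proof.
move=> v e vb eh; have [[q' []]|[T' []]] := valid_tcP v; rewrite e //.
move=> [<-] eq vT le; have [_ _ e1 e2] := valid_tipP vT.
have eb : b_view b = tip_view T by rewrite -e1 -eh.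
have eq' : q_view (b_qc b) < tip_view T by move: e2; rewrite /tip_qc -eh.
rewrite /valid_proposal vb /= !eqxx eb /fresh /= eq orbF eqSS.
rewrite (ltn_eqF (leq_trans eq' le)) v e /= eh !eqxx.
by move: le eq'; rewrite !andbT; lia.
Qed.

Lemma valid_propose_nec ch tc T ss : valid_tc P tc -> tc_high_tip tc = Some T ->
  let w := (tc_view tc).+1 in let q := tip_qc T in
  valid_agg (SNE digest w (q_view q)) ss ->
  valid_proposal P (own_proposal w (new_block P ch w q) (Some tc)
    (Some (MkNEC w (q_view q) ss))).
Proof.
move=> v e /= va; have [[q' []]|[T' []]] := valid_tcP v; rewrite e //.
move=> [<-] eq vT le; have [/andP [vq _] _ e1 e2] := valid_tipP vT.
have lt : q_view (tip_qc T) < tc_view tc by apply: leq_trans e2 le.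
rewrite /valid_proposal valid_new_block //= !eqxx leqnn.
set p := own_proposal _ _ _ _; have -> : fresh p by rewrite /fresh /= orbT.
rewrite /valid_header /= vq !eqxx leqW //= eqSS.
by rewrite eq_sym (ltn_eqF lt) v /valid_nec /= ltnS lt va.
Qed.

End Validity.

(** * The invariant of a local state *)

Section LocalInvariant.

Variables (R : realType) (f : nat) (digest : eqType) (payload : Type).
Variable P : params R f digest payload.

Local Notation state := (lstate R f digest payload).
Local Notation message := (msg f digest payload).
Local Notation signature := (sig f digest).

Implicit Types (s : state) (tc : TC f digest) (q : QC f digest).
Implicit Types (p : proposal f digest payload) (vt : vote f digest).
Implicit Types (M : timeout f digest) (m : message) (i j : validator f) (w : nat).
Implicit Types (x : signature).

Lemma hasP_In (A : Type) (a : pred A) (l : seq A) :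
  has a l <-> exists2 y, List.In y l & a y.
Proof.
elim: l => [|y l IH] /=; first by split=> // -[].
split=> [/orP [ay|/IH [z ? ?]]|[z [<- ->|zs az]]] //; first by exists y; [left|].
  by exists z; [right|].
by apply/orP; right; apply/IH; exists z.
Qed.

Definition to_all m s := forall j, List.In (j, m) (sent s).

Lemma sent_timeoutP w s : sent_timeout w s <->
  exists j M, List.In (j, MTimeout payload M) (sent s) /\ m_view M = w.
Proof.
rewrite /sent_timeout hasP_In; split; first by case=> -[j []] //= M ? /eqP; exists j, M.
by case=> j [M [? /eqP ?]]; exists (j, MTimeout payload M).
Qed.

Lemma sent_tcP w s : sent_tc w s <->
  exists j tc, List.In (j, MTC payload tc) (sent s) /\ tc_view tc = w.
Proof.
rewrite /sent_tc hasP_In; split; first by case=> -[j []] //= M ? /eqP; exists j, M.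
by case=> j [M [? /eqP ?]]; exists (j, MTC payload M).
Qed.

Lemma issuedP i w s : issued i w s <->
  exists j p, [/\ List.In (j, MProposal p) (sent s), p_view p = w & (p_sig p).1 = i].
Proof.
rewrite /issued hasP_In; split.
  by case=> -[j []] //= p ? /andP [/eqP ? /eqP ?]; exists j, p.
by case=> j [p [? /eqP ? /eqP ?]]; exists (j, MProposal p) => //=; apply/andP.
Qed.

Lemma voted_forP d s : voted_for d s <->
  exists j vt, List.In (j, MVote payload vt) (sent s) /\ vt_id vt = d.
Proof.
rewrite /voted_for hasP_In; split; first by case=> -[j []] //= M ? /eqP; exists j, M.
by case=> j [M [? /eqP ?]]; exists (j, MVote payload M).
Qed.

Lemma sent_neP w s : sent_ne w s <->
  exists j ne, List.In (j, MNE payload ne) (sent s) /\ ne_view ne = w.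
Proof.
rewrite /sent_ne hasP_In; split; first by case=> -[j []] //= M ? /eqP; exists j, M.
by case=> j [M [? /eqP ?]]; exists (j, MNE payload M).
Qed.

Lemma sent_qc_to_allP q s : sent_qc_to_all q s <-> to_all (MQC payload q) s.
Proof.
rewrite /sent_qc_to_all; split.
  move=> /allP h j; have /(_ _)/hasP_In := h j; rewrite mem_enum => /(_ isT).
  by case=> -[j' []] //= q' ? /andP [/eqP <- /eqP <-].
move=> h; apply/allP => j _; apply/hasP_In; exists (j, MQC payload q) => //=.
by rewrite !eqxx.
Qed.

(* Parameters of the analysis of one event: the validator, its clock, the
   signatures that are genuine before the event, and [led w], [fwd q], [nq w v]:
   "before the event, the leader of [w] has acted in view [w]", "the leader of
   [q_view q] has sent [q]", "the leader of [w] has requested NE votes on [v]".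
   [due w]: the event is the expiration of the timer in view [w].
   [adds_ne]: the event is the reception of an NE vote. *)
Record event_context := EventContext {
  me : validator f; clk : R; pre : state; genuine : signature -> Prop;
  led : nat -> Prop; fwd : QC f digest -> Prop; nq : nat -> nat -> Prop;
  due : nat -> Prop; adds_ne : Prop }.

Variable c : event_context.
Local Notation i := (me c).
Local Notation s0 := (pre c).

Definition all_genuine (ss : seq signature) := forall x, x \in ss -> genuine c x.

(* What the state of a correct validator shows for each signature it has made. *)
Definition origin s x : Prop :=
  match x.2 with
  | SVote w b d => w <= cur_view s /\
      (sent_timeout w s \/ exists2 p, List.In p (proposals s) & p_view p = w)
  | SProposal d => exists p,
      [/\ to_all (MProposal p) s, p_id p = d, valid_proposal P p,
          p_view p <= cur_view s & (p_sig p).1 = x.1]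
  | STimeout w _ _ => w <= cur_view s /\ sent_timeout w s
  | SNE w _ => sent_ne w s
  end.

(** Besides the signatures known before the event, a handler may send signatures that the validator
    itself makes during the event. *)
Definition good s x := genuine c x \/ x.1 = i /\ origin s x.

Definition request_inv s tc :=
  [/\ valid_tc P tc, i = leader f (tc_view tc).+1, tc_view tc < cur_view s,
      tc_high_tip tc <> None & to_all (MNERequest payload tc) s].

(** What the sending of a message guarantees. The vote clause keeps track of the copy for the leader
    of the voted view, the one counted later; a QC sent by the leader of its own view has gone to
    everybody; an NE vote remembers, through [nq], that its addressee has asked for it. *)
Definition msg_inv s (y : validator f * message) : Prop :=
  match y.2 with
  | MProposal p => valid_proposal P p
  | MVote vt =>
      [/\ valid_vote P vt, (vt_sig vt).1 = i, vt_view vt <= cur_view s,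
          List.In (leader f (vt_view vt), MVote payload vt) (sent s) &
          exists p, [/\ List.In p (proposals s), p_id p = vt_id vt & p_view p = vt_view vt]]
  | MQC q => valid_qc P q /\ (i = leader f (q_view q) -> to_all (MQC payload q) s)
  | MTimeout M =>
      [/\ valid_timeout P M, to_all (MTimeout payload M) s, (m_sig M).1 = i &
          m_view M <= cur_view s]
  | MTC tc => valid_tc P tc /\ to_all (MTC payload tc) s
  | MProposalRequest tc | MNERequest tc => request_inv s tc
  | MNE ne =>
      [/\ valid_ne ne, (ne_sig ne).1 = i, y.1 = leader f (ne_view ne) &
          nq c (ne_view ne) (ne_qc_view ne)]
  end.

Definition signed_by n (cont : content digest -> Prop) :=
  exists ss : seq signature, [/\ n <= size ss, uniq [seq x.1 | x <- ss] &
    forall x, x \in ss -> genuine c x /\ cont x.2].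

Definition timeouts_seen n w := signed_by n
  (fun y => exists t k, y = STimeout digest w t k).
Definition votes_seen w := signed_by (quorum f)
  (fun y => exists b d, y = SVote w b d).

Definition cert_seen w := [\/ w = 0, votes_seen w | timeouts_seen (quorum f) w].

Definition acted w s := i = leader f w /\ (issued i w s \/
  exists j tc, List.In (j, MNERequest payload tc) (sent s) /\ (tc_view tc).+1 = w).

Definition qc_sent_to w w' s := exists q, [/\ valid_qc P q, (q_view q).+1 = w' &
  List.In (leader f w, MQC payload q) (sent s)].

(* How the entry into view [w] becomes known to the leader of [w] (or, when it is
   due to a quorum certificate, to the leader of [w.-1]). *)
Inductive evidence w s : Prop :=
| EvStart of w = 1
| EvActed of acted w s
| EvLed of led c w & timeouts_seen (quorum f) w.-1 \/ qc_sent_to w.-1 w s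
| EvQC q of valid_qc P q & (q_view q).+1 = w &
    List.In (leader f w, MQC payload q) (sent s) &
    List.In (leader f w.-1, MQC payload q) (sent s) \/ fwd c q
| EvTimeout of sent_timeout w.-1 s & timeouts_seen (quorum f) w.-1
| EvTC tc of (tc_view tc).+1 = w & to_all (MTC payload tc) s &
    timeouts_seen (quorum f) w.-1.

(* If [leader f w.-1] is also [leader f w] (there is a single validator), it may enter
   [w] on forming a QC without acting in [w]. *)
Definition justified w s :=
  evidence w s /\ (i = leader f w -> i <> leader f w.-1 -> acted w s \/ led c w).

(** In the view that Recover serves, only a proposal ends it; hence an NE request of the current
    view leaves one of these two traces. *)
Definition request_live s tc := issued i (cur_view s) s \/
  exists2 r, recovery s = Some r & r_tc r = tc.

(** A batch smaller than [kappa P] exhausts the validators; hence the alternative on the size of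
    [r_asked]. *)
Definition recovery_inv s (r : recovery_state R f digest) :=
  [/\ tc_high_tip (r_tc r) = Some (r_tip r), request_inv s (r_tc r),
      all_genuine (tc_sigs (r_tc r)) &
      [/\ uniq (r_asked r),
          size (r_asked r) = n_validators f \/ kappa P * r_batches r <= size (r_asked r) &
          forall j, j \in r_asked r ->
            List.In (j, MProposalRequest payload (r_tc r)) (sent s)]].

(* The collected votes, tip votes and timeout messages.  They are a parameter of the
   invariant because a handler extends them before it can complete their quorums. *)
Definition book := (seq (vote f digest) * seq (vote f digest) * seq (timeout f digest))%type.
Definition book_of s : book := (votes s, tip_votes s, timeouts s).

Definition book_inv (A : book) : Prop :=
  let: (vs, tvs, Ms) := A in
  [/\ forall vt, List.In vt vs -> valid_vote P vt /\ genuine c (vt_sig vt),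
      forall vt, List.In vt tvs -> valid_vote P vt /\ genuine c (vt_sig vt) &
      (forall M, List.In M Ms -> valid_timeout P M /\ all_genuine (timeout_sigs M)) /\
      uniq [seq (m_view M, (m_sig M).1) | M <- Ms]].

(* The invariant inside a handler, relative to the state [pre c] at its start.  [X] lists the views whose entry still lacks
   evidence. *)
Record ok (A : book) (X : seq nat) s : Prop := {
  ok_cur : 0 < cur_view s -> cur_view s \in entered s;
  ok_ent : forall w, w \in entered s -> 0 < w <= cur_view s;
  ok_lqc : [/\ valid_qc P (last_qc s), q_view (last_qc s) <= (cur_view s).-1 &
               all_genuine (q_agg (last_qc s))];
  ok_cer : 0 < cur_view s -> (q_view (last_qc s)).+1 = cur_view s \/
    exists2 tc, last_tc s = Some tc & (tc_view tc).+1 = cur_view s;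
  ok_ltc : forall tc, last_tc s = Some tc -> valid_tc P tc /\ all_genuine (tc_sigs tc);
  ok_tip : local_tip s = genesis_tip P \/
    [/\ valid_tip P (local_tip s), tip_view (local_tip s) <= cur_view s &
        all_genuine (tip_sigs (local_tip s))];
  ok_hv : highest_voted_view s <= cur_view s;
  ok_hvv : 0 < highest_voted_view s -> sent_timeout (highest_voted_view s) s \/
    exists j vt, List.In (j, MVote payload vt) (sent s) /\
                 vt_view vt = highest_voted_view s;
  ok_book : book_of s = A;
  ok_bookv : book_inv A;
  ok_ne : forall ne, List.In ne (ne_votes s) -> valid_ne ne /\ genuine c (ne_sig ne);
  ok_props : forall p, List.In p (proposals s) ->
    valid_proposal P p /\ all_genuine (tip_sigs (tip_of p));
  ok_rec : forall r, recovery s = Some r -> recovery_inv s r;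
  ok_req : forall j tc, List.In (j, MNERequest payload tc) (sent s) ->
    cur_view s = (tc_view tc).+1 -> request_live s tc;
  ok_sent : forall y, List.In y (sent s) ->
    msg_inv s y /\ forall x, x \in msg_sigs y.2 -> good s x;
  ok_uniq : forall j p j' p', List.In (j, MProposal p) (sent s) ->
    List.In (j', MProposal p') (sent s) -> (p_sig p).1 = i -> (p_sig p').1 = i ->
    p_view p = p_view p' -> p_id p = p_id p';
  ok_ext : exists l, sent s = sent s0 ++ l;
  ok_mono : [/\ cur_view s0 <= cur_view s, highest_voted_view s0 <= highest_voted_view s,
     forall p, List.In p (proposals s0) -> List.In p (proposals s) &
     forall ne, List.In ne (ne_votes s0) -> List.In ne (ne_votes s)];
  ok_nes : ne_votes s = ne_votes s0 \/ adds_ne c;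
  ok_bsub : (forall vt, List.In vt (votes s0) -> List.In vt (votes s)) /\
            (forall M, List.In M (timeouts s0) -> List.In M (timeouts s));
  ok_old : {subset entered s0 <= entered s};
  ok_new : forall w, w \in entered s -> w \notin entered s0 ->
    [/\ cur_view s0 < w, cert_seen w.-1 & w \in X \/ justified w s];
  ok_timer : timer s = timer s0 /\ cur_view s = cur_view s0 \/
             timer s = clk c /\ cur_view s0 < cur_view s;
  ok_to : forall w, sent_timeout w s ->
    [\/ sent_timeout w s0, timeouts_seen f.+1 w | due c w];
  ok_newvote : forall j vt, List.In (j, MVote payload vt) (sent s) ->
    List.In (j, MVote payload vt) (sent s0) \/ cur_view s0 <= vt_view vt;
  ok_rec_pre : forall r, recovery s0 = Some r -> tc_view (r_tc r) < cur_view s0;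
  ok_rec0 : forall r, recovery s0 = Some r -> cur_view s = (tc_view (r_tc r)).+1 ->
    issued i (cur_view s) s \/ exists r', [/\ recovery s = Some r',
      r_tc r' = r_tc r, r_tip r' = r_tip r & r_start r' = r_start r];
  ok_start : forall r, recovery s = Some r -> r_start r = clk c \/
    exists2 r0, recovery s0 = Some r0 & r_start r0 = r_start r }.

Lemma book_genuine A X s : ok A X s ->
  (forall vt, List.In vt (votes s) -> valid_vote P vt /\ genuine c (vt_sig vt)) /\
  (forall M, List.In M (timeouts s) -> valid_timeout P M /\ all_genuine (timeout_sigs M)).
Proof. by move=> h; have := ok_bookv h; rewrite -(ok_book h) => -[? _ []]. Qed.

(** * Facts that persist while a handler runs *)

Definition extends s s' := [/\ forall y, List.In y (sent s) -> List.In y (sent s'),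
  cur_view s <= cur_view s' & forall p, List.In p (proposals s) -> List.In p (proposals s')].

Lemma to_all_extends m s s' : extends s s' -> to_all m s -> to_all m s'.
Proof. by case=> h _ _ a j; apply: h. Qed.

Lemma sent_timeout_extends w s s' : extends s s' -> sent_timeout w s -> sent_timeout w s'.
Proof. by case=> h _ _ /sent_timeoutP [j [M [? ?]]]; apply/sent_timeoutP; exists j, M; split; first apply: h. Qed.

Lemma issued_extends j w s s' : extends s s' -> issued j w s -> issued j w s'.
Proof. by case=> h _ _ /issuedP [k [p [? ? ?]]]; apply/issuedP; exists k, p; split=> //; apply: h. Qed.

Lemma sent_ne_extends w s s' : extends s s' -> sent_ne w s -> sent_ne w s'.
Proof. by case=> h _ _ /sent_neP [j [M [? ?]]]; apply/sent_neP; exists j, M; split; first apply: h. Qed.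

Lemma origin_extends x s s' : extends s s' -> origin s x -> origin s' x.
Proof.
move=> e; have [h1 h2 h3] := e; rewrite /origin; case: x.2 => [w b d|d|w t k|w v].
- case=> le h; split; first exact: leq_trans h2.
  case: h => [/(sent_timeout_extends e)|[p ? ?]]; [by left|right; exists p; auto].
- case=> p [? ? ? le ?]; exists p; split=> //; [exact: to_all_extends e _|exact: leq_trans h2].
- by case=> le /(sent_timeout_extends e); split; first exact: leq_trans h2.
- exact: sent_ne_extends.
Qed.

Lemma good_extends x s s' : extends s s' -> good s x -> good s' x.
Proof. by move=> e [|[? /(origin_extends e) ?]]; [left|right]. Qed.

Lemma request_extends tc s s' : extends s s' -> request_inv s tc -> request_inv s' tc.
Proof.
move=> e [? ? lt ? ?]; split=> //; last exact: to_all_extends e _.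
by case: e => _ le _; apply: leq_trans le.
Qed.

Lemma msg_inv_extends y s s' : extends s s' -> msg_inv s y -> msg_inv s' y.
Proof.
move=> e; have [h1 h2 h3] := e; rewrite /msg_inv.
case: y.2 => // [vt|q|M|tc|tc|tc].
- case=> ? ? le ? [p [? ? ?]]; split=> //; [exact: leq_trans h2|exact: h1|].
  by exists p; split; auto.
- by case=> ? h; split=> // /h /(to_all_extends e).
- by case=> ? /(to_all_extends e) ? ? le; split=> //; exact: leq_trans h2.
- by case=> ? /(to_all_extends e).
- exact: request_extends.
- exact: request_extends.
Qed.

Lemma evidence_extends w s s' : extends s s' -> evidence w s -> evidence w s'.
Proof.
move=> e; have [h1 h2 h3] := e; case.
- by move=> ?; apply: EvStart.
- case=> il h; apply: EvActed; split=> //.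
  by case: h => [/(issued_extends e)|[j [tc [? ?]]]]; [left|right; exists j, tc; auto].
- move=> l h; apply: EvLed => //.
  by case: h => [?|[q [? ? ?]]]; [left|right; exists q; split; auto].
- by move=> q v ew i1 i2; apply: (@EvQC _ _ q); auto; case: i2; auto.
- by move=> /(sent_timeout_extends e) *; apply: EvTimeout.
- by move=> tc ew a t; apply: (@EvTC _ _ tc) => //; apply: to_all_extends a.
Qed.

Lemma acted_extends w s s' : extends s s' -> acted w s -> acted w s'.
Proof.
move=> e [? h]; have [h1 _ _] := e; split=> //.
by case: h => [/(issued_extends e)|[j [tc [? ?]]]]; [left|right; exists j, tc; auto].
Qed.

Lemma justified_extends w s s' : extends s s' -> justified w s -> justified w s'.
Proof.
move=> e [/(evidence_extends e) ev h]; split=> // il ne.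
by case: (h il ne) => [/(acted_extends e)|]; [left|right].
Qed.

Lemma recovery_inv_extends r s s' : extends s s' -> recovery_inv s r -> recovery_inv s' r.
Proof.
move=> e; have [h1 _ _] := e => -[? /(request_extends e) ? ? [? ? h]].
by split=> //; split=> // j /h /h1.
Qed.

(** A view is often entered before the messages that testify to it are sent; it is therefore kept in
    [X] as a debt, which is struck off here once the evidence exists. *)
Lemma ok_discharge A w X s : ok A (w :: X) s ->
  (w \in entered s -> w \notin entered s0 -> justified w s) -> ok A X s.
Proof.
move=> h ev; case: (h); split=> // w' ent nent.
have [? ? d] := ok_new h ent nent; split=> //.
case: d; last by right.
by rewrite inE => /orP [/eqP ew|]; [right; subst w'; auto|left].
Qed.

Lemma ok_subX A X X' s : {subset X <= X'} -> ok A X s -> ok A X' s.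
Proof.
move=> sX h; case: (h); split=> // w ent nent.
have [? ? d] := ok_new h ent nent; split=> //.
by case: d; [left; auto|right].
Qed.

(** Sent messages and the Recover slot change together: [ok_req] can fail between sending an NE
    request and starting Recover, or between clearing Recover and proposing. *)
Definition upd (ms : seq (validator f * message)) r : proc R f digest payload :=
  fun s => set_recovery r (add_sent ms s).

Lemma upd_same ms s : upd ms (recovery s) s = add_sent ms s.
Proof. by case: s. Qed.

Lemma In_cat (T : Type) (y : T) l l' : List.In y (l ++ l') <-> List.In y l \/ List.In y l'.
Proof. by rewrite List.in_app_iff. Qed.

Lemma upd_extends ms r s : extends s (upd ms r s).
Proof. by split=> //= y ys; apply/In_cat; left. Qed.

Lemma sent_timeout_upd ms r w s : sent_timeout w (upd ms r s) ->
  sent_timeout w s \/ exists j M, List.In (j, MTimeout payload M) ms /\ m_view M = w.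
Proof.
case/sent_timeoutP => j [M [/In_cat [h|h] e]]; last by right; exists j, M.
by left; apply/sent_timeoutP; exists j, M.
Qed.

Lemma ok_upd A X s ms r : ok A X s -> let s' := upd ms r s in
  (forall y, List.In y ms -> msg_inv s' y /\ forall x, x \in msg_sigs y.2 -> good s' x) ->
  (forall j M, List.In (j, MTimeout payload M) ms ->
    [\/ sent_timeout (m_view M) s, timeouts_seen f.+1 (m_view M) | due c (m_view M)]) ->
  (forall j vt, List.In (j, MVote payload vt) ms -> cur_view s0 <= vt_view vt) ->
  (forall j tc, List.In (j, MNERequest payload tc) (sent s') ->
     cur_view s = (tc_view tc).+1 -> request_live s' tc) ->
  (forall r', r = Some r' -> recovery_inv s' r') ->
  (forall r0, recovery s0 = Some r0 -> cur_view s = (tc_view (r_tc r0)).+1 ->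
    issued i (cur_view s) s' \/ exists r', [/\ r = Some r',
      r_tc r' = r_tc r0, r_tip r' = r_tip r0 & r_start r' = r_start r0]) ->
  (forall r', r = Some r' -> r_start r' = clk c \/
    exists2 r0, recovery s0 = Some r0 & r_start r0 = r_start r') ->
  (forall j p, List.In (j, MProposal p) ms -> (p_sig p).1 = i ->
    forall j' p', List.In (j', MProposal p') (sent s') -> (p_sig p').1 = i ->
    p_view p = p_view p' -> p_id p = p_id p') ->
  ok A X s'.
Proof.
move=> h s' h1 h2 h3 h4 h5 h6 h7 h8; have e : extends s s' by apply: upd_extends.
case: (h); split=> //.
- move=> pos; have := (ok_hvv h) pos; case=> [/(sent_timeout_extends e)|]; first by left.
  by move=> [j [vt [? ?]]]; right; exists j, vt; split=> //; case: e => h' _ _; apply: h'.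
- move=> y /In_cat [ys|/h1 //]; have [m1 m2] := ok_sent h ys; split.
    exact: msg_inv_extends e m1.
  by move=> x /m2; apply: good_extends.
- move=> j p j' p' /In_cat [i1|i1] i2 e1 e2 ev; last exact: (h8 _ _ i1 e1 _ _ i2 e2 ev).
  move: (i2) => /In_cat [i3|i3]; first exact: (ok_uniq h i1 i3 e1 e2 ev).
  by apply/esym; apply: (h8 _ _ i3 e2 j p) => //; apply/In_cat; left.
- by have [l el] := ok_ext h; exists (l ++ ms); rewrite /= el catA.
- move=> w ent nent; have [? ? d] := ok_new h ent nent; split=> //.
  by case: d => [|/(justified_extends e)]; [left|right].
- move=> w /sent_timeout_upd [|[j [M [inM <-]]]]; first exact: (ok_to h).
  case: (h2 _ _ inM) => [st|t|d]; first exact: (ok_to h).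
    exact: Or32 t.
  exact: Or33 d.
- by move=> j vt /In_cat [/(ok_newvote h)|/h3]; [|right].
Qed.

Lemma ok_sends A X s ms : ok A X s -> let s' := add_sent ms s in
  (forall y, List.In y ms -> msg_inv s' y /\ forall x, x \in msg_sigs y.2 -> good s' x) ->
  (forall j M, List.In (j, MTimeout payload M) ms ->
    [\/ sent_timeout (m_view M) s, timeouts_seen f.+1 (m_view M) | due c (m_view M)]) ->
  (forall j vt, List.In (j, MVote payload vt) ms -> cur_view s0 <= vt_view vt) ->
  (forall j tc, ~ List.In (j, MNERequest payload tc) ms) ->
  (forall j p, List.In (j, MProposal p) ms -> (p_sig p).1 = i ->
    forall j' p', List.In (j', MProposal p') (sent s') -> (p_sig p').1 = i ->
    p_view p = p_view p' -> p_id p = p_id p') ->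
  ok A X s'.
Proof.
move=> h s'; have e : extends s s' by rewrite /s' -upd_same; apply: upd_extends.
rewrite /s' -upd_same => h1 h2 h3 h4 h5; apply: ok_upd => //.
- move=> j tc /In_cat [ys /(ok_req h ys) [|[r er et]]|/h4 //].
    by move=> /(issued_extends e) ?; left; rewrite upd_same.
  by right; exists r.
- by move=> r' /(ok_rec h); rewrite upd_same; apply: recovery_inv_extends.
- move=> r0 e0 e1; have [/(issued_extends e) ?|] := ok_rec0 h e0 e1; last by right.
  by left; rewrite upd_same.
- exact: (ok_start h).
Qed.

Lemma set_comm_ok A X s cm sc : ok A X s ->
  ok A X (LState (cur_view s) (timer s) (entered s) (last_qc s) (last_tc s)
    (local_tip s) (highest_voted_view s) (votes s) (tip_votes s) (timeouts s) (ne_votes s)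
    (proposals s) (recovery s) cm sc (sent s)).
Proof.
set s' := LState _ _ _ _ _ _ _ _ _ _ _ _ _ _ _ _ => h.
have e : extends s s' by split.
case: (h); split=> //.
- move=> w ent nent; have [? ? d] := ok_new h ent nent; split=> //.
  by case: d => [|/(justified_extends e)]; [left|right].
Qed.

Lemma ok_commit A X s q : ok A X s -> ok A X (commit q s).
Proof.
move=> h; rewrite /commit; case: (stored _ s) => // p.
have h1 : ok A X (when (fresh p) (add_spec_committed [:: p_block p]) s).
  by rewrite /when; case: ifP => // _; apply: set_comm_ok.
case: ifP => // _; case: (stored _ s) => // p'; exact: set_comm_ok.
Qed.

Lemma ok_add_proposal A X s p : ok A X s -> valid_proposal P p ->
  all_genuine (tip_sigs (tip_of p)) -> ok A X (add_proposal p s).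
Proof.
move=> h vp gp.
have in1 p' : List.In p' (rcons (proposals s) p) -> List.In p' (proposals s) \/ p' = p.
  by rewrite -cats1 => /In_cat [|[|[]]]; [left|right].
have in2 p' : List.In p' (proposals s) -> List.In p' (rcons (proposals s) p).
  by rewrite -cats1 => ?; apply/In_cat; left.
have e : extends s (add_proposal p s) by split.
case: (h); split=> //.
- by move=> p' /in1 [/(ok_props h)|->].
- move=> y ys; have [m1 m2] := ok_sent h ys.
  by split=> [|x /m2]; [exact: msg_inv_extends e m1|exact: good_extends].
- by have [? ? h3 ?] := ok_mono h; split=> // p' /h3 /in2.
- move=> w ent nent; have [? ? d] := ok_new h ent nent; split=> //.
  by case: d => [|/(justified_extends e)]; [left|right].
Qed.

Lemma ok_add_ne A X s ne : ok A X s -> adds_ne c -> valid_ne ne ->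
  genuine c (ne_sig ne) ->
  ok A X (add_ne ne s).
Proof.
move=> h an vp gp; have e : extends s (add_ne ne s) by split.
case: (h); split=> //.
- move=> ne'; rewrite /= -cats1 => /In_cat [/(ok_ne h) //|[<- //|[]]].
- have [? ? ? h4] := ok_mono h; split=> // ne' /h4 ?.
  by rewrite /= -cats1; apply/In_cat; left.
- by right.
- move=> w ent nent; have [? ? d] := ok_new h ent nent; split=> //.
  by case: d => [|/(justified_extends e)]; [left|right].
Qed.

Lemma ok_book_upd A X s vs tvs Ms : ok A X s -> book_inv (vs, tvs, Ms) ->
  (forall vt, List.In vt (votes s) -> List.In vt vs) ->
  (forall M, List.In M (timeouts s) -> List.In M Ms) ->
  ok (vs, tvs, Ms) X (LState (cur_view s) (timer s) (entered s) (last_qc s) (last_tc s)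
    (local_tip s) (highest_voted_view s) vs tvs Ms (ne_votes s)
    (proposals s) (recovery s) (committed s) (spec_committed s) (sent s)).
Proof.
set s' := LState _ _ _ _ _ _ _ _ _ _ _ _ _ _ _ _ => h hA hv hM.
have e : extends s s' by split.
case: (h); split=> //.
- by have [b1 b2] := ok_bsub h; split=> y /=; auto.
- move=> w ent nent; have [? ? d] := ok_new h ent nent; split=> //.
  by case: d => [|/(justified_extends e)]; [left|right].
Qed.

(** Applied after the vote has been sent, so that the new highest voted view already has the witness
    required by [ok_hvv]. *)
Lemma ok_vote_state A X s T w : ok A X s ->
  valid_tip P T -> tip_view T <= cur_view s -> all_genuine (tip_sigs T) ->
  w = cur_view s ->
  (sent_timeout w s \/
    exists j vt, List.In (j, MVote payload vt) (sent s) /\ vt_view vt = w) ->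
  ok A X (set_voted_view w (set_local_tip T s)).
Proof.
move=> h vT lT gT ew hw; set s' := set_voted_view _ _.
have e : extends s s' by split.
case: (h); split=> //.
- by right.
- by rewrite /= ew.
- have [? ? ? ?] := ok_mono h; split=> //=; rewrite ew.
  by apply: leq_trans (ok_hv h).
- move=> w' ent nent; have [? ? d] := ok_new h ent nent; split=> //.
  by case: d => [|/(justified_extends e)]; [left|right].
Qed.

Lemma ok_voted_view A X s w : ok A X s -> w = cur_view s ->
  (sent_timeout w s \/
    exists j vt, List.In (j, MVote payload vt) (sent s) /\ vt_view vt = w) ->
  ok A X (set_voted_view w s).
Proof.
move=> h ew hw; set s' := set_voted_view _ _.
have e : extends s s' by split.
case: (h); split=> //.
- by rewrite /= ew.
- have [? ? ? ?] := ok_mono h; split=> //=; rewrite ew.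
  by apply: leq_trans (ok_hv h).
- move=> w' ent nent; have [? ? d] := ok_new h ent nent; split=> //.
  by case: d => [|/(justified_extends e)]; [left|right].
Qed.

Lemma cert_seenP ce : valid_cert P ce -> all_genuine (cert_sigs ce) ->
  cert_seen (cert_view ce).
Proof.
case: ce => [q|tc] /= v gq.
  case: (posnP (q_view q)) => [->|pos]; first by apply: Or31.
  have [d [sz un h]] := valid_qc_agg v pos; apply: Or32.
  exists (q_agg q); rewrite sz; split=> // x xs; split; first exact: gq.
  by rewrite (h _ xs); do 2!eexists.
have [ss [sz un sub h]] := valid_tc_agg v; apply: Or33.
by exists ss; rewrite sz; split=> // x xs; split; [apply: gq; apply: sub|apply: h].
Qed.

Lemma valid_tc_seen tc : valid_tc P tc -> all_genuine (tc_sigs tc) ->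
  timeouts_seen (quorum f) (tc_view tc).
Proof.
move=> v gq; have [ss [sz un sub h]] := valid_tc_agg v.
by exists ss; rewrite sz; split=> // x xs; split; [apply: gq; apply: sub|apply: h].
Qed.

(** The certificate itself accounts for [cert_seen]; the evidence is still missing, so the new view
    joins [X]. *)
Lemma ok_enter A X s ce : ok A X s -> valid_cert P ce -> all_genuine (cert_sigs ce) ->
  ok A ((cert_view ce).+1 :: X) (enter (clk c) ce s).
Proof.
move=> h v gc; rewrite /enter; case: leqP => le; last first.
  by apply: ok_subX h => w; rewrite inE => ->; rewrite orbT.
set s' := LState _ _ _ _ _ _ _ _ _ _ _ _ _ _ _ _.
have e : extends s s' by split=> //=; rewrite leqW.
case: (h); split=> //.
- by rewrite /= mem_rcons mem_head.
- move=> w; rewrite /= mem_rcons inE => /orP [/eqP ->|/(ok_ent h)]; first by rewrite /= leqnn.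
  by move=> /andP [-> l]; rewrite (leq_trans l) ?leqW.
- rewrite /=; case: (ce) v gc le => [q|tc] //= v gc le.
  by have [? l ?] := ok_lqc h; split=> //; lia.
- by move=> _ /=; case: (ce) => [q|tc] /=; [left|right; exists tc].
- by move=> tc /=; case: (ce) v gc => [q|tc'] //= v gc; [exact: (ok_ltc h)|case=> <-].
- case: (ok_tip h) => [?|[? l ?]]; [by left|right; split=> //=].
  by rewrite (leq_trans l) ?leqW.
- by rewrite /=; apply: leq_trans (ok_hv h) _; rewrite leqW.
- by move=> r er; apply: (recovery_inv_extends e); apply: (ok_rec h).
(* An NE request sent earlier concerns at most the old view, so there is none yet for the new
   one. *)
- move=> j tc ys /= [etc]; have [[_ _ lt _ _] _] := ok_sent h ys.
  by move: (leq_trans lt le); rewrite etc ltnn.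
- move=> y ys; have [m1 m2] := ok_sent h ys.
  by split=> [|x /m2]; [exact: msg_inv_extends e m1|exact: good_extends].
- have [l ? ? ?] := ok_mono h; split=> //=; lia.
- by move=> w /(ok_old h); rewrite /= mem_rcons inE => ->; rewrite orbT.
- move=> w; rewrite /= mem_rcons inE => /orP [/eqP -> _|ent nent].
    have [l ? ? ?] := ok_mono h; split; [lia|exact: cert_seenP|by left; rewrite mem_head].
  have [? ? d] := ok_new h ent nent; split=> //.
  by case: d => [d|/(justified_extends e)]; [left; rewrite inE d orbT|right].
- by right; split=> //=; have [l ? ? ?] := ok_mono h; lia.
- move=> r /(ok_rec_pre h) lt /= [er]; have [l ? ? ?] := ok_mono h.
  by move: (leq_trans lt (leq_trans l le)); rewrite er ltnn.
Qed.

End LocalInvariant.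

(** * Proposals and recovery requests *)

Section Handlers.

Variables (R : realType) (f : nat) (digest : eqType) (payload : Type).
Variable P : params R f digest payload.
Variable c : event_context R f digest payload.
Variable ch : choices f payload.

Local Notation i := (me c).
Local Notation state := (lstate R f digest payload).
Local Notation okc := (ok P c).

Implicit Types (s : state) (tc : TC f digest) (q : QC f digest).
Implicit Types (p : proposal f digest payload) (vt : vote f digest).
Implicit Types (M : timeout f digest) (m : msg f digest payload) (j : validator f).
Implicit Types (A : book f digest) (X : seq nat) (w : nat).

Lemma In_broadcast (y : validator f * msg f digest payload) m :
  List.In y [seq (j, m) | j <- enum (validator f)] -> y.2 = m.
Proof. by move=> /List.in_map_iff [j [<- _]]. Qed.

Lemma broadcast_to_all m s : to_all m (broadcast m s).
Proof.
move=> j; apply/In_cat; right; apply/List.in_map_iff; exists j; split=> //.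
by apply/In_mem; rewrite mem_enum.
Qed.

Lemma genuine_good s (ss : seq (sig f digest)) x : all_genuine c ss -> x \in ss -> good P c s x.
Proof. by move=> h xs; left; apply: h. Qed.

Definition advances A X s s' :=
  [/\ okc A X s', extends s s' & cur_view s' = cur_view s].

Lemma advances_refl A X s : okc A X s -> advances A X s s.
Proof. by move=> h; split=> //; split. Qed.

Lemma extends_trans s s' s'' : extends s s' -> extends s' s'' -> extends s s''.
Proof.
case=> a1 b1 c1 [a2 b2 c2]; split; [by auto|exact: leq_trans b2|by auto].
Qed.

Lemma advances_trans A X A' X' s s' s'' :
  advances A X s s' -> advances A' X' s' s'' -> advances A' X' s s''.
Proof. by case=> _ e1 c1 [h e2 c2]; split=> //; [exact: extends_trans e2|rewrite c2]. Qed.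

Lemma add_sent_extends ms s : extends s (add_sent ms s).
Proof. by split=> //= y ys; apply/In_cat; left. Qed.

Lemma advances_commit A X s q : okc A X s -> advances A X s (commit q s).
Proof.
move=> h; have h' := ok_commit q h; split=> //; rewrite /commit /when.
  case: (stored _ s) => // p; case: ifP => _; case: ifP => _ //; case: (stored _ s) => //.
by case: (stored _ s) => // p; case: ifP => _; case: ifP => _ //; case: (stored _ s).
Qed.

Lemma advances_send_qc A X s q j : okc A X s -> valid_qc P q -> all_genuine c (q_agg q) ->
  (i = leader f (q_view q) -> to_all (MQC payload q) s) ->
  advances A X s (send j (MQC payload q) s).
Proof.
move=> h v gq a; have e : extends s (send j (MQC payload q) s) by apply: add_sent_extends.
split=> //; apply: ok_sends => //=; try by move=> ? ? [].
by move=> y [<-|//]; split=> [|x] /=; [split=> // /a /(to_all_extends e)|apply: genuine_good].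
Qed.

Lemma advances_broadcast_qc A X s q : okc A X s -> valid_qc P q -> all_genuine c (q_agg q) ->
  advances A X s (broadcast_qc q s) /\ to_all (MQC payload q) (broadcast_qc q s).
Proof.
move=> h v gq; rewrite /broadcast_qc; case: ifP => [/sent_qc_to_allP a|_].
  by split=> //; apply: advances_refl.
split; last exact: broadcast_to_all.
split=> //; last exact: add_sent_extends.
apply: ok_sends => //; try by move=> ? ? /In_broadcast.
move=> [j m] /In_broadcast /= ->; split=> [|x] /=; last exact: genuine_good.
by split=> // _; apply: broadcast_to_all.
Qed.

Lemma advances_broadcast_tc A X s tc : okc A X s -> valid_tc P tc -> all_genuine c (tc_sigs tc) ->
  advances A X s (broadcast (MTC payload tc) s).
Proof.
move=> h v gq; split=> //; last exact: add_sent_extends.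
apply: ok_sends => //; try by move=> ? ? /In_broadcast.
move=> [j m] /In_broadcast /= ->; split=> [|x] /=; last exact: genuine_good.
by split=> //; apply: broadcast_to_all.
Qed.

Definition proposal_genuine (b : block f digest payload) (otc : option (TC f digest)) onec :=
  [/\ all_genuine c (q_agg (b_qc b)), all_genuine c (oapp (@tc_sigs _ _) [::] otc) &
      all_genuine c (oapp (@nec_agg f digest) [::] onec)].

(** The choice [r = None] covers the return of Recover, where the slot is cleared and the proposal
    sent in one update. If the view already has its proposal, nothing is sent and [issued] holds
    anyway. *)
Lemma advances_propose_reset A X s r w b otc onec : okc A X s ->
  r = recovery s \/ r = None -> cur_view s = w -> i = leader f w ->
  valid_proposal P (own_proposal P w b otc onec) -> proposal_genuine b otc onec ->
  let s' := propose P i b otc onec (set_recovery r s) in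
  advances A X s s' /\ issued i w s'.
Proof.
move=> h hr ew il v [g1 g2 g3] s'.
pose ms := if issued i w s then [::]
  else [seq (j, MProposal (own_proposal P w b otc onec)) | j <- enum (validator f)].
have es' : s' = upd ms r s.
  rewrite /s' /propose /= ew /ms /own_proposal -il -[issued _ _ (set_recovery r s)]/(issued i w s).
  by case: ifP => // _; case: (s) => *; rewrite /upd /add_sent /= cats0.
have iss : issued i w s'.
  rewrite es' /ms; case: ifP => [|_]; first by apply: issued_extends; apply: upd_extends.
  apply/issuedP; exists i, (own_proposal P w b otc onec); split=> //.
  exact: (@broadcast_to_all _ (set_recovery r s) i).
split=> //; rewrite es'; split=> //; last exact: upd_extends.
rewrite es' in iss; have e := upd_extends ms r s.
apply: ok_upd => //; try by move=> ? ?; rewrite /ms; case: ifP => // _ /In_broadcast.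
- move=> [j m]; rewrite /ms; case: ifP => // _ iy; have /= -> := In_broadcast iy.
  split=> // x /=; rewrite inE => /orP [/eqP ->|].
    right; split=> //=; exists (own_proposal P w b otc onec); split=> //=; last by rewrite ew.
    exact: (@broadcast_to_all _ (set_recovery r s)).
  rewrite !mem_cat => /or3P [] xs; left; [exact: g1| |].
    by case: (otc) g2 xs => // tc' g2 xs; exact: g2.
  by case: (onec) g3 xs => // tc' g3 xs; exact: g3.
- by move=> j tc _ _; left; rewrite /= ew.
- move=> r' er; case: hr => er'; last by rewrite er' in er.
  by apply: (recovery_inv_extends e); apply: (ok_rec h); rewrite -er'.
- by move=> r0 _ _; left; rewrite ew.
- move=> r' er; case: hr => er'; last by rewrite er' in er.
  by apply: (ok_start h); rewrite -er'.
- move=> j p; rewrite /ms; case: ifP => [_ []|/negP niss /In_broadcast /= [->] _].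
  move=> j' p' /In_cat [ip|/In_broadcast /= [->] //] e1 e2.
  by case: niss; apply/issuedP; exists j', p'.
Qed.

Lemma set_recovery_same s : set_recovery (recovery s) s = s.
Proof. by case: s. Qed.

Lemma advances_propose A X s w b otc onec : okc A X s ->
  cur_view s = w -> i = leader f w ->
  valid_proposal P (own_proposal P w b otc onec) -> proposal_genuine b otc onec ->
  let s' := propose P i b otc onec s in
  advances A X s s' /\ issued i w s'.
Proof.
move=> h ew il v g s'.
have := advances_propose_reset h (or_introl erefl) ew il v g.
by rewrite set_recovery_same.
Qed.

Lemma advances_propose_qc A X s q : okc A X s -> valid_qc P q -> all_genuine c (q_agg q) ->
  cur_view s = (q_view q).+1 -> i = leader f (q_view q).+1 ->
  let s' := propose_qc P i ch q s in
  advances A X s s' /\ issued i (q_view q).+1 s'.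
Proof.
move=> h v gq ew il; rewrite /propose_qc ew; apply: advances_propose => //.
by apply: valid_propose_qc.
Qed.

Lemma tip_genuine tc T : all_genuine c (tc_sigs tc) -> tc_high_tip tc = Some T ->
  all_genuine c (tip_sigs T).
Proof.
case: tc => v ts oT qs oq s /= h e x xT; apply: h.
by rewrite e !mem_cat xT orbT.
Qed.

Lemma tip_qc_genuine T : all_genuine c (tip_sigs T) -> all_genuine c (q_agg (tip_qc T)).
Proof. by case: T => v d h s otc onec g x xs; apply: g; rewrite /= inE mem_cat xs orbT. Qed.

Lemma high_qc_genuine tc q : all_genuine c (tc_sigs tc) -> tc_high_qc tc = Some q ->
  all_genuine c (q_agg q).
Proof.
case: tc => v ts oT qs oq s /= h e x xT; apply: h.
by rewrite e !mem_cat xT !orbT.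
Qed.

Lemma advances_request_batch A X s r : okc A X s -> recovery s = Some r ->
  let s' := request_batch P ch s in
  advances A X s s' /\ exists r', [/\ recovery s' = Some r', r_tc r' = r_tc r,
    r_tip r' = r_tip r & r_start r' = r_start r].
Proof.
move=> h er s'; rewrite /s' /request_batch er /andthen.
set F := [seq j <- _ | _]; set js := take _ F; set ms := map _ js; set r' := MkRecovery _ _ _ _ _.
rewrite -[set_recovery _ _]/(upd ms (Some r') s).
have e := upd_extends ms (Some r') s.
have msP y : List.In y ms -> exists2 j, j \in js & y = (j, MProposalRequest payload (r_tc r)).
  by move=> /List.in_map_iff [j [<- /In_mem ?]]; exists j.
split; last by exists r'.
have [et rq g [un sz h1]] := ok_rec h er.
split=> //; apply: ok_upd => //; try by move=> ? ? /msP [].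
- move=> y /msP [j _ ->]; split; first exact: request_extends e rq.
  by move=> x; apply: genuine_good.
- move=> j tc /In_cat [ys|/msP []//] /(ok_req h ys) [/(issued_extends e) ?|[r1 er1 <-]]; first by left.
  by right; exists r' => //; move: er1; rewrite er => -[<-].
- move=> _ [<-]; split=> //; first exact: request_extends e rq.
  have uF : uniq F by rewrite filter_uniq // map_inj_uniq ?enum_uniq //; apply: perm_inj.
  have uj : uniq js by rewrite take_uniq.
  have un' : uniq (r_asked r ++ js).
    rewrite cat_uniq un uj andbT; apply/hasPn => j /mem_take.
    by rewrite mem_filter => /andP [].
  split=> //=; last first.
    move=> j; rewrite mem_cat => /orP [/h1 ?|jj]; apply/In_cat; [by left|right].
    by apply/List.in_map_iff; exists j; split=> //; apply/In_mem.
  have le_n : size (r_asked r ++ js) <= n_validators f.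
    rewrite /n_validators -[X in _ <= X]card_ord -(card_uniqP un').
    exact: max_card.
  case: sz => sz.
    by left; apply/eqP; rewrite eqn_leq le_n size_cat sz leq_addr.
  (* A full batch adds exactly [kappa P] recipients; a shorter one takes all the validators not
     asked so far. *)
  case: (leqP (kappa P) (size F)) => lF.
    by right; rewrite size_cat size_takel // mulnSr leq_add2r.
  left; rewrite /js take_oversize ?(ltnW lF) //.
  rewrite -[RHS]/((3 * f).+1) -[RHS]size_enum_ord; apply/perm_size/uniq_perm; rewrite ?enum_uniq //.
    by move: un'; rewrite /js take_oversize ?(ltnW lF).
  move=> j; rewrite mem_enum mem_cat mem_filter; case: (j \in r_asked r) => //=.
  by apply/mapP; exists (((ch_order ch)^-1)%g j); rewrite ?mem_enum // permKV.
- move=> r0 e0 e1; have [/(issued_extends e)|[r1 [e2 <- <- <-]]] := ok_rec0 h e0 e1; first by left.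
  by right; exists r'; move: e2; rewrite er => -[<-].
- by move=> _ [<-]; apply: (ok_start h er).
Qed.

Lemma advances_recover A X s tc T : okc A X s -> valid_tc P tc -> all_genuine c (tc_sigs tc) ->
  tc_high_tip tc = Some T -> cur_view s = (tc_view tc).+1 -> i = leader f (tc_view tc).+1 ->
  let s' := recover P (clk c) ch tc T s in
  advances A X s s' /\ acted c (tc_view tc).+1 s'.
Proof.
move=> h v g eT ew il s'; rewrite /s' /recover.
case: ifP => [|neg].
  (* Being below the current view, the TC of the running Recover has the same view as [tc]; the NE
     request already sent for it counts as the action of the leader. *)
  case er: (recovery s) => [r|] // le.
  have [_ [_ _ lt _ a] _ _] := ok_rec h er.
  split; first exact: advances_refl.
  split=> //; right; exists i, (r_tc r); split; first exact: a.
  by move: le lt; rewrite ew; lia.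
rewrite /andthen; set r := MkRecovery _ _ _ _ _.
pose ms := [seq (j, MNERequest payload tc) | j <- enum (validator f)].
rewrite -[set_recovery _ _]/(upd ms (Some r) s); set s1 := upd _ _ _.
have e : extends s s1 by apply: upd_extends.
have a : to_all (MNERequest payload tc) s1 by apply: (@broadcast_to_all _ (set_recovery (Some r) s)).
have rq : request_inv P c s1 tc by split; rewrite //= ?ew // eT.
have h1 : okc A X s1.
  apply: ok_upd => //; try by move=> ? ? /In_broadcast.
  - move=> [j m] /In_broadcast /= ->; split=> // x; exact: genuine_good.
  - move=> j tc' /In_cat [ys e1|/In_broadcast /= [->] _]; last by right; exists r.
    have [/(issued_extends e)|[r1 er1 e2]] := ok_req h ys e1; first by left.
    by move: neg; rewrite er1 e2 -ltnS -e1 ew ltnSn.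
  - by move=> _ [<-]; split=> //; split=> //; right; rewrite muln0.
  - move=> r0 e0 e1; have [/(issued_extends e)|[r1 [e2 e3 _ _]]] := ok_rec0 h e0 e1; first by left.
    by move: neg; rewrite e2 e3 -ltnS -e1 ew ltnSn.
  - by move=> _ [<-]; left.
have [[h2 e2 c2] _] := advances_request_batch h1 erefl.
split; last by split=> //; right; exists i, tc; split=> //; case: e2 => h3 _ _; apply: h3.
by split=> //; exact: extends_trans e2.
Qed.

Lemma In_filter (T : Type) (a : pred T) l y : List.In y (filter a l) <-> List.In y l /\ a y.
Proof.
elim: l => [|z l IH] /=; first by split=> // -[].
case: ifP => az /=; split.
- by case=> [<-|/IH [? ?]]; split=> //; [left|right].
- by case=> -[<-|ys] ay; [left|right; apply/IH].
- by move=> /IH [? ?]; split=> //; right.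
- by case=> -[ez|ys] ay; [rewrite ez ay in az|apply/IH].
Qed.

Lemma ohead_In (T : Type) (l : seq T) y : ohead l = Some y -> List.In y l.
Proof. by case: l => //= z l [<-]; left. Qed.

Lemma stored_In d s p : stored d s = Some p -> List.In p (proposals s) /\ p_id p = d.
Proof. by move=> /(@ohead_In _ _ _) /In_filter [? /eqP]. Qed.

Lemma stored_blockP h s b : stored_block h s = Some b ->
  header_of b = h /\ exists2 p, List.In p (proposals s) & p_block p = b.
Proof.
move=> /(@ohead_In _ _ _) /In_filter [/List.in_map_iff [p [eb ip]] /eqP ->].
by split=> //; exists p.
Qed.

Lemma block_qc_genuine p : all_genuine c (tip_sigs (tip_of p)) ->
  all_genuine c (q_agg (b_qc (p_block p))).
Proof. exact: (@tip_qc_genuine (tip_of p)). Qed.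

Lemma advances_propose_tc A X s tc : okc A X s -> valid_tc P tc -> all_genuine c (tc_sigs tc) ->
  cur_view s = (tc_view tc).+1 -> i = leader f (tc_view tc).+1 ->
  let s' := propose_tc P i (clk c) ch tc s in
  advances A X s s' /\ acted c (tc_view tc).+1 s'.
Proof.
move=> h v g ew il s'; rewrite /s' /propose_tc.
case eq: (tc_high_qc tc) => [q|].
  rewrite ew; have [] := @advances_propose A X s (tc_view tc).+1
    (new_block P ch (tc_view tc).+1 q) (Some tc) None h ew il.
  - exact: valid_propose_high_qc.
  - by split=> //=; apply: high_qc_genuine eq.
  by move=> ? ?; split=> //; split=> //; left.
have [[q [_ e]]|[T [eT _ vT le]]] := valid_tcP v; first by rewrite eq in e.
rewrite eT; case eb: (stored_block _ s) => [b|]; last exact: advances_recover.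
have [eh [p ip ep]] := stored_blockP eb; have [vp gp] := ok_props h ip.
have [] := @advances_propose A X s (tc_view tc).+1 b (Some tc) None h ew il.
- by apply: valid_repropose eT _ eh => //; rewrite -ep; case/and5P: vp.
- by split=> //=; rewrite -ep; apply: block_qc_genuine.
by move=> ? ?; split=> //; split=> //; left.
Qed.

Lemma advances_propose_cert A X s ce : okc A X s -> valid_cert P ce ->
  all_genuine c (cert_sigs ce) ->
  cur_view s = (cert_view ce).+1 -> i = leader f (cert_view ce).+1 ->
  let s' := propose_cert P i (clk c) ch ce s in
  advances A X s s' /\ acted c (cert_view ce).+1 s'.
Proof.
case: ce => [q|tc] h v g ew il /=; last exact: advances_propose_tc.
by have [? ?] := advances_propose_qc h v g ew il; split=> //; split=> //; left.
Qed.

End Handlers.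

(** * Timeouts, votes and proposals *)

Section Steps.

Variables (R : realType) (f : nat) (digest : eqType) (payload : Type).
Variable P : params R f digest payload.
Variable c : event_context R f digest payload.
Variable ch : choices f payload.

Local Notation i := (me c).
Local Notation s0 := (pre c).
Local Notation state := (lstate R f digest payload).
Local Notation okc := (ok P c).
Local Notation advances := (advances P c).

Implicit Types (s : state) (tc : TC f digest) (q : QC f digest).
Implicit Types (p : proposal f digest payload) (vt : vote f digest).
Implicit Types (M : timeout f digest) (m : msg f digest payload) (j : validator f).
Implicit Types (A : book f digest) (X : seq nat) (w : nat).

(** The certificate of the previous view comes from [ok_cer]. The genesis tip is never reported,
    since its view 0 does not exceed that of any QC. *)
Lemma valid_timeout_msg A X s : okc A X s -> 0 < cur_view s ->
  valid_timeout P (timeout_msg P i s).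
Proof.
move=> h pos; have [vq lq _] := ok_lqc h.
rewrite /timeout_msg; set cer := if _ then CertQC _ else _.
have [vc ec] : valid_cert P cer /\ (cert_view cer).+1 = cur_view s.
  rewrite /cer; case: eqP => [//|ne]; case: (ok_cer h pos) => // -[tc e1 e2].
  by rewrite e1 /=; have [] := ok_ltc h e1.
case: leqP => lt; rewrite /valid_timeout /= vc ec !eqxx /=.
  by rewrite vq andbT /=; lia.
case: (ok_tip h) => [e|[vT lT _]]; first by move: lt; rewrite e.
by rewrite /valid_vote /= vT lT !eqxx.
Qed.

Lemma timeout_msg_good A X s s' : okc A X s -> extends s s' ->
  sent_timeout (cur_view s) s' ->
  forall x, x \in timeout_sigs (timeout_msg P i s) -> good P c s' x.
Proof.
move=> h e st x; have [vq lq gq] := ok_lqc h.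
have le : cur_view s <= cur_view s' by case: e.
have gc : all_genuine c (cert_sigs (m_cer (timeout_msg P i s))).
  have -> : m_cer (timeout_msg P i s) = if (q_view (last_qc s)).+1 == cur_view s
    then CertQC (last_qc s) else if last_tc s is Some tc then CertTC tc else CertQC (last_qc s).
    by rewrite /timeout_msg; case: ifP.
  case: eqP => // _; case e1: (last_tc s) => [tc|] //.
  by have [] := ok_ltc h e1.
rewrite /timeout_sigs inE !mem_cat => /or3P [/eqP ->|xs|].
- by right; rewrite /timeout_msg; case: ifP => _.
- move: xs; rewrite /timeout_msg; case: leqP => //= lt xT.
  by case: (ok_tip h) => [e1|[_ _ gT]]; [move: lt; rewrite e1|left; apply: gT].
case/or3P => xs; last by left; apply: gc.
  move: xs; rewrite /timeout_msg; case: leqP => //= lt; rewrite inE => /eqP ->.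
  by right; split=> //=; split=> //; left.
by move: xs; rewrite /timeout_msg; case: leqP => //= lt xs; left; apply: gq.
Qed.

Lemma advances_time_out A X s : okc A X s -> 0 < cur_view s ->
  [\/ sent_timeout (cur_view s) s, timeouts_seen c f.+1 (cur_view s) | due c (cur_view s)] ->
  advances A X s (time_out P i s) /\ sent_timeout (cur_view s) (time_out P i s).
Proof.
move=> h pos why; rewrite /time_out; case: ifP => [st|nst].
  by split=> //; apply: advances_refl.
rewrite /andthen; set M := timeout_msg P i s.
pose ms := [seq (j, MTimeout payload M) | j <- enum (validator f)].
(* Reordered by conversion: the timeout message, once sent, is the witness for the new highest voted
   view. *)
rewrite -[broadcast _ _]/(set_voted_view (cur_view s) (add_sent ms s)).
have ew : m_view M = cur_view s by rewrite /M /timeout_msg; case: ifP.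
have a : to_all (MTimeout payload M) (add_sent ms s) by apply: broadcast_to_all.
have st : sent_timeout (cur_view s) (add_sent ms s).
  by apply/sent_timeoutP; exists i, M; split.
have e := add_sent_extends ms s.
split=> //; split=> //; apply: ok_voted_view => //; last by left.
apply: ok_sends => //; try by move=> ? ? /In_broadcast.
  move=> [j m] /In_broadcast /= ->; split; last exact: timeout_msg_good h e st.
  split=> //=; [exact: valid_timeout_msg h pos|by rewrite /M /timeout_msg; case: ifP|by rewrite ew].
by move=> j M' /In_broadcast /= [->]; rewrite ew.
Qed.

Lemma valid_header_inj (h h' : header f digest) : valid_header P h -> valid_header P h' ->
  h_hash h = h_hash h' -> h = h'.
Proof.
case: h h' => [v ph q b] [v' ph' q' b'] /andP [_ /eqP /= ->] /andP [_ /eqP /= ->].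
by move=> /= e; case: (@H_inj _ _ _ _ P _ _ e) => -> -> ->.
Qed.

(** Collision freeness, first for the identifier and then for the block hash. So Recover may accept
    any valid proposal with the identifier it is looking for. *)
Lemma same_id_header p T : valid_proposal P p -> valid_tip P T -> p_id p = tip_id T ->
  header_of (p_block p) = tip_header T.
Proof.
move=> vp vT; have [-> _] := valid_proposal_id vp; have [vh -> _ _] := valid_tipP vT.
case/proposal_id_inj => e _; apply: valid_header_inj => //.
exact: valid_proposal_header.
Qed.

(** If the validator has left the view of Recover, the result is dropped; this is sound since
    [ok_req] and [ok_rec0] speak of the current view only. *)
Lemma advances_recover_return A X s r b onec w : okc A X s -> recovery s = Some r ->
  w = (tc_view (r_tc r)).+1 ->
  valid_proposal P (own_proposal P w b (Some (r_tc r)) onec) ->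
  proposal_genuine c b (Some (r_tc r)) onec ->
  let s' := recover_return r (propose P i b (Some (r_tc r)) onec) s in
  advances A X s s' /\ (cur_view s = w -> issued i w s').
Proof.
move=> h er ew v g s'; rewrite /s' /recover_return /andthen /when -ew.
case: eqP => [e1|ne].
  have [_ [_ il _ _ _] _ _] := ok_rec h er.
  rewrite -ew in il.
  by have [] := advances_propose_reset h (or_intror erefl) e1 il v g.
split=> //; have -> : set_recovery None s = upd [::] None s.
  by rewrite /upd /add_sent /=; case: (s) => *; rewrite /= cats0.
have e := upd_extends [::] None s.
split=> //; apply: ok_upd => //.
- move=> j tc; rewrite /= cats0 => ys ec; have [/(issued_extends e)|] := ok_req h ys ec; first by left.
  by case=> r'; rewrite er => -[<-] etc; case: ne; rewrite ew etc.
- move=> r0 e0 e1; have [/(issued_extends e)|[r1 [e2 e3 _ _]]] := ok_rec0 h e0 e1; first by left.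
  by case: ne; rewrite e1 ew -e3; move: e2; rewrite er => -[<-].
Qed.

Lemma tip_tc_genuine p tc : all_genuine c (tip_sigs (tip_of p)) -> p_tc p = Some tc ->
  all_genuine c (tc_sigs tc).
Proof. by move=> g e x xs; apply: g; rewrite /= inE !mem_cat e xs !orbT. Qed.

Lemma proposal_cert_genuine p : all_genuine c (tip_sigs (tip_of p)) ->
  all_genuine c (cert_sigs (proposal_cert p)).
Proof.
rewrite /proposal_cert => g; case e: (p_tc p) => [tc|] /=; first exact: tip_tc_genuine e.
exact: block_qc_genuine.
Qed.

Lemma advances_recover_on_proposal A X s p : okc A X s -> valid_proposal P p ->
  all_genuine c (tip_sigs (tip_of p)) ->
  let s' := recover_on_proposal P i p s in
  advances A X s s' /\ forall r, recovery s = Some r -> p_id p = tip_id (r_tip r) ->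
    cur_view s = (tc_view (r_tc r)).+1 -> issued i (cur_view s) s'.
Proof.
move=> h v g s'; rewrite /s' /recover_on_proposal /when.
case er: (recovery s) => [r|]; last by split=> //; apply: advances_refl.
case: eqP => [eid|ne]; last by split=> [|_ [<-] //]; apply: advances_refl.
have [eT [vt _ _ _ _] gt _] := ok_rec h er.
have [[q [e _ _ _]]|[T [eT' _ vT _]]] := valid_tcP vt; first by rewrite eT in e.
move: eT'; rewrite eT => -[?]; subst T.
have [||a b] := @advances_recover_return A X s r (p_block p) None _ h er erefl.
- by apply: valid_repropose eT _ _ => //; [case/and5P: v|apply: same_id_header].
- by split=> //=; apply: block_qc_genuine.
by split=> // _ [<-] _ e; rewrite e; apply: b.
Qed.

Definition ne_sigs w v (l : seq (ne_vote f digest)) :=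
  undup [seq ne_sig ne | ne <- l & (ne_view ne == w) && (ne_qc_view ne == v)].

Lemma ne_sigsP x w v l : x \in ne_sigs w v l <->
  exists ne, [/\ List.In ne l, ne_view ne = w, ne_qc_view ne = v & ne_sig ne = x].
Proof.
rewrite mem_undup -In_mem List.in_map_iff; split.
  by case=> ne [<- /In_filter [? /andP [/eqP ? /eqP ?]]]; exists ne.
by case=> ne [? ew ev ex]; exists ne; split=> //; apply/In_filter; rewrite ew ev !eqxx.
Qed.

Lemma advances_recover_on_ne A X s : okc A X s ->
  let s' := recover_on_ne P i ch s in
  advances A X s s' /\ forall r, recovery s = Some r ->
    cur_view s = (tc_view (r_tc r)).+1 ->
    quorum f <= size (ne_sigs (tc_view (r_tc r)).+1 (q_view (tip_qc (r_tip r))) (ne_votes s)) ->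
    issued i (cur_view s) s'.
Proof.
move=> h s'; rewrite /s' /recover_on_ne /when.
case er: (recovery s) => [r|]; last by split=> //; apply: advances_refl.
rewrite -/(ne_sigs _ _ _); set ss := ne_sigs _ _ _.
case: ifP => le; last first.
  by split=> [|_ [<-] _]; [apply: advances_refl|rewrite -/ss le].
have [eT [vt _ _ _ _] gt _] := ok_rec h er.
have hs x : x \in ss ->
    x.2 = SNE digest (tc_view (r_tc r)).+1 (q_view (tip_qc (r_tip r))) /\ genuine c x.
  move=> /ne_sigsP [ne [/(ok_ne h) [/eqP vne g] ew ev <-]].
  by rewrite vne ew ev.
have [||a b] := @advances_recover_return A X s r
  (new_block P ch (tc_view (r_tc r)).+1 (tip_qc (r_tip r)))
  (Some (MkNEC (tc_view (r_tc r)).+1 (q_view (tip_qc (r_tip r))) (take (quorum f) ss)))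
  _ h er erefl.
- apply: valid_propose_nec => //; rewrite /valid_agg size_takel // eqxx /=.
  apply/andP; split; last by apply/allP => x /mem_take /hs [-> _].
  apply: (@mem_undup_uniq_fst _ _ _ (SNE digest (tc_view (r_tc r)).+1 (q_view (tip_qc (r_tip r))))).
    by rewrite take_uniq // undup_uniq.
  by move=> x /mem_take /hs [].
- split=> //=; last by move=> x /mem_take /hs [].
  by apply: tip_qc_genuine; apply: tip_genuine gt eT.
by split=> // _ [<-] e _; rewrite e; apply: b.
Qed.

Lemma vote_tip_genuine p T0 : valid_proposal P p -> all_genuine c (tip_sigs (tip_of p)) ->
  all_genuine c (tip_sigs
    (if fresh p then tip_of p else odflt T0 (obind (@tc_high_tip _ _) (p_tc p)))).
Proof.
move=> /and5P [_ _ _ _ /andP [_]] + g; case: ifP => // _ /andP [_].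
case e: (p_tc p) => [tc|] //= /and3P [v _].
case eT: (tc_high_tip tc) => [T|] //= _.
exact: tip_genuine (tip_tc_genuine g e) eT.
Qed.

Lemma advances_vote_for A X s p : okc A X s -> valid_proposal P p ->
  all_genuine c (tip_sigs (tip_of p)) -> List.In p (proposals s) -> cur_view s = p_view p ->
  let s' := vote_for P i p s in
  advances A X s s' /\ p_view p <= highest_voted_view s'.
Proof.
move=> h v g ip ew s'; rewrite /s' /vote_for.
case: ltnP => [lt|le]; last by split=> //; apply: advances_refl.
have [vT lT eT] := valid_proposal_tip (local_tip s) v.
have gT := @vote_tip_genuine p (local_tip s) v g.
move: vT lT eT gT; set T := if _ then _ else _ => vT lT eT gT.
pose vt := make_vote P i (cur_view s) (tip_hash T).
pose s1 := add_sent [:: (leader f (cur_view s), MVote payload vt)] s.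
pose s2 := add_sent [:: (leader f (cur_view s).+1, MVote payload vt)] s1.
rewrite /andthen -[set_voted_view _ _]/(set_voted_view (cur_view s) (set_local_tip T s2)).
have [eid _] := valid_proposal_id v.
(* Stated for any later state of the handler, as the vote goes out twice, to the leaders of the
   current and of the next view. *)
have vv s3 : cur_view s3 = cur_view s -> List.In p (proposals s3) ->
    List.In (leader f (cur_view s), MVote payload vt) (sent s3) ->
    forall j, msg_inv P c s3 (j, MVote payload vt) /\
      forall x, x \in msg_sigs (MVote payload vt) -> good P c s3 x.
  move=> ec ip' iv j; split.
    split=> //=; [by rewrite /valid_vote /= !eqxx|by rewrite ec|].
    by exists p; split=> //; rewrite eid eT ew.
  move=> x /=; rewrite inE => /eqP ->; right; split=> //; rewrite /origin /= ec; split=> //.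
  by right; exists p.
have i1 : List.In (leader f (cur_view s), MVote payload vt) (sent s1).
  by apply/In_cat; right; left.
have le0 : cur_view s0 <= cur_view s by have [] := ok_mono h.
have h1 : okc A X s1.
  apply: ok_sends => //; try by move=> ? ? [].
    by move=> y [<-|//]; apply: vv.
  by move=> j vt' [[_ <-]|].
have h2 : okc A X s2.
  apply: ok_sends => //; try by move=> ? ? [].
    move=> y [<-|//]; apply: vv => //; apply/In_cat; by left.
  by move=> j vt' [[_ <-]|].
have i2 : List.In (leader f (cur_view s), MVote payload vt) (sent s2).
  by apply/In_cat; left.
split; last by rewrite /= ew.
split=> //.
- apply: ok_vote_state => //; first by rewrite /= ew.
  by right; exists (leader f (cur_view s)), vt.
- by apply: extends_trans (add_sent_extends _ _) (add_sent_extends _ _).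
Qed.

Lemma enter_extends s ce : extends s (enter (clk c) ce s).
Proof. by rewrite /enter; case: leqP => // le; split=> //=; rewrite leqW. Qed.

Lemma enter_cur s ce : cur_view (enter (clk c) ce s) = maxn (cur_view s) (cert_view ce).+1.
Proof.
rewrite /enter; case: leqP => le /=; last by rewrite (maxn_idPl le).
by apply/esym/maxn_idPr; rewrite leqW.
Qed.

(** What is known of a delivered message: its signatures are genuine, a message to oneself has
    really been sent, and a sender that leads the relevant view has acted in it. With the contexts
    of the execution, the promises about a leader are void if the leader is Byzantine. *)
Definition received j m :=
  [/\ all_genuine c (msg_sigs m), j = i -> List.In (i, m) (sent s0) &
  match m with
  | MProposal p => j = leader f (p_view p) -> valid_proposal P p -> led c (p_view p)
  | MQC q => j = leader f (q_view q) -> valid_qc P q -> fwd c q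
  | MProposalRequest tc =>
      j = leader f (tc_view tc).+1 -> valid_tc P tc -> led c (tc_view tc).+1
  | MNERequest tc =>
      j = leader f (tc_view tc).+1 -> valid_tc P tc -> led c (tc_view tc).+1 /\
        forall T, tc_high_tip tc = Some T -> nq c (tc_view tc).+1 (q_view (tip_qc T))
  | _ => True
  end].

Lemma ok_on_proposal A j p : okc A [::] s0 -> received j (MProposal p) ->
  let s' := on_proposal P i (clk c) j p s0 in
  [/\ okc A [::] s', extends s0 s' & valid_proposal P p ->
    [/\ List.In p (proposals s'),
        j = leader f (p_view p) -> p_view p <= cur_view s' /\
          (cur_view s0 <= p_view p -> p_view p <= highest_voted_view s') &
        forall r, recovery s0 = Some r -> p_id p = tip_id (r_tip r) ->
          cur_view s0 = (tc_view (r_tc r)).+1 -> issued i (cur_view s0) s']].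
Proof.
move=> h [g self led_j] s'; rewrite /s' /on_proposal.
case: ifP => [v|nv]; last by split=> //; split.
rewrite /andthen; set s1 := add_proposal p s0; set s2 := recover_on_proposal _ _ _ _.
have e1 : extends s0 s1 by split=> //= y ys; rewrite -cats1; apply/In_cat; left.
have h1 : okc A [::] s1 by apply: ok_add_proposal.
have [[h2 e2 c2] rec2] := advances_recover_on_proposal h1 v g.
have ip2 : List.In p (proposals s2).
  by case: e2 => _ _; apply; rewrite /= -cats1; apply/In_cat; right; left.
have e02 : extends s0 s2 by apply: extends_trans e2.
have cur2 : cur_view s2 = cur_view s0 by rewrite c2.
rewrite /when; case: ifP => [/andP [/eqP ej le]|cond]; last first.
  split=> // _; split=> // ej; move: cond; rewrite ej eqxx /= cur2 => /negbT.
  by rewrite -ltnNge => lt; split; [rewrite ltnW // cur2|rewrite leqNgt lt].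
have [vc ec] := valid_proposal_cert v; have gc := proposal_cert_genuine g.
rewrite -/(proposal_cert p).
set s3 := enter _ _ _.
have h3 : okc A [:: p_view p] s3 by rewrite -ec; apply: ok_enter.
have e3 : extends s2 s3 by apply: enter_extends.
have c3 : cur_view s3 = p_view p by rewrite enter_cur ec; apply/maxn_idPr; rewrite cur2.
have vq : valid_qc P (b_qc (p_block p)) by case/andP: (valid_proposal_header v).
have gq := block_qc_genuine g.
set q := b_qc (p_block p) in vq gq *.
set s4 := (if (q_view q).+1 == p_view p then _ else _) .
(* If the QC of the block is of the previous view, it is forwarded to the leader of that view;
   otherwise the proposal carries a TC, which shows a quorum of timeouts. *)
have [[h4 e4 c4] ev4] : advances A [:: p_view p] s3 s4 /\
    (timeouts_seen c (quorum f) (p_view p).-1 \/ qc_sent_to P (p_view p).-1 (p_view p) s4).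
  rewrite /s4; case: eqP => [ew|ne]; last first.
    split; first exact: advances_refl.
    left; move: vc ec gc; rewrite /proposal_cert; case: (p_tc p) => [tc|] /=.
      by move=> vtc <- gtc; apply: valid_tc_seen vtc gtc.
    by move=> _ e; case: ne.
  set s5 := (if _ then broadcast_qc q s3 else s3).
  have [a5 b5] : advances A [:: p_view p] s3 s5 /\
      (i = leader f (q_view q) -> to_all (MQC payload q) s5).
    rewrite /s5; case: eqP => [il|ne].
      by have [? ?] := advances_broadcast_qc h3 vq gq.
    by split=> //; apply: advances_refl.
  split; last first.
    right; exists q; rewrite -ew /=; split=> //; apply/In_cat; right; by left.
  by have [h5 _ _] := a5; apply: advances_trans a5 (advances_send_qc _ h5 vq gq b5).
have h4' : okc A [::] s4.
  apply: ok_discharge h4 _ => _ _; split; last by right; apply: led_j.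
  by apply: EvLed; [apply: led_j|exact: ev4].
have a6 := advances_commit q h4'; have [h6 e6 c6] := a6.
have e26 : extends s2 (commit q s4) by apply: extends_trans (extends_trans e3 e4) e6.
have ip6 : List.In p (proposals (commit q s4)) by case: e26 => _ _; apply.
have c46 : cur_view (commit q s4) = p_view p by rewrite c6 c4.
have [[h7 e7 c7] hv7] := advances_vote_for h6 v g ip6 c46.
have e27 := extends_trans e26 e7.
split=> //; first exact: extends_trans e27.
move=> _; split; first by case: e7 => _ _; apply.
  by move=> _; split=> //; rewrite c7 c46.
move=> r er eid ecur; apply: issued_extends e27 _.
by rewrite -cur2 c2; apply: rec2 er eid ecur.
Qed.
End Steps.

(** * Message handlers *)

Section Counting.

Variables (R : realType) (f : nat) (digest : eqType) (payload : Type).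
Variable P : params R f digest payload.
Variable c : event_context R f digest payload.
Variable ch : choices f payload.

Local Notation i := (me c).
Local Notation s0 := (pre c).
Local Notation state := (lstate R f digest payload).
Local Notation okc := (ok P c).
Local Notation advances := (advances P c).
Local Notation received := (received P c).

Implicit Types (s : state) (tc : TC f digest) (q : QC f digest).
Implicit Types (p : proposal f digest payload) (vt : vote f digest).
Implicit Types (M : timeout f digest) (m : msg f digest payload) (j : validator f).
Implicit Types (A : book f digest) (X : seq nat) (w : nat).

Definition timeouts_of w (Ms : seq (timeout f digest)) := [seq M <- Ms | m_view M == w].

(* The quorums that have been collected for the current view or a later one are
   still incomplete. *)
Record counted s : Prop := {
  cn_votes : forall vt, List.In vt (votes s) -> cur_view s <= vt_view vt ->
    size (id_sigs (vt_id vt) (votes s)) < quorum f;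
  cn_timeouts : forall w, cur_view s <= w ->
    size (timeouts_of w (timeouts s)) < quorum f;
  cn_sent : forall w, f < size (timeouts_of w (timeouts s)) -> sent_timeout w s;
  cn_tips : forall vt, List.In vt (tip_votes s) -> cur_view s <= vt_view vt ->
    exists M, [/\ List.In M (timeouts s), m_view M = vt_view vt &
                  (m_sig M).1 = (vt_sig vt).1] }.

Lemma counted_extends s s' : counted s -> extends s s' -> book_of s' = book_of s ->
  counted s'.
Proof.
case=> c1 c2 c3 c4 e; have [_ le _] := e; rewrite /book_of => -[ev et eM].
split; rewrite ?ev ?et ?eM.
- by move=> vt iv lv; apply: c1 => //; apply: leq_trans lv.
- by move=> w lw; apply: c2; apply: leq_trans lw.
- by move=> w /c3; apply: sent_timeout_extends.
- by move=> vt iv lv; apply: c4 => //; apply: leq_trans lv.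
Qed.

Lemma enter_same A X s ce : okc A X s -> valid_cert P ce -> all_genuine c (cert_sigs ce) ->
  cur_view s <= (cert_view ce).+1 ->
  [/\ okc A ((cert_view ce).+1 :: X) (enter (clk c) ce s),
      extends s (enter (clk c) ce s) &
      cur_view (enter (clk c) ce s) = (cert_view ce).+1].
Proof.
move=> h v g le; split; [exact: ok_enter|exact: enter_extends|].
by rewrite enter_cur; apply/maxn_idPr.
Qed.

Lemma to_all_issued w s : issued i w s -> i = leader f w -> acted c w s.
Proof. by move=> h il; split=> //; left. Qed.

Lemma ok_start_event A : okc A [::] s0 -> cur_view s0 = 0 ->
  let s' := start P i (clk c) ch s0 in okc A [::] s' /\ extends s0 s'.
Proof.
move=> h e0 s'; rewrite /s' /start /andthen.
have vg : valid_qc P (genesis_qc P) by rewrite /valid_qc eqxx.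
have gg : all_genuine c (q_agg (genesis_qc P)) by [].
have [|h1 e1 c1] := @enter_same A [::] s0 (CertQC (genesis_qc P)) h vg gg.
  by rewrite e0.
rewrite /when; case: eqP => [il|ne]; last first.
  split=> //; apply: ok_discharge h1 _ => _ _; split; first exact: EvStart.
  by move=> il; case: ne.
have [[h2 e2 c2] iss] := @advances_propose_qc _ _ _ _ _ _ ch _ _ _ _ h1 vg gg c1 il.
split; last exact: extends_trans e2.
apply: ok_discharge h2 _ => _ _; split; first exact: EvStart.
by move=> _ _; left; split=> //; left.
Qed.

Lemma ok_on_vote j vt : okc (book_of s0) [::] s0 -> counted s0 ->
  received j (MVote payload vt) ->
  let s' := on_vote P i (clk c) ch vt s0 in
  [/\ okc (book_of s') [::] s', extends s0 s', counted s' &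
      valid_vote P vt -> i = leader f (vt_view vt) ->
      List.In vt (votes s') \/ vt_view vt < cur_view s'].
Proof.
move=> h cn [g _ _] s'; rewrite /s' /on_vote.
case: ifP => [/and3P [v le il]|cond]; last first.
  split=> // v il; right; move: cond; rewrite v il eqxx /= andbT => /negbT.
  by rewrite -ltnNge.
set s1 := add_vote vt s0.
have h1 : okc (rcons (votes s0) vt, tip_votes s0, timeouts s0) [::] s1.
  have [b1 b2 b3] := ok_bookv h; apply: (ok_book_upd h) => //; last first.
    by move=> vt' iv; rewrite -cats1; apply/In_cat; left.
  split=> //.
  move=> vt'; rewrite -cats1 => /In_cat [/b1 //|[<-|//]]; split=> //.
  by apply: g; rewrite mem_head.
have e1 : extends s0 s1 by split.
have ivt : List.In vt (votes s1) by rewrite /= -cats1; apply/In_cat; right; left.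
have av : all (valid_vote P) (votes s1).
  by apply: In_all => vt' /(book_genuine h1).1 [].
case eq: (form_qc _ _) => [q|]; last first.
  split=> //; last by left.
  have sz := form_qc_none eq; case: (cn) => c1 c2 c3 c4; split=> // vt' iv' lv'.
  case: (vt_id vt' =P vt_id vt) => [-> //|ne].
  suff -> : id_sigs (vt_id vt') (votes s1) = id_sigs (vt_id vt') (votes s0).
    apply: c1 => //; move: iv'; rewrite /= -cats1 => /In_cat [//|[e|//]].
    by case: ne; rewrite e.
  by rewrite /id_sigs /= filter_rcons; case: eqP => // e; case: ne.
have [vq ew sz sub] := form_qcP v av eq.
have gq : all_genuine c (q_agg q).
  move=> x /sub /id_sigsP [vt' iv' [_ ->]].
  by have [] := (book_genuine h1).1 _ iv'.
rewrite /andthen; have le1 : cur_view s1 <= (cert_view (CertQC q)).+1 by rewrite /= ew leqW.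
have [h2 e2 c2] := @enter_same _ _ _ (CertQC q) h1 vq gq le1.
have [h3 e3 c3] := advances_commit q h2.
set s3 := commit q _ in h3 e3 c3 *.
have e13 : extends s1 s3 by apply: extends_trans e3.
have c3' : cur_view s3 = (q_view q).+1 by rewrite c3 c2.
suff: forall s', advances (book_of s1) [:: (q_view q).+1] s3 s' ->
    justified P c (q_view q).+1 s' ->
    [/\ okc (book_of s') [::] s', extends s0 s', counted s' &
      valid_vote P vt -> i = leader f (vt_view vt) ->
      List.In vt (votes s') \/ vt_view vt < cur_view s'].
  case: eqP => [il1|nl] fin.
    have [a5 b5] := advances_broadcast_qc h3 vq gq; apply: fin a5 _; split.
      by apply: (EvQC (q := q)) => //; left; exact: b5.
    by move=> _ []; rewrite /= ew.
  have il2 : i = leader f (q_view q).+1 by rewrite ew; move: il; case: eqP => //= _ /eqP.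
  have [a5 b5] := @advances_propose_qc _ _ _ _ _ _ ch _ _ _ _ h3 vq gq c3' il2.
  apply: fin a5 _; split; first by apply: EvActed; exact: to_all_issued.
  by move=> _ _; left; exact: to_all_issued.
move=> s4 [h4 e4 c4] just; have bk := ok_book h4.
have e14 : extends s1 s4 by apply: extends_trans e4.
have cur4 : cur_view s4 = (vt_view vt).+1 by rewrite c4 c3' ew.
split; rewrite ?cur4 //.
- by rewrite bk; apply: ok_discharge h4 _.
(* The quorum just completed belongs to a view that has been left; for every other identifier the
   collected votes are those of before. *)
- move: bk; rewrite /book_of => -[ev et eM]; case: (cn) => c1 c2' c3'' c4'.
  split; rewrite ?ev ?et ?eM ?cur4.
  + move=> vt' iv' lv'; have lv0 : cur_view s0 <= vt_view vt' by lia.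
    have vv' := all_In av iv'.
    have ne : vt_id vt' <> vt_id vt.
      by move=> /(valid_vote_id vv' v) [ee _]; move: lv'; rewrite ee ltnn.
    have -> : id_sigs (vt_id vt') (votes s1) = id_sigs (vt_id vt') (votes s0).
      by rewrite /id_sigs /= filter_rcons; case: eqP => // e; case: ne.
    apply: c1 => //; move: iv'; rewrite /= -cats1 => /In_cat [//|[e|//]].
    by case: ne; rewrite e.
  + by move=> w lw; apply: c2'; lia.
  + by move=> w /c3''; apply: sent_timeout_extends.
  + by move=> vt' iv' lv'; apply: c4' => //; lia.
by move=> _ _; right.
Qed.

Lemma finish s : okc (book_of s0) [::] s -> extends s0 s -> counted s0 ->
  okc (book_of s) [::] s /\ counted s.
Proof.
move=> h e cn; have eb := ok_book h; split; first by rewrite eb.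
exact: counted_extends cn e eb.
Qed.

Lemma ok_on_qc j q : okc (book_of s0) [::] s0 -> counted s0 ->
  received j (MQC payload q) ->
  let s' := on_qc P i (clk c) ch j q s0 in
  [/\ okc (book_of s') [::] s', extends s0 s', counted s' &
    valid_qc P q ->
    (j = leader f (q_view q) \/ i = leader f (q_view q).+1 -> q_view q < cur_view s') /\
    (i = leader f (q_view q) -> q_view q < cur_view s0 \/ to_all (MQC payload q) s')].
Proof.
move=> h cn [g self fw] s'; rewrite /s' /on_qc.
case: ifP => [/andP [v le]|cond]; last first.
  split=> // v; move: cond; rewrite v /= => /negbT; rewrite -ltnNge => lt.
  by split=> // _; left.
rewrite /andthen; set w := (q_view q).+1; set X := [:: w].
set s1 := when (j == _) _ s0.
have [h1 e1 [c1 l1]] : [/\ okc (book_of s0) X s1, extends s0 s1 & cur_view s1 <= w /\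
    (j = leader f (q_view q) -> cur_view s1 = w /\ List.In (leader f w, MQC payload q) (sent s1))].
  rewrite /s1 /when; case: eqP => [ej|ne]; last first.
    by split; rewrite ?(leqW le) //; apply: ok_subX h.
  have [h2 e2 c2] := @enter_same _ _ _ (CertQC q) h v g (leqW le).
  have a3 := advances_commit q h2; have [h3 e3 c3] := a3.
  (* If [i] leads the view of [q], the sender is [i] itself, and a QC that a leader of its view
     sends has gone to everybody. *)
  have toall : i = leader f (q_view q) -> to_all (MQC payload q) (commit q (enter (clk c) (CertQC q) s0)).
    move=> il; have ij : j = i by rewrite il.
    have [[_ a] _] := ok_sent h (self ij).
    by apply: to_all_extends (a il); apply: extends_trans e3.
  have [h4 e4 c4] := advances_send_qc (leader f w) h3 v g toall.
  split=> //; first by apply: extends_trans (extends_trans e2 e3) e4.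
  rewrite c4 c3 c2; split=> // _; split=> //.
  by apply/In_cat; right; left.
set s2 := when (i == _) _ s1.
have [a2 b2] : advances (book_of s0) X s1 s2 /\
    (i = leader f (q_view q) -> to_all (MQC payload q) s2).
  rewrite /s2 /when; case: eqP => [il|ne].
    by have [? ?] := advances_broadcast_qc h1 v g; split.
  by split=> //; apply: advances_refl.
have [h2 e2 c2] := a2.
have e02 := extends_trans e1 e2.
set s3 := when _ _ s2.
have [h3 e3 l3] : [/\ okc (book_of s0) [::] s3, extends s2 s3 &
   (j = leader f (q_view q) \/ i = leader f w -> cur_view s3 = w)].
  rewrite /s3 /when; case: eqP => [il|ne].
    have le2 : cur_view s2 <= (cert_view (CertQC q)).+1 by rewrite c2.
    have [h4 e4 c4] := @enter_same _ _ _ (CertQC q) h2 v g le2.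
    have [h5 e5 c5] := advances_commit q h4.
    rewrite c4 in c5.
    have [[h6 e6 c6] iss] := @advances_propose_qc _ _ _ _ _ _ ch _ _ _ _ h5 v g c5 il.
    split; last by rewrite c6.
    (* Both calls of [enter] in this handler have put the same view on the list of debts. *)
    - apply: ok_discharge (ok_discharge h6 _) _ => _ _.
      + split; first by apply: EvActed; exact: to_all_issued.
        by move=> _ _; left; exact: to_all_issued.
      + split; first by apply: EvActed; exact: to_all_issued.
        by move=> _ _; left; exact: to_all_issued.
    - by apply: extends_trans (extends_trans e4 e5) e6.
  split=> //.
  - apply: (ok_discharge h2) => we nwe.
    case: (j =P leader f (q_view q)) => [ej|nj].
      have [_ iw] := l1 ej; split; last by move=> il; case: ne.
      apply: (EvQC (q := q)) => //; last by right; apply: fw.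
      by case: e2 => h' _ _; apply: h'.
    (* Neither call of [enter] has taken place, so there is no new entry to justify. *)
    have e0 : s1 = s0 by rewrite /s1 /when; case: eqP.
    have [le0 _] := ok_mono h1; have [lt _ _] := ok_new h2 we nwe.
    have : w \in entered s0.
      suff <- : entered s2 = entered s0 by [].
      rewrite /s2 e0 /when; case: eqP => // _.
      by rewrite /broadcast_qc; case: ifP.
    by rewrite (negPf nwe).
  - by case=> [/l1 [cw _]|//]; rewrite c2.
have e03 := extends_trans e02 e3.
have [h3' cn'] := finish h3 e03 cn.
split=> // _; split; first by move=> /l3 ->.
by move=> il; right; apply: to_all_extends e3 (b2 il).
Qed.

Lemma ok_on_tc j tc : okc (book_of s0) [::] s0 -> counted s0 ->
  received j (MTC payload tc) ->
  let s' := on_tc P i (clk c) ch tc s0 in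
  [/\ okc (book_of s') [::] s', extends s0 s', counted s' &
    valid_tc P tc -> tc_view tc < cur_view s'].
Proof.
move=> h cn [g _ _] s'; rewrite /s' /on_tc.
case: ifP => [/andP [v le]|cond]; last first.
  by split=> // v; move: cond; rewrite v /= => /negbT; rewrite -ltnNge.
rewrite /andthen; set w := tc_view tc in le *.
have seen := valid_tc_seen v g; rewrite -/w in seen.
have [h1 e1 c1] := @enter_same _ _ _ (CertTC tc) h v g (leqW le).
set s1 := enter _ _ _ in h1 e1 c1 *; rewrite /= -/w in h1 c1.
set s2 := when (_ && _) _ s1.
have [[h2 e2 c2] ev] : advances (book_of s0) [:: w.+1] s1 s2 /\ evidence P c w.+1 s2.
  rewrite /s2 /when; case: ifP => [_|/negbT].
    have [h2 e2 c2] := advances_broadcast_tc h1 v g.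
    split=> //; apply: (EvTC P (tc := tc)) => //; exact: broadcast_to_all.
  move=> cond; split; first exact: advances_refl.
  (* Staying silent is excused either by an earlier broadcast of a TC of the same view, possibly
     another one, or by an own timeout message. *)
  move: cond; rewrite negb_and !negbK => /orP [/sent_tcP [j' [tc' [itc etc]]]|st].
    apply: (EvTC P (tc := tc')) => //; first by rewrite etc.
    by apply: to_all_extends e1 _; have [[_ a] _] := ok_sent h itc.
  by apply: EvTimeout => //; apply: sent_timeout_extends st.
rewrite /when; case: eqP => [il|ne].
  have ew : cur_view s2 = w.+1 by rewrite c2.
  have [[h3 e3 c3] a3] := @advances_propose_tc _ _ _ _ _ _ ch _ _ _ _ h2 v g ew il.
  have h3' : okc (book_of s0) [::] (propose_tc P i (clk c) ch tc s2).
    apply: ok_discharge h3 _ => _ _; split; first exact: evidence_extends ev.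
    by move=> _ _; left.
  have e03 := extends_trans (extends_trans e1 e2) e3.
  have [h3'' cn'] := finish h3' e03 cn.
  by split=> // _; rewrite c3 ew.
have h2' : okc (book_of s0) [::] s2.
  apply: ok_discharge h2 _ => _ _; split; first exact: ev.
  by move=> il; case: ne.
have e02 := extends_trans e1 e2.
have [h2'' cn'] := finish h2' e02 cn.
by split=> // _; rewrite c2 c1.
Qed.

(** * Answers to the requests of Recover *)

Lemma on_request_enter j tc : okc (book_of s0) [::] s0 ->
  all_genuine c (tc_sigs tc) -> valid_tc P tc ->
  (j = leader f (tc_view tc).+1 -> led c (tc_view tc).+1) ->
  j = leader f (tc_view tc).+1 -> cur_view s0 <= (tc_view tc).+1 ->
  let s1 := enter (clk c) (CertTC tc) s0 in
  [/\ okc (book_of s0) [::] s1, extends s0 s1, cur_view s1 = (tc_view tc).+1 &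
      sent s1 = sent s0 /\ proposals s1 = proposals s0].
Proof.
move=> h g v l ej le s1.
have [h1 e1 c1] := @enter_same _ _ _ (CertTC tc) h v g le.
split=> //; last by rewrite /s1 /enter; case: ifP.
apply: ok_discharge h1 _ => _ _; split; last by right; apply: l.
by apply: EvLed; [apply: l|left; apply: (valid_tc_seen (P := P))].
Qed.

Lemma In_stored d s p : List.In p (proposals s) -> p_id p = d -> stored d s <> None.
Proof.
move=> ip ed; rewrite /stored; elim: (proposals s) ip => //= p' l IH.
case: eqP => // ne [e|/IH //]; by case: ne; rewrite e.
Qed.

(** Votes are backed by stored proposals, so a validator that cannot return the block has not voted
    for it. The hypothesis on own signatures serves [ok_uniq] when the returned proposal is signed
    by [i] itself. *)
Lemma ok_on_proposal_request j tc :
  (forall x, genuine c x -> x.1 = i -> origin P s0 x) -> okc (book_of s0) [::] s0 -> counted s0 ->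
  received j (MProposalRequest payload tc) ->
  let s' := on_proposal_request P (clk c) j tc s0 in
  [/\ okc (book_of s') [::] s', extends s0 s', counted s' &
    valid_tc P tc -> j = leader f (tc_view tc).+1 -> forall T, tc_high_tip tc = Some T ->
    cur_view s0 <= (tc_view tc).+1 ->
    (exists2 p, p_id p = tip_id T /\ valid_proposal P p &
       List.In (j, MProposal p) (drop (size (sent s0)) (sent s'))) \/
    cur_view s' = (tc_view tc).+1 /\ ~ voted_for (tip_id T) s'].
Proof.
move=> own h cn [g _ l] s'; rewrite /s' /on_proposal_request /on_request.
case eT: (tc_high_tip tc) => [T|]; last by split.
case: ifP => [/and3P [v /eqP ej le]|cond]; last first.
  split=> // v ej T' [<-] le; move: cond; by rewrite v ej eqxx le.
rewrite /andthen; have [h1 e1 c1 [se pe]] := on_request_enter h g v (fun e => l e v) ej le.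
set s1 := enter _ _ _ in h1 e1 c1 se pe *.
case est: (stored _ s1) => [p|].
  have [ip ep] := stored_In est; have [vp gp] := ok_props h1 ip.
  have e2 : extends s1 (send j (MProposal p) s1) by apply: add_sent_extends.
  have h2 : okc (book_of s0) [::] (send j (MProposal p) s1).
    apply: ok_sends => //; try by move=> ? ? [].
      by move=> y [<-|//]; split=> // x; apply: genuine_good.
    move=> j1 p1 [[_ <-]|//] e3 j' p' /In_cat [ip'|[[_ <-] //|//]] e4 e5.
    have [eid es1] := valid_proposal_id vp.
    have gs1 : genuine c (p_sig p) by apply: gp; rewrite mem_head.
    have := own _ gs1 e3; rewrite /origin es1 /= => -[p2 [i2 eid2 v2 _ e6]].
    have [eid3 _] := valid_proposal_id v2.
    have ev2 : p_view p2 = p_view p.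
      by move: eid2; rewrite eid eid3 => /proposal_id_inj [].
    have ip2 : List.In (i, MProposal p2) (sent s1) by rewrite se; apply: i2.
    rewrite -eid2; apply: (ok_uniq h1 ip2 ip') => //; last by rewrite ev2.
    by rewrite e6 -e3 es1.
  have [h2' cn'] := finish h2 (extends_trans e1 e2) cn.
  split=> //; first exact: extends_trans e2.
  move=> _ _ T' [<-] _; left; exists p => //.
  by rewrite /= se drop_size_cat //; left.
have [h1' cn'] := finish h1 e1 cn.
split=> // _ _ T' [<-] _; right; split=> //.
move=> /voted_forP [j' [vt [/(ok_sent h1) [[_ _ _ _ [p [ip ep _]]] _] e]]].
by apply: (In_stored ip _ est); rewrite ep.
Qed.

Lemma ok_on_ne_request j tc : okc (book_of s0) [::] s0 -> counted s0 ->
  received j (MNERequest payload tc) ->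
  let s' := on_ne_request P i (clk c) j tc s0 in
  [/\ okc (book_of s') [::] s', extends s0 s', counted s' &
    valid_tc P tc -> j = leader f (tc_view tc).+1 -> tc_high_tip tc <> None ->
    tc_view tc < cur_view s' /\ forall T, tc_high_tip tc = Some T ->
    cur_view s0 <= (tc_view tc).+1 ->
    voted_for (tip_id T) s' \/ sent_ne (tc_view tc).+1 s'].
Proof.
move=> h cn [g _ l] s'; rewrite /s' /on_ne_request /on_request.
case eT: (tc_high_tip tc) => [T|]; last by split.
case: ifP => [/and3P [v /eqP ej le]|cond]; last first.
  split=> // v ej _; move: cond; rewrite v ej eqxx /= => /negbT; rewrite -ltnNge => lt.
  split; first by rewrite ltnW.
  by move=> T' _ le; move: lt; rewrite ltnNge le.
have [l1 l2] := l ej v.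
rewrite /andthen; have [h1 e1 c1 [se pe]] := on_request_enter h g v (fun _ => l1) ej le.
set s1 := enter _ _ _ in h1 e1 c1 se pe *.
case: ifP => [_|/negbT cond].
  set ne := MkNE _ _ _.
  have e2 : extends s1 (send j (MNE payload ne) s1) by apply: add_sent_extends.
  have h2 : okc (book_of s0) [::] (send j (MNE payload ne) s1).
    apply: ok_sends => //; try by move=> ? ? [].
    move=> y [<-|//]; split.
      by split=> //=; [rewrite /valid_ne /= eqxx|apply: l2].
    move=> x; rewrite inE => /eqP ->; right; split=> //; rewrite /origin /=.
    by apply/sent_neP; exists j, ne; split=> //; apply/In_cat; right; left.
  have [h2' cn'] := finish h2 (extends_trans e1 e2) cn.
  split=> //; first exact: extends_trans e2.
  move=> _ _ _; split; first by rewrite /= c1.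
  move=> T' [<-] _; right; apply/sent_neP; exists j, ne; split=> //.
  by apply/In_cat; right; left.
have [h1' cn'] := finish h1 e1 cn.
split=> // _ _ _; rewrite c1; split=> // T' [<-] _.
by move: cond; rewrite negb_and !negbK => /orP.
Qed.

Lemma ok_on_ne j ne : okc (book_of s0) [::] s0 -> counted s0 -> adds_ne c ->
  received j (MNE payload ne) ->
  let s' := on_ne P i ch ne s0 in
  [/\ okc (book_of s') [::] s', extends s0 s', counted s' &
    (valid_ne ne -> ne_votes s' = rcons (ne_votes s0) ne /\ forall r, recovery s0 = Some r ->
      cur_view s0 = (tc_view (r_tc r)).+1 ->
      quorum f <= size (ne_sigs (tc_view (r_tc r)).+1 (q_view (tip_qc (r_tip r)))
                          (rcons (ne_votes s0) ne)) ->
      issued i (cur_view s0) s') /\ (~~ valid_ne ne -> ne_votes s' = ne_votes s0)].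
Proof.
move=> h cn an [g _ _] s'; rewrite /s' /on_ne /when.
case: ifP => // v; rewrite /andthen.
have e1 : extends s0 (add_ne ne s0) by split.
have h1 : okc (book_of s0) [::] (add_ne ne s0).
  by apply: ok_add_ne => //; apply: g; rewrite mem_head.
have [[h2 e2 c2] iss] := advances_recover_on_ne ch h1.
have e02 := extends_trans e1 e2.
have [h2' cn'] := finish h2 e02 cn.
split=> //; split=> // _; split; last by move=> r er ec le; exact: iss er ec le.
have <- // : ne_votes (add_ne ne s0) = ne_votes (recover_on_ne P i ch (add_ne ne s0)).
rewrite /recover_on_ne /when; case: (recovery _) => // r; case: ifP => // _.
rewrite /recover_return /andthen /when; case: ifP => // _.
by rewrite /propose; case: ifP.
Qed.

(** * Timeout messages and the certificates they carry *)

Lemma ok_process_cer A s ce : okc A [::] s -> valid_cert P ce ->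
  all_genuine c (cert_sigs ce) -> cur_view s <= (cert_view ce).+1 ->
  let s' := process_cer P i (clk c) ch ce s in
  [/\ okc A [::] s', extends s s' & cur_view s' = (cert_view ce).+1].
Proof.
move=> h v g le s'; rewrite /s' /process_cer /andthen; set w := cert_view ce in le *.
set s1 := when _ _ s.
have [h1 e1 c1] : advances A [::] s s1.
  rewrite /s1 /when; case: (ce) v g => [q|tc] v g; first exact: advances_refl.
  by case: ifP => _; [apply: advances_broadcast_tc|apply: advances_refl].
have ev1 : if ce is CertTC tc then evidence P c w.+1 s1 else True.
  rewrite /s1 /when; case ee: (ce) => [//|tc]; move: v g; rewrite ee => v g.
  have seen := valid_tc_seen v g.
  have ew : w = tc_view tc by rewrite /w ee.
  rewrite ew; case: ifP => [_|/negbT cond].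
    by apply: (EvTC P (tc := tc)) => //; exact: broadcast_to_all.
  move: cond; rewrite negb_and !negbK => /orP [st|/sent_tcP [j' [tc' [itc etc]]]].
    by apply: EvTimeout.
  apply: (EvTC P (tc := tc')) => //; first by rewrite etc.
  by have [[_ a] _] := ok_sent h itc.
have le1 : cur_view s1 <= w.+1 by rewrite c1.
have [h2 e2 c2] := enter_same h1 v g le1.
set s2 := enter _ _ s1 in h2 e2 c2 *.
set s3 := when _ _ s2.
have [[h3 e3 c3] b3] : advances A [:: w.+1] s2 s3 /\ (i = leader f w.+1 -> acted c w.+1 s3).
  rewrite /s3 /when; case: eqP => [il|ne] /=; last by split=> //; apply: advances_refl.
  case: ifP => [_|/negbT]; last first.
    rewrite negbK => iss; split; first exact: advances_refl.
    by move=> _; apply: to_all_issued.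
  by have [a3 b3] := @advances_propose_cert _ _ _ _ _ _ ch _ _ _ _ h2 v g c2 il; split.
have e03 := extends_trans (extends_trans e1 e2) e3.
rewrite c2 in c3.
case ee: (ce) => [q|tc] /=; last first.
  rewrite ee in ev1; split=> //; apply: (ok_discharge h3) => _ _; split.
    exact: evidence_extends (extends_trans e2 e3) ev1.
  by move=> il _; left; apply: b3.
move: v g; rewrite ee => v g; have ew : w = q_view q by rewrite /w ee.
rewrite /andthen; set s4 := when _ _ s3.
have [[h4 e4 c4] b4] : advances A [:: w.+1] s3 s4 /\
    (i = leader f (q_view q) -> to_all (MQC payload q) s4).
  rewrite /s4 /when -ew; case: eqP => [il|ne].
    by have [? ?] := advances_broadcast_qc h3 v g; split.
  by split=> //; apply: advances_refl.
have [h5 e5 c5] := advances_send_qc (leader f w) h4 v g b4.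
set s5 := send _ _ s4 in h5 e5 c5 *.
have b5 : i = leader f (q_view q) -> to_all (MQC payload q) s5.
  by move=> il; apply: to_all_extends e5 (b4 il).
have [h6 e6 c6] := advances_send_qc (leader f w.+1) h5 v g b5.
set s6 := send _ _ s5 in h6 e6 c6 *.
have [h7 e7 c7] := advances_commit q h6.
have e36 := extends_trans (extends_trans e4 e5) e6.
split.
- apply: (ok_discharge h7) => _ _; split.
    apply: evidence_extends e7 _; apply: (EvQC (q := q)) => //; first by rewrite ew.
      by apply/In_cat; right; left.
    left; case: e6 => h' _ _; apply: h'; apply/In_cat; right; by left.
  by move=> il _; left; apply: acted_extends (extends_trans e36 e7) (b3 il).
- exact: extends_trans e03 (extends_trans e36 e7).
by rewrite c7 c6 c5 c4 c3.
Qed.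

(** Serves to exhibit [timeouts_seen] when only the list of signers is at hand and a timeout
    signature of each must be chosen. *)
Lemma choose_list (S : seq (validator f)) (Q : sig f digest -> Prop) :
  (forall a, a \in S -> exists2 x, x.1 = a & Q x) ->
  exists2 ss : seq (sig f digest), [seq x.1 | x <- ss] = S & forall x, x \in ss -> Q x.
Proof.
elim: S => [|a S IH] h; first by exists [::].
have [b bS|ss es hs] := IH; first by apply: h; rewrite inE bS orbT.
have [x ex qx] := h a (mem_head _ _).
exists (x :: ss); first by rewrite /= ex es.
by move=> y; rewrite inE => /orP [/eqP -> //|/hs].
Qed.

Lemma timeout_seen_sig M : valid_timeout P M -> all_genuine c (timeout_sigs M) ->
  genuine c (m_sig M) /\ exists t k, (m_sig M).2 = STimeout digest (m_view M) t k.
Proof.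
by move=> v g; split; [apply: g; rewrite mem_head|apply: valid_timeout_sig v].
Qed.

Lemma timeouts_of_seen n w (Ms : seq (timeout f digest)) :
  (forall M, List.In M Ms -> valid_timeout P M /\ all_genuine c (timeout_sigs M)) ->
  uniq [seq (m_view M, (m_sig M).1) | M <- Ms] ->
  n <= size (timeouts_of w Ms) ->
  uniq [seq (m_sig M).1 | M <- timeouts_of w Ms] /\ timeouts_seen c n w.
Proof.
move=> h u le.
have u' : uniq [seq (m_sig M).1 | M <- timeouts_of w Ms].
  elim: (Ms) u => //= M l IH /andP [nin /IH u']; rewrite /timeouts_of /=.
  case: eqP => //= ew; rewrite u' andbT; apply/negP.
  move=> /In_mem/List.in_map_iff [M' [ea /In_filter [iM /eqP ew']]].
  case/negP: nin; apply/In_mem/List.in_map_iff; exists M'; split=> //.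
  by rewrite ea ew ew'.
split=> //; exists [seq m_sig M | M <- timeouts_of w Ms].
rewrite size_map -map_comp; split=> // x.
rewrite -In_mem List.in_map_iff => -[M [<- /In_filter [iM /eqP ew]]].
by have [v g] := h M iM; have [? ?] := timeout_seen_sig v g; rewrite -ew.
Qed.
(** The counting hypotheses are [counted] in the middle of the handler: the tip vote of [M] may be
    recorded while [M] is not, whence the alternative [M' = M]. *)
Lemma ok_record_timeout M s vs tvs Ms : okc (vs, tvs, Ms) [::] s ->
  valid_timeout P M -> all_genuine c (timeout_sigs M) ->
  cur_view s = m_view M -> 0 < m_view M ->
  (forall vt, List.In vt vs -> cur_view s <= vt_view vt ->
    size (id_sigs (vt_id vt) vs) < quorum f) ->
  (forall w, cur_view s <= w -> size (timeouts_of w Ms) < quorum f) ->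
  (forall w, f < size (timeouts_of w Ms) -> sent_timeout w s) ->
  (forall vt, List.In vt tvs -> cur_view s <= vt_view vt ->
    exists M', [/\ M' = M \/ List.In M' Ms, m_view M' = vt_view vt &
                  (m_sig M').1 = (vt_sig vt).1]) ->
  let s' := record_timeout P i (clk c) ch M s in
  [/\ okc (book_of s') [::] s', extends s s', counted s' &
   exists M', [/\ List.In M' (timeouts s'), m_view M' = m_view M &
                  (m_sig M').1 = (m_sig M).1]].
Proof.
move=> h v g ew pos c1 c2 c3 c4 s'; rewrite /s' /record_timeout.
set w := m_view M in ew pos *; set known := has _ _.
have [ev et eM] : [/\ votes s = vs, tip_votes s = tvs & timeouts s = Ms].
  by have := ok_book h; rewrite /book_of => -[-> -> ->].
have [b1 b2 [b3 b4]] := ok_bookv h.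
set s1 := when (~~ known) _ s; set Ms1 := timeouts s1.
have rec1 : exists M', [/\ List.In M' Ms1, m_view M' = w & (m_sig M').1 = (m_sig M).1].
  rewrite /Ms1 /s1 /when; case kn: known => /=; last first.
    by exists M; split=> //; rewrite -cats1; apply/In_cat; right; left.
  move/hasP_In: kn => [M' iM /andP [/eqP ? /eqP ?]].
  by exists M'; split.
have sub1 M' : List.In M' Ms1 -> List.In M' Ms \/ M' = M.
  rewrite /Ms1 /s1 /when; case: (known) => /=; first by rewrite eM; left.
  by rewrite -cats1 => /In_cat [|[|[]]]; rewrite ?eM; [left|right].
have sup1 M' : List.In M' Ms -> List.In M' Ms1.
  rewrite /Ms1 /s1 /when; case: (known) => /=; first by rewrite eM.
  by rewrite -cats1 eM => ?; apply/In_cat; left.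
have u1 : uniq [seq (m_view M', (m_sig M').1) | M' <- Ms1].
  rewrite /Ms1 /s1 /when; case kn: known => /=; first by rewrite eM.
  rewrite map_rcons rcons_uniq eM b4 andbT; apply/negP.
  move=> /In_mem/List.in_map_iff [M' [[e1 e2] iM]].
  move/negP: (negbT kn); apply; apply/hasP_In; exists M'; first by rewrite eM.
  by rewrite e1 e2 !eqxx.
have of1 w' : w' <> w -> timeouts_of w' Ms1 = timeouts_of w' Ms.
  move=> ne; rewrite /Ms1 /s1 /when; case: (known) => /=; first by rewrite eM.
  by rewrite /timeouts_of filter_rcons eM -/w; case: eqP => // e; case: ne.
have bk1 : book_inv P c (vs, tvs, Ms1).
  by split=> //; split=> // M' /sub1 [/b3 //|->].
have h1 : okc (vs, tvs, Ms1) [::] s1.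
  have := ok_book_upd h bk1 _ _; rewrite ev eM => /(_ (fun _ => id) sup1); rewrite /Ms1 /s1 /when /add_timeout -ev -et.
  by case: (known) => //=; case: (s).
have e1 : extends s s1 by rewrite /s1 /when; case: ifP.
have c1' : cur_view s1 = w by rewrite -ew /s1 /when; case: ifP.
rewrite -/(timeouts_of w Ms1); set L := timeouts_of w Ms1.
have hL M' : List.In M' Ms1 -> valid_timeout P M' /\ all_genuine c (timeout_sigs M').
  by move=> /sub1 [/b3 //|->].
rewrite /andthen; set s2 := when (f < _) _ s1.
have [[h2 e2 cur2] st2] : advances (vs, tvs, Ms1) [::] s1 s2 /\ (f < size L -> sent_timeout w s2).
  rewrite /s2 /when; case: ifP => [lt|_]; last by split=> //; apply: advances_refl.
  have [||a st] := advances_time_out h1.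
  - by rewrite c1'.
  - by apply: Or32; rewrite c1'; have [] := timeouts_of_seen hL u1 lt.
  by split=> // _; rewrite -c1'.
rewrite c1' in cur2.
set s3 := when _ _ s2.
have [h3 e3 cur3] : [/\ okc (vs, tvs, Ms1) [::] s3, extends s2 s3 &
    w <= cur_view s3 /\ (quorum f <= size L -> w < cur_view s3)].
  rewrite /s3 /when; case: ifP => [le|_]; last by split=> //; rewrite cur2.
  have [uL seen] := timeouts_of_seen hL u1 le.
  have vt : valid_tc P (form_tc w (take (quorum f) L)).
    apply: form_tc_valid.
    - by rewrite size_takel.
    - apply: In_all => M' iM; have : List.In M' L.
        by rewrite -[L](cat_take_drop (quorum f)); apply/In_cat; left.
      by case/In_filter => /hL [].
    - apply: In_all => M' iM; have : List.In M' L.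
        by rewrite -[L](cat_take_drop (quorum f)); apply/In_cat; left.
      by case/In_filter.
    by rewrite map_take take_uniq.
  have gt : all_genuine c (tc_sigs (form_tc w (take (quorum f) L))).
    move=> x /form_tc_sigs [M' iM xM]; have : List.In M' L.
      by rewrite -[L](cat_take_drop (quorum f)); apply/In_cat; left.
    by case/In_filter => /hL [_ gM] _; apply: gM.
  have le2 : cur_view s2 <= (cert_view (CertTC (form_tc w (take (quorum f) L)))).+1.
    by rewrite cur2.
  have [h4 e4 c4'] := @enter_same _ _ _ (CertTC (form_tc w (take (quorum f) L))) h2 vt gt le2.
  (* A quorum exceeds [f], so the own timeout has been triggered by now; it is the evidence for the
     entry made with the TC. *)
  have stw : sent_timeout w s2 by apply: st2; apply: leq_trans le; rewrite /quorum; lia.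
  rewrite /= in h4 e4 c4'.
  set s4 := enter _ _ s2 in h4 e4 c4' *.
  rewrite /andthen -/s4.
  case: eqP => [il|ne].
    have [[h5 e5 c5] a5] := @advances_propose_tc _ _ _ _ _ _ ch _ _ _ _ h4 vt gt c4' il.
    split; [|exact: extends_trans e5|by rewrite c5 c4'].
    apply: (ok_discharge h5) => _ _; split; last by move=> _ _; left.
    by apply: EvTimeout => //; apply: sent_timeout_extends stw; apply: extends_trans e5.
  split=> //; last by rewrite c4'.
  apply: (ok_discharge h4) => _ _; split; last by move=> il; case: ne.
  by apply: EvTimeout => //; apply: sent_timeout_extends stw.
have e13 := extends_trans e2 e3; have e03 := extends_trans e1 e13.
have bk := ok_book h3; have [ev3 et3 eM3] : [/\ votes s3 = vs, tip_votes s3 = tvs & timeouts s3 = Ms1].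
  by move: bk; rewrite /book_of => -[-> -> ->].
have [cur3a cur3b] := cur3.
split=> //; first by rewrite bk.
- split; rewrite ?ev3 ?et3 ?eM3.
  + by move=> vt iv lv; apply: c1 => //; rewrite ew; apply: leq_trans lv.
  + move=> w' lw; case: (w' =P w) => [e|ne]; last first.
      by rewrite of1 //; apply: c2; rewrite ew; apply: leq_trans lw.
    by rewrite e -/L ltnNge; apply/negP => /cur3b; rewrite -e ltnNge lw.
  + move=> w'; case: (w' =P w) => [->|ne].
      by move=> /st2; apply: sent_timeout_extends.
    by rewrite of1 // => /c3; apply: sent_timeout_extends.
  + move=> vt iv lv; have [|M' [d e2' e3']] := c4 vt iv; first by rewrite ew; apply: leq_trans lv.
    case: d => [eM'|/sup1 ?]; last by exists M'.
    have [M2 [? e4 e5]] := rec1; exists M2; split=> //.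
      by rewrite e4 -e2' eM'.
    by rewrite e5 -e3' eM'.
by have [M' [? ? ?]] := rec1; exists M'; rewrite eM3.
Qed.

Lemma ok_on_timeout j M : okc (book_of s0) [::] s0 -> counted s0 ->
  received j (MTimeout payload M) ->
  let s' := on_timeout P i (clk c) ch M s0 in
  [/\ okc (book_of s') [::] s', extends s0 s', counted s' &
    valid_timeout P M -> m_view M < cur_view s' \/
      exists M', [/\ List.In M' (timeouts s'), m_view M' = m_view M &
                  (m_sig M').1 = (m_sig M).1]].
Proof.
move=> h cn [g _ _] s'; rewrite /s' /on_timeout.
case: ifP => [/andP [v le]|cond]; last first.
  split=> // v; left; move: cond; rewrite v /= => /negbT; by rewrite -ltnNge.
have [vc ec] : valid_cert P (m_cer M) /\ (cert_view (m_cer M)).+1 = m_view M.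
  by case/and3P: v => -> /eqP.
have gc : all_genuine c (cert_sigs (m_cer M)).
  by move=> x xs; apply: g; rewrite /= inE !mem_cat xs !orbT.
have le1 : cur_view s0 <= (cert_view (m_cer M)).+1 by rewrite ec.
have [h1 e1 c1] := ok_process_cer h vc gc le1.
set s1 := process_cer _ _ _ _ _ _ in h1 e1 c1 *; rewrite ec in c1.
have pos : 0 < m_view M by rewrite -ec.
have [ev et eM] : [/\ votes s1 = votes s0, tip_votes s1 = tip_votes s0 & timeouts s1 = timeouts s0].
  by have := ok_book h1; rewrite /book_of => -[-> -> ->].
case: (cn) => n1 n2 n3 n4.
have fin s2 tvs : okc (votes s0, tvs, timeouts s0) [::] s2 -> extends s1 s2 ->
    cur_view s2 = m_view M ->
    (forall vt, List.In vt tvs -> List.In vt (tip_votes s0) \/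
      (vt_view vt = m_view M /\ (vt_sig vt).1 = (m_sig M).1)) ->
    let s' := record_timeout P i (clk c) ch M s2 in
    [/\ okc (book_of s') [::] s', extends s0 s', counted s' &
      valid_timeout P M -> m_view M < cur_view s' \/
      exists M', [/\ List.In M' (timeouts s'), m_view M' = m_view M &
                  (m_sig M').1 = (m_sig M).1]].
  move=> h2 e2 c2 ht; have e02 := extends_trans e1 e2.
  have [||||h3 e3 cn3 r3] := ok_record_timeout h2 v g c2 pos.
  - by move=> vt iv lv; apply: n1 => //; rewrite c2 in lv; lia.
  - by move=> w lw; apply: n2; rewrite c2 in lw; lia.
  - by move=> w /n3; apply: sent_timeout_extends.
  - move=> vt /ht [iv lv|[? ?] _]; last by exists M; split=> //; left.
    by have [|M' [? ? ?]] := n4 _ iv; [rewrite c2 in lv; lia|exists M'; split=> //; right].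
  by split=> //; [exact: extends_trans e3|right].
have fin0 : let s' := record_timeout P i (clk c) ch M s1 in
    [/\ okc (book_of s') [::] s', extends s0 s', counted s' &
      valid_timeout P M -> m_view M < cur_view s' \/
      exists M', [/\ List.In M' (timeouts s'), m_view M' = m_view M &
                  (m_sig M').1 = (m_sig M).1]].
  by apply: fin h1 _ c1 _ => //; left.
rewrite /record_tip_vote; case ev1: (m_tip_vote M) => [vt|]; last exact: fin0.
case etp: (isSome (m_tip M)); last exact: fin0.
have [vv vw va] := valid_timeout_vote v etp ev1.
set s2 := add_tip_vote vt s1.
have gvt : genuine c (vt_sig vt).
  by apply: g; rewrite /= /timeout_sigs ev1 inE !mem_cat /= inE eqxx !orbT.
have [b1 b2 [b3 b4]] := ok_bookv h.
have in2 vt' : List.In vt' (rcons (tip_votes s0) vt) -> List.In vt' (tip_votes s0) \/ vt' = vt.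
  by rewrite -cats1 => /In_cat [|[|[]]]; [left|right].
have bk2 : book_inv P c (votes s0, rcons (tip_votes s0) vt, timeouts s0).
  by split=> // vt' /in2 [/b2 //|->].
have h2 : okc (votes s0, rcons (tip_votes s0) vt, timeouts s0) [::] s2.
  have := ok_book_upd h1 bk2; rewrite ev eM => /(_ (fun _ => id) (fun _ => id)).
  by rewrite -ev -et -eM.
have e2 : extends s1 s2 by split.
case eq: (form_qc vt _) => [q|]; last first.
  apply: fin h2 e2 c1 _ => vt' /in2 [|->]; [by left|by right].
rewrite /= et in eq; set tvs := rcons _ vt in eq bk2 h2 in2 *.
have atv : all (valid_vote P) tvs.
  by apply: In_all => vt' /in2 [/b2 []|->].
have [vq ew sz sub] := form_qcP vv atv eq.
have gq : all_genuine c (q_agg q).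
  by move=> x /sub /id_sigsP [vt' /in2 [/b2 [_ gv]|->] [_ ->]].
rewrite vw in ew.
have le2 : cur_view s2 <= (cert_view (CertQC q)).+1 by rewrite /= ew c1.
have [h3 e3 c3] := @enter_same _ _ _ (CertQC q) h2 vq gq le2.
have [h4 e4 c4] := advances_commit q h3.
rewrite /andthen; set s3 := enter _ _ s2 in h3 e3 c3 h4 e4 c4 *.
set s4 := commit q s3 in h4 e4 c4 *; rewrite c3 in c4.
have e14 := extends_trans e2 (extends_trans e3 e4).
suff [h5 e5 c5] : [/\ okc (votes s0, tvs, timeouts s0) [::]
     (when (i == leader f (q_view q).+1) (propose_qc P i ch q) s4),
     extends s4 (when (i == leader f (q_view q).+1) (propose_qc P i ch q) s4) &
     cur_view (when (i == leader f (q_view q).+1) (propose_qc P i ch q) s4) = (q_view q).+1].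
  have bk := ok_book h5; move: h5 e5 c5 bk; set s5 := when _ _ _ => h5 e5 c5 bk.
  have e05 := extends_trans e1 (extends_trans e14 e5).
  split=> //; first by rewrite bk.
  - move: bk; rewrite /book_of => -[ev5 et5 eM5]; rewrite ew in c5.
    split; rewrite ?ev5 ?et5 ?eM5 ?c5.
    + by move=> vt' iv lv; apply: n1 => //; lia.
    + by move=> w lw; apply: n2; lia.
    + by move=> w /n3; apply: sent_timeout_extends.
    + move=> vt' /in2 [iv lv|-> lv]; last by move: lv; rewrite vw ltnn.
      by apply: n4 => //; lia.
  by move=> _; left; rewrite c5 ew.
rewrite /when; case: eqP => [il|ne].
  have [[h5 e5 c5] iss] := @advances_propose_qc _ _ _ _ _ _ ch _ _ _ _ h4 vq gq c4 il.
  split=> //; last by rewrite c5 c4.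
  apply: (ok_discharge h5) => _ _; split; first by apply: EvActed; apply: to_all_issued.
  by move=> _ _; left; apply: to_all_issued.
(* This QC is sent to nobody, so the entry has to be evidenced by timeouts: each tip vote came with
   a timeout message of its author. *)
split=> //; apply: (ok_discharge h4) => _ _; split; last by move=> il; case: ne.
have f0 : 0 < f.
  by rewrite lt0n; apply/eqP => e0; case: ne; apply: single_validator.
(* The votes of the quorum other than [vt] were recorded with their timeout messages. *)
set S := [seq x.1 | x <- id_sigs (vt_id vt) tvs].
have uS : uniq S.
  apply: (@mem_undup_uniq_fst _ _ _ (vt_sig vt).2); first exact: undup_uniq.
  by move=> x /id_sigsP [vt' /(all_In atv) v' [e ->]]; have [_ ->] := valid_vote_id v' vv e.
have old a : a \in S -> a = (m_sig M).1 \/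
    exists2 M', List.In M' (timeouts s0) & m_view M' = m_view M /\ (m_sig M').1 = a.
  move=> /mapP [x /id_sigsP [vt' /in2 [iv|->] [e ->]] ->]; last by left; rewrite va.
  have [v' _] := b2 _ iv; have [ew' _] := valid_vote_id v' vv e.
  right; have [|M' [? e1' e2']] := n4 _ iv; first by rewrite ew' vw.
  by exists M' => //; split; rewrite // e1' ew' vw.
have size_old : f < size (timeouts_of (m_view M) (timeouts s0)).
  have sub' : {subset rem (m_sig M).1 S <= [seq (m_sig M').1 | M' <- timeouts_of (m_view M) (timeouts s0)]}.
    move=> a; rewrite mem_rem_uniq // inE => /andP [na /old [e|[M' iM [e1' <-]]]].
      by rewrite /= e eqxx in na.
    by apply/In_mem/List.in_map_iff; exists M'; split=> //; apply/In_filter; rewrite e1' eqxx.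
  have := uniq_leq_size (rem_uniq _ uS) sub'; rewrite size_map => le'.
  have : size S <= (size (rem (m_sig M).1 S)).+1.
    case: (boolP ((m_sig M).1 \in S)) => iS; last by rewrite rem_id.
    by rewrite size_rem //; apply: leqSpred.
  have eS : size S = size (id_sigs (vt_id vt) tvs) by rewrite size_map.
  move: sz le' f0; rewrite /quorum -eS.
  move: (size S) (size (rem _ S)) (size (timeouts_of _ _)) => k1 k2 k3 {S uS old sub' eS}.
  clear; lia.
rewrite /= ew; apply: EvTimeout => /=.
  by apply: sent_timeout_extends (n3 _ size_old); apply: extends_trans e14.
have [|ss es hs] := @choose_list S (fun x => genuine c x /\
    exists t k, x.2 = STimeout digest (m_view M) t k).
  move=> a /old [->|[M' iM [e1' e2']]].
    by exists (m_sig M) => //; apply: timeout_seen_sig.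
  exists (m_sig M') => //; rewrite -e1'; have [vM gM] := b3 _ iM.
  exact: timeout_seen_sig.
exists ss; rewrite -(size_map (@fst _ _) ss) es size_map; split=> //.
Qed.
End Counting.

(** * The invariant of an execution *)

Section Executions.

Variables (R : realType) (f : nat) (digest : eqType) (payload : Type).
Variable P : params R f digest payload.

Local Notation state := (lstate R f digest payload).

Implicit Types (s : state) (tc : TC f digest) (q : QC f digest).
Implicit Types (p : proposal f digest payload) (vt : vote f digest).
Implicit Types (M : timeout f digest) (m : msg f digest payload).
Implicit Types (i j : validator f) (w : nat).

Lemma ok_init (c : event_context R f digest payload) : pre c = init_state P ->
  ok P c (book_of (init_state P)) [::] (init_state P).
Proof.
move=> e; split; rewrite ?e //=; try by left.
- by split=> //; rewrite /valid_qc eqxx.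
- by exists [::].
Qed.

Lemma counted_init : counted (init_state P).
Proof. by split. Qed.

(** Passage to the next event. The final state becomes the reference state, which makes the
    comparisons with [pre c'] trivial; the other clauses survive because knowledge only grows. *)
Lemma ok_rebase (c c' : event_context R f digest payload) A s :
  ok P c A [::] s -> me c' = me c -> pre c' = s ->
  (forall x, genuine c x -> genuine c' x) ->
  (forall w v, nq c w v -> nq c' w v) -> ok P c' A [::] s.
Proof.
move=> h em ep hg hn.
have ag ss : all_genuine c ss -> all_genuine c' ss by move=> g x /g /hg.
have rq tc : request_inv P c s tc -> request_inv P c' s tc by rewrite /request_inv em.
case: (h) => *; split; rewrite ?ep //; try by left.
- by have [? ? /ag] := ok_lqc h; split.
- by move=> tc /(ok_ltc h) [? /ag].
- by case: (ok_tip h) => [?|[? ? /ag]]; [left|right; split].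
- move: (ok_bookv h); case: (A) => -[vs tvs] Ms [b1 b2 [b3 b4]]; split.
  + by move=> vt /b1 [? /hg].
  + by move=> vt /b2 [? /hg].
  + by split=> // M /b3 [? /ag].
- by move=> ne /(ok_ne h) [? /hg].
- by move=> p /(ok_props h) [? /ag].
- by move=> r /(ok_rec h) [? /rq ? /ag].
- move=> j tc ys e; rewrite /request_live em; exact: (ok_req h ys e).
- move=> y /(ok_sent h) [m1 m2]; split.
    move: m1; rewrite /msg_inv em; case: y.2 => // ne.
    by case=> ? ? ? /hn.
  by move=> x /m2; rewrite /good em => -[/hg|]; [left|right].
- by move=> j p j' p'; rewrite em; apply: (ok_uniq h).
- by exists [::]; rewrite cats0.
- by move=> w ->.
- by move=> w st; apply: Or31.
- by move=> r /(ok_rec h) [_ []].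
- by move=> r er _; right; exists r.
- by move=> r er; right; exists r.
Qed.

Variable E : execution R f digest payload.
Hypothesis adm : admissible P E.

Local Notation st := (st E).
Local Notation time := (time E).
Local Notation ev := (ev E).
Local Notation correct := (correct E).

Definition origin_before k (x : sig f digest) :=
  correct x.1 -> origin P (st k x.1) x.

Definition acts s i w := issued i w s \/
  exists j tc, List.In (j, MNERequest payload tc) (sent s) /\ (tc_view tc).+1 = w.

(** Each promise about a leader is conditional on its correctness, so that messages of Byzantine
    leaders fulfil it vacuously. A signature is genuine when its signer, if correct, shows its
    [origin] before event [k]. *)
Definition ctx k i : event_context R f digest payload :=
  EventContext i (clock E i (time k)) (st k i) (origin_before k)
    (fun w => correct (leader f w) -> acts (st k (leader f w)) (leader f w) w)
    (fun q => correct (leader f (q_view q)) ->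
       to_all (MQC payload q) (st k (leader f (q_view q))))
    (fun w v => correct (leader f w) -> exists j tc T,
       [/\ List.In (j, MNERequest payload tc) (sent (st k (leader f w))),
           (tc_view tc).+1 = w, tc_high_tip tc = Some T & q_view (tip_qc T) = v])
    (fun w => timer_due P (st k i) (clock E i (time k)) /\ cur_view (st k i) = w)
    (exists j ne ch, ev k = Some (i, InMsg j (MNE payload ne), ch)).

Definition inv k := forall i, correct i ->
  ok P (ctx k i) (book_of (st k i)) [::] (st k i) /\ counted (st k i).

Lemma inv_good k i j m x : inv k -> correct i -> List.In (j, m) (sent (st k i)) ->
  x \in msg_sigs m -> origin_before k x.
Proof.
move=> h ci ij xm; have [hi _] := h i ci.
by have [_ g] := ok_sent hi ij; case: (g x xm) => // -[e o] _; rewrite e.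
Qed.

Lemma inv_issued k i j p : inv k -> correct i -> List.In (j, MProposal p) (sent (st k i)) ->
  i = leader f (p_view p) -> issued i (p_view p) (st k i).
Proof.
move=> h ci ij il; have [hi _] := h i ci; have [v _] := ok_sent hi ij.
apply/issuedP; exists j, p; split=> //.
by have [_ ->] := valid_proposal_id v.
Qed.

(** A message from a correct sender has really been sent, so the sender's invariant applies. For a
    Byzantine sender, unforgeability traces every signature of a correct validator to a message sent
    by its owner. *)
Lemma inv_received k i j m ch : inv k -> ev k = Some (i, InMsg j m, ch) ->
  received P (ctx k i) j m.
Proof.
move=> h e; have ci : correct i by have := adm_step adm k; rewrite e => -[].
have au := adm_authentic adm e.
have req tc : List.In (i, MProposalRequest payload tc) (sent (st k j)) \/
    List.In (i, MNERequest payload tc) (sent (st k j)) -> correct j ->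
    [/\ request_inv P (ctx k j) (st k j) tc & j = leader f (tc_view tc).+1 ->
    acts (st k j) j (tc_view tc).+1].
  move=> ij cj; have [hj _] := h j cj.
  have rq : request_inv P (ctx k j) (st k j) tc.
    by case: ij => [/(ok_sent hj) [? _]|/(ok_sent hj) [? _]].
  by split=> // _; right; exists i, tc; split=> //; case: rq.
split.
- move=> x xm /=; case cj: (correct j) au => au; first exact: inv_good h cj au xm.
  move=> cx; have [y iy xy] := au x xm cx.
  by apply: (inv_good h cx (j := y.1) (m := y.2)) => //; rewrite -surjective_pairing.
- by move=> ej; move: au; rewrite ej ci.
case: m e au => //= [p|q|tc|tc] e au.
- by move=> ej v cl; rewrite -ej in cl *; left; apply: inv_issued => //; rewrite cl in au; exact: au.
- move=> ej v cl; rewrite -ej in cl *; rewrite cl in au.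
  by have [hj _] := h j cl; have [[_ a] _] := ok_sent hj au; apply: a.
- move=> ej v cl; rewrite -ej in cl *; rewrite cl in au.
  by have [_ a] := req tc (or_introl au) cl; apply: a.
move=> ej v; split=> [cl|T eT cl]; rewrite -ej in cl *; rewrite cl in au.
  by have [_ a] := req tc (or_intror au) cl; apply: a.
by exists i, tc, T.
Qed.

Lemma inv_step k : inv k -> forall i, correct i ->
  [/\ ok P (ctx k i) (book_of (st k.+1 i)) [::] (st k.+1 i),
      extends (st k i) (st k.+1 i) & counted (st k.+1 i)].
Proof.
move=> h i ci; have := adm_step adm k.
case e: (ev k) => [[[i' a] ch]|]; last first.
  by move=> ->; have [? ?] := h i ci; split=> //; split.
case=> ci' en es eo; case: (i =P i') => [ei|/eqP ne]; last first.
  by rewrite eo //; have [? ?] := h i ci; split=> //; split.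
subst i'; have [hi cn] := h i ci; rewrite es.
case: a e en es => [|j m| | |p] e en es /=.
- have [|h1 e1] := @ok_start_event _ _ _ _ P (ctx k i) ch _ hi.
    by move: en; rewrite /= /started lt0n negbK => /eqP.
  by have [? ?] := finish h1 e1 cn.
- have rc := inv_received h e.
  case: m e en es rc => [p|vt|q|M|tc|tc|tc|ne] e en es rc /=.
  + by have [h1 e1 _] := ok_on_proposal hi rc; have [? ?] := finish h1 e1 cn.
  + by have [] := ok_on_vote ch hi cn rc.
  + by have [] := ok_on_qc ch hi cn rc.
  + by have [] := ok_on_timeout ch hi cn rc.
  + by have [] := ok_on_tc ch hi cn rc.
  + have own x : genuine (ctx k i) x -> x.1 = i -> origin P (st k i) x.
      by move=> gx ex; rewrite -ex; apply: gx; rewrite ex.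
    by have [] := ok_on_proposal_request own hi cn rc.
  + by have [] := ok_on_ne_request hi cn rc.
  + by have [] // := @ok_on_ne _ _ _ _ P (ctx k i) ch j ne hi cn _ rc; exists j, ne, ch.
- have pos : 0 < cur_view (st k i) by move: en; rewrite /= /timer_due => /and3P [].
  have [|[h1 e1 _] _] := advances_time_out hi pos; first by apply: Or33.
  by have [? ?] := finish h1 e1 cn.
- move: en; rewrite /= /batch_due; case er: (recovery _) => [r|] // _.
  have [[h1 e1 _] _] := advances_request_batch ch hi er.
  by have [? ?] := finish h1 e1 cn.
move: en => /= /andP [_ v].
have g : all_genuine (ctx k i) (tip_sigs (tip_of p)).
  move=> x xm cx; have [y iy xy] := adm_fetch adm e xm cx.
  by apply: (inv_good h cx (j := y.1) (m := y.2)) => //; rewrite -surjective_pairing.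
have h1 := ok_add_proposal hi v g.
have e1 : extends (st k i) (add_proposal p (st k i)).
  by split=> //= y ys; rewrite -cats1; apply/In_cat; left.
by have [? ?] := finish h1 e1 cn.
Qed.

Lemma acts_extends s s' i w : extends s s' -> acts s i w -> acts s' i w.
Proof.
move=> e; have [h _ _] := e.
by case=> [/(issued_extends e)|[j [tc [? ?]]]]; [left|right; exists j, tc; auto].
Qed.

Lemma inv_all k : inv k.
Proof.
elim: k => [|k IH] i ci.
  split; last by rewrite (adm_init adm); exact: counted_init.
  by rewrite (adm_init adm); apply: ok_init; rewrite /= (adm_init adm).
have [h e cn] := inv_step IH ci; split=> //.
apply: (ok_rebase h) => //=.
  move=> x o cx; have [_ ex _] := inv_step IH cx.
  by apply: origin_extends ex (o cx).
move=> w v hq cl; have [j [tc [T [i1 i2 i3 i4]]]] := hq cl.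
have [_ [ex _ _] _] := inv_step IH cl.
by exists j, tc, T; split; auto.
Qed.

End Executions.

(** * Timers and first entries *)

Lemma ltn_quorum f : f < quorum f.
Proof. by rewrite /quorum ltnS leq_pmull. Qed.

Section Timing.

Variables (R : realType) (f : nat) (digest : eqType) (payload : Type).
Variable P : params R f digest payload.
Variable E : execution R f digest payload.
Hypothesis adm : admissible P E.

Local Notation st := (st E).
Local Notation time := (time E).
Local Notation correct := (correct E).
Local Notation ctx := (ctx P E).
Local Notation delta := (delta E).
Local Notation GST := (GST E).

Implicit Types (tc : TC f digest) (q : QC f digest).
Implicit Types (p : proposal f digest payload) (vt : vote f digest).
Implicit Types (M : timeout f digest) (m : msg f digest payload).
Implicit Types (i j : validator f) (w k : nat) (t : R).

Lemma delta_ge0 : (0 <= delta)%R.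
Proof. by have /andP [] := adm_delta adm. Qed.

Lemma delta_le : (delta <= Delta P)%R.
Proof. by have /andP [] := adm_delta adm. Qed.

Lemma st_ok k i : correct i -> ok P (ctx k i) (book_of (st k i)) [::] (st k i).
Proof. by case/(inv_all adm k). Qed.

Lemma st_counted k i : correct i -> counted (st k i).
Proof. by case/(inv_all adm k). Qed.

Lemma step_ok k i : correct i -> ok P (ctx k i) (book_of (st k.+1 i)) [::] (st k.+1 i).
Proof. by case/(inv_step adm (inv_all adm k)). Qed.

Lemma st_extends k k' i : correct i -> k <= k' -> extends (st k i) (st k' i).
Proof.
move=> ci; elim: k' => [|k' IH]; first by rewrite leqn0 => /eqP ->; split.
rewrite leq_eqVlt => /orP [/eqP ->|/IH e]; first by split.
have [_ e' _] := inv_step adm (inv_all adm k') ci; exact: extends_trans e'.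
Qed.

Lemma st_cur k k' i : correct i -> k <= k' -> cur_view (st k i) <= cur_view (st k' i).
Proof. by move=> ci /(st_extends ci) []. Qed.

Lemma st_grows k k' i : correct i -> k <= k' ->
  [/\ {subset entered (st k i) <= entered (st k' i)},
      highest_voted_view (st k i) <= highest_voted_view (st k' i),
      forall vt, List.In vt (votes (st k i)) -> List.In vt (votes (st k' i)),
      forall M, List.In M (timeouts (st k i)) -> List.In M (timeouts (st k' i)) &
      forall ne, List.In ne (ne_votes (st k i)) -> List.In ne (ne_votes (st k' i))].
Proof.
move=> ci; elim: k' => [|k' IH]; first by rewrite leqn0 => /eqP ->; split.
rewrite leq_eqVlt => /orP [/eqP ->|/IH [a1 a2 a3 a4 a5]]; first by split.
have h := step_ok k' ci; have [b1 b2 _ b4] := ok_mono h; have [b5 b6] := ok_bsub h.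
split.
- by move=> w /a1; apply: (ok_old h).
- exact: leq_trans b2.
- by move=> vt /a3 /b5.
- by move=> M /a4 /b6.
- by move=> ne /a5 /b4.
Qed.

Lemma time_le k k' : k <= k' -> (time k <= time k')%R.
Proof.
elim: k' => [|k' IH]; first by rewrite leqn0 => /eqP ->.
rewrite leq_eqVlt => /orP [/eqP -> //|/IH le].
exact: le_trans le (adm_time adm k').
Qed.

Lemma time_unbounded t : exists k, (t < time k)%R.
Proof.
have [k le] := adm_nonzeno adm (t + 1)%R; exists k.
by apply: lt_le_trans le; rewrite ltrDl.
Qed.

(* The number of events up to time [t]: [st (upto t)] is the state at time [t]. *)
Definition upto t := ex_minn (time_unbounded t).

Lemma ltn_upto k t : (k < upto t) = (time k <= t)%R.
Proof.
rewrite /upto; case: ex_minnP => K ltK minK; apply/idP/idP => [lt|le].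
  by rewrite leNgt; apply/negP => /minK; rewrite leqNgt lt.
rewrite ltnNge; apply/negP => leK; have := time_le leK.
by move=> h; have := lt_le_trans ltK h; rewrite ltNge le.
Qed.

Lemma upto_le t t' : (t <= t')%R -> upto t <= upto t'.
Proof.
case e: (upto t) => [//|k] le; rewrite ltn_upto; apply: le_trans le.
by rewrite -ltn_upto e.
Qed.

Local Notation at_time t i := (st (upto t) i).

Lemma at_cur t t' i : correct i -> (t <= t')%R ->
  cur_view (at_time t i) <= cur_view (at_time t' i).
Proof. by move=> ci /upto_le; apply: st_cur. Qed.

Lemma at_extends t t' i : correct i -> (t <= t')%R -> extends (at_time t i) (at_time t' i).
Proof. by move=> ci /upto_le; apply: st_extends. Qed.

Lemma some_correct (ss : seq (sig f digest)) :
  f.+1 <= size ss -> uniq [seq x.1 | x <- ss] -> exists2 x, x \in ss & correct x.1.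
Proof.
move=> le u; have [|x xs nb] := @size_uniq_card _ _ fst ss (byz E) u.
  by apply: leq_trans le; rewrite ltnS (adm_byz adm).
by exists x.
Qed.

Definition timed_out w k := [set j : validator f | correct j & sent_timeout w (st k j)].

Lemma timeouts_seen_card k i n w : timeouts_seen (ctx k i) n w ->
  n <= #|timed_out w k| + f.
Proof.
case=> ss [le u h]; apply: leq_trans le _; rewrite -(size_map fst).
rewrite -(card_uniqP u); apply: leq_trans (_ : #|timed_out w k :|: byz E| <= _).
  apply/subset_leq_card/subsetP => j /mapP [x xs ->]; rewrite !inE.
  have [gx [t [v e]]] := h x xs; case cj: (correct x.1).
    by have := gx cj; rewrite /origin e /= => -[_ ->].
  by move/negbFE: cj => ->; rewrite orbT.
apply: leq_trans (leq_card_setU _ _) _; by rewrite leq_add2l (adm_byz adm).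
Qed.

Lemma timeouts_seen_some k i n w : f < n -> timeouts_seen (ctx k i) n w ->
  exists j, [/\ correct j, sent_timeout w (st k j) & w <= cur_view (st k j)].
Proof.
move=> lt [ss [le u h]]; have [x xs cx] := some_correct (leq_trans lt le) u.
have [gx [t [v e]]] := h x xs; exists x.1.
by have := gx cx; rewrite /origin e /= => -[? ?]; split.
Qed.

Lemma votes_seen_some k i w : votes_seen (ctx k i) w ->
  exists j, [/\ correct j, w <= cur_view (st k j) & sent_timeout w (st k j) \/
    exists2 p, List.In p (proposals (st k j)) & p_view p = w].
Proof.
move=> [ss [le u h]]; have [|x xs cx] := some_correct _ u.
  exact: leq_trans (ltn_quorum f) le.
have [gx [b [d e]]] := h x xs; exists x.1.
by have := gx cx; rewrite /origin e /= => -[? ?]; split.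
Qed.

Lemma card_correct : quorum f <= #|[set j : validator f | correct j]|.
Proof.
have -> : [set j : validator f | correct j] = ~: byz E by apply/setP => j; rewrite !inE.
have := cardsC (byz E); rewrite card_ord; have := adm_byz adm.
by rewrite /quorum; move: #|byz E| #|~: byz E| => x y; lia.
Qed.

(** Views are not skipped. At the first event bringing a correct validator to a view at least [w],
    the certificate in use is backed by a correct validator that was already in the preceding view,
    and before this event no correct one had reached [w]. *)
Lemma entry_from_cur k i w : correct i -> 0 < w -> w <= cur_view (st k i) ->
  exists2 k0, k0 < k & exists i0, enters E k0 i0 w.
Proof.
move=> ci w0 le.
have ex : exists k, [exists j, correct j && (w <= cur_view (st k j))].
  by exists k; apply/existsP; exists i; rewrite ci.
case: (ex_minnP ex) => K /existsP [j /andP [cj lej]] minK.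
have leK : K <= k by apply: minK; apply/existsP; exists i; rewrite ci.
case: K lej minK leK => [|K] lej minK leK.
  by move: lej; rewrite (adm_init adm) /=; lia.
exists K => //; exists j.
have lt0 j' : correct j' -> cur_view (st K j') < w.
  move=> cj'; rewrite ltnNge; apply/negP => le'.
  have := minK K; rewrite ltnn => h; suff : false by [].
  by apply: h; apply/existsP; exists j'; rewrite cj'.
have h := step_ok K cj; set w' := cur_view (st K.+1 j) in lej.
have we : w' \in entered (st K.+1 j) by apply: (ok_cur h); apply: leq_trans lej.
have wn : w' \notin entered (st K j).
  apply/negP => /(ok_ent (st_ok K cj)) /andP [_ le'].
  by have := lt0 j cj; rewrite ltnNge (leq_trans lej le').
have [_ cs _] := ok_new h we wn.
suff ew : w' = w by rewrite /enters cj -ew wn we.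
have : w'.-1 < w.
  case: cs => [->//|/votes_seen_some [j' [cj' le' _]]|].
    exact: leq_ltn_trans le' (lt0 _ cj').
  move=> /timeouts_seen_some [|j' [cj' _ le']]; first exact: ltn_quorum.
  exact: leq_ltn_trans le' (lt0 _ cj').
by move: lej; rewrite -/w'; lia.
Qed.

Lemma first_entryP k i w : correct i -> 0 < w -> w <= cur_view (st k i) ->
  exists a, first_entry E w a.
Proof.
move=> ci w0 le; have [k0 _ [i0 e0]] := entry_from_cur ci w0 le.
have ex : exists k, [exists j, enters E k j w] by exists k0; apply/existsP; exists i0.
case: (ex_minnP ex) => K /existsP [j ej] minK; exists (time K); split; first by exists K, j.
by move=> k' i' e'; apply: time_le; apply: minK; apply/existsP; exists i'.
Qed.

Lemma first_entry_le w a i t : first_entry E w a -> correct i -> 0 < w ->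
  w <= cur_view (at_time t i) -> (a <= t)%R.
Proof.
case=> _ h ci w0 le; have [k0 lt [i0 e0]] := entry_from_cur ci w0 le.
by apply: le_trans (h _ _ e0) _; rewrite -ltn_upto.
Qed.

Lemma first_entry_at w a : first_entry E w a -> exists2 i, correct i &
  w \in entered (at_time a i).
Proof.
case=> -[k [i [/and3P [ci _ e] et]]] _; exists i => //.
have lt : k < upto a by rewrite ltn_upto et.
by have [s _ _ _ _] := st_grows ci lt; apply: s.
Qed.

Lemma entered_cur k i w : correct i -> w \in entered (st k i) -> 0 < w <= cur_view (st k i).
Proof. by move=> ci; apply: (ok_ent (st_ok k ci)). Qed.

Lemma timer_start k i : correct i -> 0 < cur_view (st k i) ->
  exists k1, [/\ k1 < k, timer (st k i) = clock E i (time k1),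
    cur_view (st k1.+1 i) = cur_view (st k i) & cur_view (st k1 i) < cur_view (st k i)].
Proof.
move=> ci; elim: k => [|k IH]; first by rewrite (adm_init adm).
have [[-> ec]|[-> lt]] := ok_timer (step_ok k ci).
  by rewrite ec => /IH [k1 [? ? ? ?]]; exists k1; split=> //; apply: ltnW.
by exists k.
Qed.

(** Consider the first timeout of [w] sent by a correct validator. It cannot answer [f + 1]
    timeouts, one of which would be correct and earlier; so a timer expired, and this timer was
    started in [w], not before [a], on a clock that is accurate from then on. *)
Lemma no_early_timeout w a i t : first_entry E w a -> (GST <= a)%R -> correct i ->
  sent_timeout w (at_time t i) -> (a + theta_view P <= t)%R.
Proof.
move=> [_ ha] ga ci sti.
have ex : exists k, [exists j, correct j && sent_timeout w (st k j)].
  by exists (upto t); apply/existsP; exists i; rewrite ci.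
case: (ex_minnP ex) => K /existsP [j /andP [cj sj]] minK.
have leK : K <= upto t by apply: minK; apply/existsP; exists i; rewrite ci.
case: K sj minK leK => [|K] sj minK leK; first by move: sj; rewrite (adm_init adm).
have none j' : correct j' -> ~ sent_timeout w (st K j').
  move=> cj' s'; have := minK K; rewrite ltnn => h.
  by suff : false by []; apply: h; apply/existsP; exists j'; rewrite cj'.
case: (ok_to (step_ok K cj) sj) => [/(none j cj) //|/timeouts_seen_some|].
  by case=> // j' [cj' /(none j' cj')].
rewrite /= /timer_due => -[/and3P [pos _ due] ew].
have [k1 [lt1 et ec lt]] := timer_start cj pos.
have e1 : enters E k1 j w.
  apply/and3P; split=> //.
    by apply/negP => /(entered_cur cj) /andP [_]; rewrite leqNgt -ew lt.
  rewrite -ew -ec; apply: (ok_cur (st_ok _ cj)); by rewrite ec.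
have a1 := ha _ _ e1; have l1 := time_le (ltnW lt1).
rewrite et (adm_clock_gst adm) // in due; last exact: le_trans a1.
have : (time K <= t)%R by rewrite -ltn_upto.
by move: a1 due; lra.
Qed.

(** The timer may have been started before [GST] on a drifting clock, but no later than [t];
    monotonicity of the clock bounds its initial reading by that at [t], and from [t] on the clock
    is accurate. *)
Lemma view_timeout w i t : correct i -> 0 < w -> (GST <= t)%R ->
  w <= cur_view (at_time t i) -> (0 <= theta_view P)%R ->
  w < cur_view (at_time (t + theta_view P) i) \/
  sent_timeout w (at_time (t + theta_view P) i).
Proof.
move=> ci w0 gt le th0; set t' := (t + _)%R.
have let' : (t <= t')%R by rewrite /t'; lra.
have le' := at_cur ci let'; case: ltngtP (leq_trans le le') => // [|ew _]; first by left.
right; have pos : 0 < cur_view (at_time t' i) by rewrite -ew.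
have [k1 [lt1 et ec lt]] := timer_start ci pos.
have k1t : (time k1 <= t)%R.
  rewrite -ltn_upto ltnNge; apply/negP => /(st_cur ci) le2.
  by move: lt; rewrite -ew ltnNge (leq_trans le le2).
case eK: (upto t') pos lt1 => [//|K] pos lt1; rewrite -eK in pos.
have b1 : (time K <= t')%R by rewrite -ltn_upto eK.
have b2 : (t' < time K.+1)%R by rewrite ltNge -ltn_upto eK ltnn.
have /andP [nd _] := adm_timers adm ci b1 b2; move: nd.
rewrite /timer_due /started -eK pos -ew /= negb_and negbK => /orP [] //.
rewrite et => /negP []; have c1 := adm_clock adm i k1t.
have := adm_clock_gst adm i gt let'; move: c1; rewrite {2}/t'; lra.
Qed.

End Timing.

(** * Message delivery *)

Section Delivery.

Variables (R : realType) (f : nat) (digest : eqType) (payload : Type).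
Variable P : params R f digest payload.
Variable E : execution R f digest payload.
Hypothesis adm : admissible P E.

Local Notation st := (st E).
Local Notation time := (time E).
Local Notation ev := (ev E).
Local Notation correct := (correct E).
Local Notation ctx := (ctx P E).
Local Notation delta := (delta E).
Local Notation GST := (GST E).
Local Notation upto := (upto adm).
Local Notation at_time t i := (st (upto t) i).

Implicit Types (tc : TC f digest) (q : QC f digest).
Implicit Types (p : proposal f digest payload) (vt : vote f digest).
Implicit Types (M : timeout f digest) (m : msg f digest payload).
Implicit Types (i j : validator f) (w k : nat) (t : R).

Lemma sent_new k i y : correct i -> List.In y (sent (st k i)) ->
  exists2 k0, k0 < k & List.In y (new_sent E k0 i).
Proof.
move=> ci; elim: k => [|k IH]; first by rewrite (adm_init adm).
have [l el] := ok_ext (step_ok adm k ci); rewrite /= in el.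
rewrite el => /In_cat [/IH [k0 ? ?]|yl]; first by exists k0 => //; apply: ltnW.
by exists k; rewrite // /new_sent el drop_size_cat.
Qed.

(** Keeps the order of sending and reception, which matters when a reply must find Recover
    running. *)
Lemma delivered_new k i j m t : correct i -> correct j -> (GST <= t)%R ->
  k < upto t -> List.In (j, m) (new_sent E k i) ->
  exists k' ch, [/\ k < k', k' < upto (t + delta)%R & ev k' = Some (j, InMsg i m, ch)].
Proof.
move=> ci cj gt lt h; have [k' [ch [l1 e l2]]] := adm_delivery adm ci cj h.
exists k', ch; split=> //; rewrite ltn_upto; apply: le_trans l2 _.
rewrite lerD2r ge_max gt andbT; by rewrite -(ltn_upto adm).
Qed.

Lemma delivered i j m t : correct i -> correct j -> (GST <= t)%R ->
  List.In (j, m) (sent (at_time t i)) ->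
  exists k ch, k < upto (t + delta)%R /\ ev k = Some (j, InMsg i m, ch).
Proof.
move=> ci cj gt /(sent_new ci) [k0 lt /(delivered_new ci cj gt lt)].
by case=> k [ch [_ ? ?]]; exists k, ch.
Qed.

Lemma event_step k i a ch : ev k = Some (i, a, ch) ->
  st k.+1 i = step P i (clock E i (time k)) a ch (st k i).
Proof. by move=> e; have := adm_step adm k; rewrite e => -[]. Qed.

Lemma event_received k i j m ch : ev k = Some (i, InMsg j m, ch) ->
  received P (ctx k i) j m.
Proof. exact: (inv_received adm (inv_all adm k)). Qed.

Section OneDelivery.

Variables (i j : validator f) (t : R).
Hypotheses (ci : correct i) (cj : correct j) (gt : (GST <= t)%R).
Local Notation t' := (t + delta)%R.

Lemma deliver_qc q : List.In (j, MQC payload q) (sent (at_time t i)) ->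
  (i = leader f (q_view q) \/ j = leader f (q_view q).+1 ->
     q_view q < cur_view (at_time t' j)) /\
  (j = leader f (q_view q) ->
     q_view q < cur_view (at_time t' j) \/ to_all (MQC payload q) (at_time t' j)).
Proof.
move=> h; have [[vq _] _] := ok_sent (st_ok adm _ ci) h.
have [k [ch [lt e]]] := delivered ci cj gt h.
have [_ _ _ /(_ vq) [h1 h2]] := ok_on_qc ch (st_ok adm k cj) (st_counted adm k cj) (event_received e).
have es := event_step e; rewrite /= in es h1 h2; rewrite -es in h1 h2.
have le := st_cur adm cj lt; split.
  by move=> /h1 l; apply: leq_trans le.
move=> /h2 [l|a]; [left|right].
  by apply: leq_trans (leq_trans (st_cur adm cj (ltnW lt)) (leqnn _)).
exact: to_all_extends (st_extends adm cj lt) a.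
Qed.

Lemma deliver_tc tc : List.In (j, MTC payload tc) (sent (at_time t i)) ->
  tc_view tc < cur_view (at_time t' j).
Proof.
move=> h; have [[vq _] _] := ok_sent (st_ok adm _ ci) h.
have [k [ch [lt e]]] := delivered ci cj gt h.
have [_ _ _ /(_ vq) h1] := ok_on_tc ch (st_ok adm k cj) (st_counted adm k cj) (event_received e).
have es := event_step e; rewrite /= in es h1; rewrite -es in h1.
exact: leq_trans h1 (st_cur adm cj lt).
Qed.

Lemma deliver_timeout M : List.In (j, MTimeout payload M) (sent (at_time t i)) ->
  m_view M < cur_view (at_time t' j) \/
  exists M', [/\ List.In M' (timeouts (at_time t' j)), m_view M' = m_view M &
                 (m_sig M').1 = (m_sig M).1].
Proof.
move=> h; have [[vq _ _ _] _] := ok_sent (st_ok adm _ ci) h.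
have [k [ch [lt e]]] := delivered ci cj gt h.
have [_ _ _ /(_ vq) h1] := ok_on_timeout ch (st_ok adm k cj) (st_counted adm k cj) (event_received e).
have es := event_step e; rewrite /= in es h1; rewrite -es in h1.
have [_ _ _ tM _] := st_grows adm cj lt.
case: h1 => [l|[M' [? ? ?]]]; first by left; apply: leq_trans l (st_cur adm cj lt).
by right; exists M'; split=> //; apply: tM.
Qed.

Lemma deliver_proposal p : List.In (j, MProposal p) (sent (at_time t i)) ->
  i = leader f (p_view p) -> p_view p <= cur_view (at_time t' j) /\
  (cur_view (at_time t' j) <= p_view p -> p_view p <= highest_voted_view (at_time t' j)).
Proof.
move=> h il; have [vp _] := ok_sent (st_ok adm _ ci) h.
have [k [ch [lt e]]] := delivered ci cj gt h.
have [_ _ /(_ vp) [_ /(_ il) [h1 h2] _]] := ok_on_proposal (st_ok adm k cj) (event_received e).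
have es := event_step e; rewrite /= in es h1 h2; rewrite -es in h1 h2.
have [_ hv _ _ _] := st_grows adm cj lt.
split; first exact: leq_trans h1 (st_cur adm cj lt).
move=> le; apply: leq_trans hv; apply: h2; apply: leq_trans le.
exact: (st_cur adm cj (ltnW lt)).
Qed.

Lemma deliver_ne_request tc : List.In (j, MNERequest payload tc) (sent (at_time t i)) ->
  tc_view tc < cur_view (at_time t' j) /\ forall T, tc_high_tip tc = Some T ->
  cur_view (at_time t' j) <= (tc_view tc).+1 ->
  voted_for (tip_id T) (at_time t' j) \/ sent_ne (tc_view tc).+1 (at_time t' j).
Proof.
move=> h; have [[vp il _ nT _] _] := ok_sent (st_ok adm _ ci) h.
have [k [ch [lt e]]] := delivered ci cj gt h.
have [_ _ _ /(_ vp il nT) [h1 h2]] :=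
  ok_on_ne_request (st_ok adm k cj) (st_counted adm k cj) (event_received e).
have es := event_step e; rewrite /= in es h1 h2; rewrite -es in h1 h2.
split; first exact: leq_trans h1 (st_cur adm cj lt).
move=> T eT le; have e1 := st_extends adm cj lt; have [e2 _ _] := e1.
case: (h2 T eT); last by right; apply: sent_ne_extends e1 _.
  by apply: leq_trans le; exact: (st_cur adm cj (ltnW lt)).
by move=> /voted_forP [j' [vt [? ?]]]; left; apply/voted_forP; exists j', vt; split; auto.
Qed.

Lemma deliver_vote vt : List.In (j, MVote payload vt) (sent (at_time t i)) ->
  j = leader f (vt_view vt) ->
  List.In vt (votes (at_time t' j)) \/ vt_view vt < cur_view (at_time t' j).
Proof.
move=> h jl; have [[vv _ _ _ _] _] := ok_sent (st_ok adm _ ci) h.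
have [k [ch [lt e]]] := delivered ci cj gt h.
have [_ _ _ /(_ vv jl) h1] :=
  ok_on_vote ch (st_ok adm k cj) (st_counted adm k cj) (event_received e).
have es := event_step e; rewrite /= in es h1; rewrite -es in h1.
have [_ _ sv _ _] := st_grows adm cj lt.
by case: h1 => [/sv|l]; [left|right; apply: leq_trans l (st_cur adm cj lt)].
Qed.

Lemma deliver_ne ne : List.In (j, MNE payload ne) (sent (at_time t i)) ->
  List.In ne (ne_votes (at_time t' j)).
Proof.
move=> h; have [[vv _ _ _] _] := ok_sent (st_ok adm _ ci) h.
have [k [ch [lt e]]] := delivered ci cj gt h.
have an : adds_ne (ctx k j) by exists i, ne, ch.
have [_ _ _ [/(_ vv) [h1 _] _]] :=
  ok_on_ne ch (st_ok adm k cj) (st_counted adm k cj) an (event_received e).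
have es := event_step e; rewrite /= in es h1; rewrite -es in h1.
have [_ _ _ _ sn] := st_grows adm cj lt; apply: sn.
by rewrite h1 -cats1; apply/In_cat; right; left.
Qed.

End OneDelivery.

(** [issued] shows a single recipient. The signature on the identifier leads, through [origin], to a
    broadcast proposal, and the identifier determines its view. *)
Lemma issued_sent k i w : correct i -> issued i w (st k i) ->
  exists p, [/\ to_all (MProposal p) (st k i), valid_proposal P p, p_view p = w,
                (p_sig p).1 = i & i = leader f w].
Proof.
move=> ci /issuedP [j [p [ip ew es]]].
have [vp g] := ok_sent (st_ok adm k ci) ip.
have [eid esg] := valid_proposal_id vp.
have gx : origin_before P E k (p_sig p).
  by apply: (inv_good (inv_all adm k) ci ip); rewrite mem_head.
have := gx; rewrite /origin_before es => /(_ ci); rewrite /origin esg /=.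
case=> p' [a eid' vp' _ es']; have [eid2 _] := valid_proposal_id vp'.
have ev' : p_view p' = p_view p by move: eid'; rewrite eid eid2 => /proposal_id_inj [].
exists p'; split=> //; first by rewrite ev'.
  by rewrite es' -es esg.
by rewrite -es esg /= ew.
Qed.

(** The signature of the leader covers the identifier only, so the stored proposal need not be equal
    to the one that was sent. *)
Lemma stored_issued k i p w : correct i -> List.In p (proposals (st k i)) -> p_view p = w ->
  correct (leader f w) -> exists2 p', List.In (leader f w, MProposal p') (sent (st k (leader f w))) &
    [/\ p_id p' = p_id p, p_view p' = w & (p_sig p').1 = leader f w].
Proof.
move=> ci ip ew cl; have [vp gp] := ok_props (st_ok adm k ci) ip.
have [eid es] := valid_proposal_id vp.
have gx : origin_before P E k (p_sig p) by apply: gp; rewrite mem_head.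
have := gx; rewrite /origin_before es /= ew => /(_ cl); rewrite /origin /=.
case=> p' [a eid' vp' _ es']; have [eid2 _] := valid_proposal_id vp'.
have ev' : p_view p' = p_view p by move: eid'; rewrite eid eid2 => /proposal_id_inj [].
by exists p' => //; rewrite ev' es'.
Qed.

Lemma acts_all w t : correct (leader f w) -> (GST <= t)%R ->
  acts (at_time t (leader f w)) (leader f w) w ->
  forall j, correct j -> w <= cur_view (at_time (t + delta)%R j).
Proof.
move=> cl gt [/(issued_sent cl) [p [a vp ew _ _]]|[j' [tc [h ew]]]] j cj.
  have [|h1 _] := deliver_proposal cl cj gt (a j); first by rewrite ew.
  by rewrite -ew.
have [[_ _ _ _ a] _] := ok_sent (st_ok adm _ cl) h.
by have [h1 _] := deliver_ne_request cl cj gt (a j); rewrite -ew.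
Qed.

Lemma acts_cur k i w : correct i -> acts (st k i) i w -> w <= cur_view (st k i).
Proof.
move=> ci [/issuedP [j [p [ip ew es]]]|[j' [tc [h <-]]]]; last first.
  by have [[_ _ ? _ _] _] := ok_sent (st_ok adm k ci) h.
have [vp g] := ok_sent (st_ok adm k ci) ip.
have [eid esg] := valid_proposal_id vp.
have gx : origin_before P E k (p_sig p).
  by apply: (inv_good (inv_all adm k) ci ip); rewrite mem_head.
have := gx; rewrite /origin_before es => /(_ ci); rewrite /origin esg /=.
case=> p' [a eid' vp' le _]; have [eid2 _] := valid_proposal_id vp'.
have ev' : p_view p' = p_view p by move: eid'; rewrite eid eid2 => /proposal_id_inj [].
by rewrite -ew -ev'.
Qed.

Lemma timed_out_sent k i w : correct i -> sent_timeout w (st k i) ->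
  exists M, [/\ to_all (MTimeout payload M) (st k i), m_view M = w & (m_sig M).1 = i].
Proof.
move=> ci /sent_timeoutP [j [M [h ew]]].
by have [[_ a es _] _] := ok_sent (st_ok adm k ci) h; exists M.
Qed.

Lemma size_timeouts_of (S : {set validator f}) w (Ms : seq (timeout f digest)) :
  (forall i, i \in S -> exists M, [/\ List.In M Ms, m_view M = w & (m_sig M).1 = i]) ->
  #|S| <= size (timeouts_of w Ms).
Proof.
move=> h; rewrite cardE -(size_map (fun M => (m_sig M).1)).
apply: uniq_leq_size (enum_uniq _) _ => i; rewrite mem_enum => /h [M [iM ew <-]].
by apply/In_mem/List.in_map_iff; exists M; split=> //; apply/In_filter; rewrite ew eqxx.
Qed.

Lemma timed_out_counted w t j : correct j -> (GST <= t)%R ->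
  w < cur_view (at_time (t + delta)%R j) \/
  #|timed_out E w (upto t)| <= size (timeouts_of w (timeouts (at_time (t + delta)%R j))).
Proof.
move=> cj gt; case: leqP => [le|]; [right|by left].
apply: size_timeouts_of => i; rewrite inE => /andP [ci /(timed_out_sent ci) [M [a ew es]]].
case: (deliver_timeout ci cj gt (a j)) => [|[M' [? e1 e2]]]; first by rewrite ew ltnNge le.
by exists M'; rewrite e1 e2.
Qed.

Lemma all_timed_out w t : (GST <= t)%R ->
  (forall i, correct i -> sent_timeout w (at_time t i)) ->
  forall j, correct j -> w < cur_view (at_time (t + delta)%R j).
Proof.
move=> gt h j cj; case: (timed_out_counted w cj gt) => // le.
rewrite ltnNge; apply/negP => /(cn_timeouts (st_counted adm _ cj)).
rewrite ltnNge => /negP; apply; apply: leq_trans le.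
apply: leq_trans (card_correct adm) _; apply/subset_leq_card/subsetP => i.
by rewrite !inE => ci; rewrite ci h.
Qed.

Lemma some_timed_out w t : (GST <= t)%R -> f < #|timed_out E w (upto t)| ->
  forall j, correct j -> w < cur_view (at_time (t + delta)%R j) \/
    sent_timeout w (at_time (t + delta)%R j).
Proof.
move=> gt lt j cj; case: (timed_out_counted w cj gt) => [|le]; [by left|right].
by apply: (cn_sent (st_counted adm _ cj)); apply: leq_trans le.
Qed.

End Delivery.

(** * Synchronisation by a correct leader *)

Section ViewSynchronisation.

Variables (R : realType) (f : nat) (digest : eqType) (payload : Type).
Variable P : params R f digest payload.
Variable E : execution R f digest payload.
Hypothesis adm : admissible P E.

Local Notation st := (st E).
Local Notation time := (time E).
Local Notation correct := (correct E).
Local Notation ctx := (ctx P E).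
Local Notation delta := (delta E).
Local Notation GST := (GST E).
Local Notation upto := (upto adm).
Local Notation at_time t i := (st (upto t) i).

Implicit Types (tc : TC f digest) (q : QC f digest).
Implicit Types (p : proposal f digest payload) (vt : vote f digest).
Implicit Types (M : timeout f digest) (m : msg f digest payload).
Implicit Types (i j : validator f) (w k : nat) (t a : R).

Lemma leader_next w : 0 < f -> leader f w <> leader f w.+1.
Proof.
move=> f0 /(congr1 (@nat_of_ord _)); rewrite /leader !inordK ?ltn_pmod // /n_validators.
move=> /eqP; rewrite -[w.+1]addn1 -{1}[w]addn0 eqn_modDl.
by rewrite mod0n modn_small //; lia.
Qed.

Lemma entry_event k i w : correct i -> w \in entered (st k i) -> exists k0,
  [/\ k0 < k, w \notin entered (st k0 i), cur_view (st k0 i) < w,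
      w \in entered (st k0.+1 i) & justified P (ctx k0 i) w (st k0.+1 i)].
Proof.
move=> ci; elim: k => [|k IH]; first by rewrite (adm_init adm).
move=> we; case: (boolP (w \in entered (st k i))) => [/IH [k0 [? ? ? ? ?]]|wn].
  by exists k0; split=> //; apply: ltnW.
have [lt _ []] := ok_new (step_ok adm k ci) we wn => //.
by exists k; split.
Qed.

Lemma started_before_gst k i : correct i -> (GST <= time k)%R -> 0 < cur_view (st k i).
Proof.
move=> ci gk; have [k1 [ch [e lt]]] := adm_start adm ci.
have lt1 : k1 < k.
  rewrite ltnNge; apply/negP => /(time_le adm) le.
  by move: (lt_le_trans lt (le_trans gk le)); rewrite ltxx.
apply: leq_trans (st_cur adm ci lt1).
rewrite (event_step adm e) /= /start /andthen /when.
have e1 : 0 < cur_view (enter (clock E i (time k1)) (CertQC (genesis_qc P)) (st k1 i)).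
  by rewrite (enter_cur (ctx k1 i)) leq_max orbT.
by case: ifP => // _; rewrite /propose_qc /propose; case: ifP.
Qed.

Lemma theta_recovery_ge : (2%:R * Delta P <= theta_recovery P)%R.
Proof.
rewrite /theta_recovery lerDr mulr_ge0 ?ler0n //; exact: theta_interval_ge0.
Qed.

Section CorrectLeader.

Variables (w : nat) (a : R).
Hypotheses (w0 : 0 < w) (f0 : 0 < f) (ha : first_entry E w a) (ga : (GST <= a)%R).
Local Notation L := (leader f w).
Hypothesis cl : correct L.

Let d0 := delta_ge0 adm.
Let dD := delta_le adm.
Let D0 := Delta_gt0 P.

Lemma no_timeout i t : correct i -> (t < a + theta_view P)%R -> ~ sent_timeout w (at_time t i).
Proof. by move=> ci lt /(no_early_timeout ha ga ci); rewrite leNgt lt. Qed.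

(** Before the timers expire, [w] can only be left through a quorum of votes; one of them is from a
    correct validator, which has stored a proposal signed by the leader. *)
Lemma above_acts i t : correct i -> (t < a + theta_view P)%R -> w < cur_view (at_time t i) ->
  acts (at_time t L) L w.
Proof.
move=> ci lt lw; have [k0 ltk [i0 /and3P [ci0 wn we]]] := entry_from_cur adm ci (ltn0Sn w) lw.
have notime j : correct j -> ~ sent_timeout w (st k0 j).
  move=> cj /(sent_timeout_extends (st_extends adm cj (ltnW ltk))).
  exact: no_timeout.
have [_ cs _] := ok_new (step_ok adm k0 ci0) we wn; case: cs => /=.
- by move=> e; move: w0; rewrite e.
- move=> /(votes_seen_some adm) [j [cj _ [/(notime j cj) //|[p ip ew]]]].
  have [p' h [_ ew' es]] := stored_issued adm cj ip ew cl.
  apply: acts_extends (st_extends adm cl (ltnW ltk)) _; left.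
  by apply/issuedP; exists L, p'.
by move=> /(timeouts_seen_some adm) [|j [cj /(notime j cj) //]]; apply: ltn_quorum.
Qed.

(** By [justified], the leader acts on entering [w] unless it also leads the preceding view, which
    [0 < f] excludes. *)
Lemma entered_leader_acts t : (t < a + theta_view P)%R -> w <= cur_view (at_time t L) ->
  acts (at_time t L) L w.
Proof.
move=> lt; rewrite leq_eqVlt => /orP [/eqP ew|lw]; last exact: above_acts cl lt lw.
have we : w \in entered (at_time t L).
  by rewrite {1}ew; apply: (ok_cur (st_ok adm _ cl)); rewrite -ew.
have [k0 [lt0 wn _ we0 [_ /= h]]] := entry_event cl we.
have [||[_ ac]|ld] := h.
- by [].
- by move=> e; apply: (@leader_next w.-1 f0); rewrite prednK.
- exact: acts_extends (st_extends adm cl lt0) ac.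
- exact: acts_extends (st_extends adm cl (ltnW lt0)) (ld cl).
Qed.

Lemma leader_acts : acts (at_time (a + 2%:R * delta)%R L) L w.
Proof.
set T2 := (a + _)%R.
have lt2 : (T2 < a + theta_view P)%R.
  rewrite /T2 /theta_view; have := theta_recovery_ge; move: d0 dD D0; lra.
have e2 : (a + delta + delta)%R = T2 by rewrite /T2 mulr_natl mulr2n addrA.
have a1 : (a <= a + delta)%R by move: d0; lra.
have a2 : (a + delta <= T2)%R by rewrite -e2; move: d0; lra.
case: (boolP (w <= cur_view (at_time T2 L))) => [|nle]; first exact: entered_leader_acts.
rewrite -ltnNge in nle.
have nacts k : k <= upto T2 -> ~ acts (st k L) L w.
  move=> le ac; have := acts_cur adm cl ac; apply/negP; rewrite -ltnNge.
  exact: leq_ltn_trans (st_cur adm cl le) nle.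
(* As the leader is supposed to be below [w] at [T2], all evidence that would have reached it is
   excluded; what remains is an own timeout of the preceding view. *)
have late i t : correct i -> (a <= t)%R -> (t <= a + delta)%R -> w \in entered (at_time t i) ->
    sent_timeout w.-1 (at_time t i) /\
    exists k0, k0 < upto t /\ timeouts_seen (ctx k0 i) (quorum f) w.-1.
  move=> ci at1 at2 we; have [k0 [lt wn cw we0 [jw _]]] := entry_event ci we.
  have le2 : k0.+1 <= upto T2 by apply: leq_trans lt _; apply: upto_le; apply: le_trans a2.
  have gt : (GST <= t)%R by apply: le_trans at1.
  have ex := st_extends adm ci lt.
  have tT : (t + delta <= T2)%R by move: at2; rewrite -e2; lra.
  have low : cur_view (at_time (t + delta)%R L) < w.
    exact: leq_ltn_trans (at_cur adm cl tT) nle.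
  case: jw => /=.
  (* Correct validators start before [GST], so none of them enters view 1 at [a] or later. *)
  - move=> e; have en : enters E k0 i w by apply/and3P.
    have [_ /(_ _ _ en) /(le_trans ga) /(started_before_gst ci)] := ha.
    by move: cw; rewrite e ltnS leqn0 => /eqP ->.
  - by case=> /= il ac; have := nacts _ le2; rewrite -il.
  - by move=> ld _; have := nacts _ (ltnW le2); case; apply: ld.
  - move=> q vq ew iL _; have [ext _ _] := ex.
    have [h _] := deliver_qc ci cl gt (ext _ iL).
    have lq : q_view q < cur_view (at_time (t + delta)%R L) by apply: h; right; rewrite ew.
    by move: low; rewrite ltnNge -[X in X <= _]ew lq.
  - move=> sw seen; split; first exact: sent_timeout_extends ex sw.
    by exists k0.
  - move=> tc ew al _; have [ext _ _] := ex.
    have lq := deliver_tc ci cl gt (ext _ (al L)).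
    by move: low; rewrite ltnNge -[X in X <= _]ew lq.
have [i0 ci0 we0] := first_entry_at adm ha.
have [_ [k0 [lt0 seen]]] := late _ _ ci0 (lexx a) a1 we0.
have card : f < #|timed_out E w.-1 (upto a)|.
  have := timeouts_seen_card adm seen.
  suff /subset_leq_card : timed_out E w.-1 k0 \subset timed_out E w.-1 (upto a).
    move=> le1 le2; rewrite -(ltn_add2r f); apply: leq_trans (leq_add le1 (leqnn f)).
    by apply: leq_trans le2; rewrite /quorum mul2n -addnn.
  apply/subsetP => j; rewrite !inE => /andP [cj sj]; rewrite cj /=.
  exact: sent_timeout_extends (st_extends adm cj (ltnW lt0)) sj.
(* A validator that has already left [w.-1] is exactly in [w], as nobody gets above [w] before the
   leader acts; by [late] it has timed out as well. *)
have all_out i : correct i -> sent_timeout w.-1 (at_time (a + delta)%R i).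
  move=> ci; case: (some_timed_out ga card ci) => // lw.
  have lw' : w <= cur_view (at_time (a + delta)%R i) by rewrite -(prednK w0).
  have ew : cur_view (at_time (a + delta)%R i) = w.
    apply/eqP; rewrite eqn_leq lw' andbT leqNgt; apply/negP => lw2.
    have lt1 : (a + delta < a + theta_view P)%R by apply: le_lt_trans a2 lt2.
    exact: (nacts _ (upto_le adm a2)) (above_acts ci lt1 lw2).
  have we : w \in entered (at_time (a + delta)%R i).
    by rewrite -ew; apply: (ok_cur (st_ok adm _ ci)); rewrite ew.
  by have [] := late _ _ ci a1 (lexx _) we.
have gt1 : (GST <= a + delta)%R by apply: le_trans a1.
have := all_timed_out gt1 all_out cl; rewrite e2 => lw.
by move: nle; rewrite ltnNge -[X in X <= _](prednK w0) lw.
Qed.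

Lemma all_enter j : correct j -> w <= cur_view (at_time (a + 3%:R * delta)%R j).
Proof.
have -> : (a + 3%:R * delta = a + 2%:R * delta + delta)%R by lra.
apply: acts_all => //; first by move: ga d0; lra.
exact: leader_acts.
Qed.

End CorrectLeader.

End ViewSynchronisation.

(** * Progress of a post-GST view with a correct leader *)

Section LiveView.

Variables (R : realType) (f : nat) (digest : eqType) (payload : Type).
Variable P : params R f digest payload.
Variable E : execution R f digest payload.
Hypothesis adm : admissible P E.

Local Notation st := (st E).
Local Notation time := (time E).
Local Notation correct := (correct E).
Local Notation delta := (delta E).
Local Notation GST := (GST E).
Local Notation upto := (upto adm).
Local Notation at_time t i := (st (upto t) i).

Implicit Types (tc : TC f digest) (q : QC f digest).
Implicit Types (p : proposal f digest payload) (vt : vote f digest).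
Implicit Types (M : timeout f digest) (m : msg f digest payload).
Implicit Types (i j : validator f) (w k : nat) (t a : R).

Lemma size_ge_correct (ss : seq (sig f digest)) :
  (forall j, correct j -> j \in [seq x.1 | x <- ss]) -> quorum f <= size ss.
Proof.
move=> h; apply: leq_trans (card_correct adm) _; rewrite cardE -(size_map fst).
apply: uniq_leq_size (enum_uniq _) _ => j; rewrite mem_enum inE; exact: h.
Qed.

(** One delay is for the proposal and one for the votes. If nobody had left [w], the leader would
    hold votes of all correct validators for one identifier, against [counted]. *)
Lemma issued_progress w t : correct (leader f w) -> 0 < w -> (GST <= t)%R ->
  issued (leader f w) w (at_time t (leader f w)) ->
  (forall j, correct j -> ~ sent_timeout w (at_time (t + delta)%R j)) ->
  ~ (forall j, correct j -> cur_view (at_time (t + delta + delta)%R j) <= w).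
Proof.
move=> cl w0 gt iss nt low; set L := leader f w in cl iss *.
have d0 := delta_ge0 adm.
have l1 : (t <= t + delta)%R by lra.
have l2 : (t + delta <= t + delta + delta)%R by lra.
have gt1 : (GST <= t + delta)%R by apply: le_trans l1.
have [p [al vp ew es _]] := issued_sent adm cl iss.
set s := at_time (t + delta + delta)%R L.
have voted j : correct j -> exists vt,
    [/\ List.In vt (votes s), vt_id vt = p_id p, vt_view vt = w & (vt_sig vt).1 = j].
  move=> cj; have lowj := leq_trans (at_cur adm cj l2) (low _ cj).
  have pl : L = leader f (p_view p) by rewrite ew.
  have [_] := deliver_proposal cl cj gt (al j) pl.
  rewrite ew => /(_ lowj) hv; have h := st_ok adm (upto (t + delta)%R) cj.
  have ehv : highest_voted_view (at_time (t + delta)%R j) = w.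
    by apply/eqP; rewrite eqn_leq hv andbT (leq_trans (ok_hv h) lowj).
  (* A timeout also raises the highest voted view; [nt] rules this out, so a vote has been cast in
     [w]. *)
  have := ok_hvv h; rewrite ehv => /(_ w0) [/(nt _ cj) //|[j' [vt [iv ev']]]].
  have [[vv ej _ iL [p' [ip' eid ew']]] _] := ok_sent h iv.
  rewrite ev' in iL ew'; have [p2 ip2 [eid2 ew2 es2]] := stored_issued adm cj ip' ew' cl.
  exists vt; split=> //.
    have Lw : leader f w = leader f (vt_view vt) by rewrite ev'.
    case: (deliver_vote cj cl gt1 iL Lw) => //.
    by rewrite ev' ltnNge low.
  (* A correct leader signs a single identifier per view, so all these votes agree. *)
  rewrite -eid -eid2; apply: (ok_uniq (st_ok adm (upto (t + delta)%R) cl) ip2 (j' := L)) => //.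
    by have [h1 _ _] := at_extends adm cl l1; apply: h1; apply: al.
  by rewrite ew2 ew.
have [vt [iv eid ev' _]] := voted _ cl.
have := cn_votes (st_counted adm _ cl) iv; rewrite ev' low // => /(_ isT).
rewrite ltnNge => /negP; apply; apply: size_ge_correct => j /voted [vt' [iv' eid' _ <-]].
by apply: map_f; apply/id_sigsP; exists vt'; rewrite // eid' eid.
Qed.

Lemma recovery_start k i r : correct i -> recovery (st k i) = Some r ->
  exists2 k', k' < k & r_start r = clock E i (time k').
Proof.
move=> ci; elim: k r => [|k IH] r; first by rewrite (adm_init adm).
move=> /(ok_start (step_ok adm k ci)) [->|[r0 /IH [k' lt e1] <-]]; first by exists k.
by exists k' => //; apply: ltnW.
Qed.

Lemma request_alive k i j tc : correct i ->
  List.In (j, MNERequest payload tc) (sent (st k i)) ->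
  cur_view (st k i) <= (tc_view tc).+1 ->
  issued i (tc_view tc).+1 (st k i) \/
  exists2 r, recovery (st k i) = Some r & r_tc r = tc.
Proof.
move=> ci ij le; have h := st_ok adm k ci; have [[_ _ lt _ _] _] := ok_sent h ij.
have ew : cur_view (st k i) = (tc_view tc).+1 by apply/eqP; rewrite eqn_leq le.
by case: (ok_req h ij ew) => [|]; [rewrite /= ew; left|right].
Qed.

Lemma recovery_persists k k' i r : correct i -> k <= k' -> recovery (st k i) = Some r ->
  cur_view (st k' i) <= (tc_view (r_tc r)).+1 ->
  ~ issued i (tc_view (r_tc r)).+1 (st k' i) ->
  exists r', [/\ recovery (st k' i) = Some r', r_tc r' = r_tc r & r_start r' = r_start r].
Proof.
move=> ci le er; elim: k' le => [|k' IH] le.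
  by move: le; rewrite leqn0 => /eqP e; rewrite e in er; exists r.
move: le; rewrite leq_eqVlt => /orP [/eqP <-|le] low ni; first by exists r.
have [||r' [er' et es]] := IH le.
- exact: leq_trans (st_cur adm ci (leqnSn _)) low.
- by move=> iss; apply: ni; apply: issued_extends (st_extends adm ci (leqnSn _)) iss.
have h := step_ok adm k' ci.
have [_ [_ _ lt _ _] _ _] := ok_rec (st_ok adm k' ci) er'.
have ew : cur_view (st k'.+1 i) = (tc_view (r_tc r')).+1.
  apply/eqP; rewrite eqn_leq et low -et; exact: leq_trans lt (st_cur adm ci (leqnSn _)).
case: (ok_rec0 h er' ew) => [|[r2 [er2 et2 _ es2]]]; first by rewrite ew et => /ni.
by exists r2; rewrite et2 es2.
Qed.

(** Index of the last batch, counted from 0, and thus the number of intervals in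
    [theta_recovery]. *)
Definition last_batch : nat := (ceil_div (n_validators f) (kappa P)).-1.

Lemma last_batch_ge : n_validators f <= kappa P * last_batch.+1.
Proof.
rewrite /last_batch /ceil_div; have := kappa_gt0 P.
case: (kappa P) => // k _; rewrite /n_validators /=.
set n := (3 * f).+1; have := divn_eq (n + k) k.+1; have := ltn_pmod (n + k) (ltn0Sn k).
set d := (n + k) %/ k.+1; set r := (n + k) %% k.+1 => lt e.
have d0 : 0 < d by rewrite /d divn_gt0 // /n addSn ltnS leq_addl.
rewrite prednK // mulnC; move: lt e; rewrite -(ltn_add2l (d * k.+1)) => lt e.
by rewrite -(leq_add2r k) e; move: lt; rewrite -e; lia.
Qed.

(** Recover was started by [t], so the batch of index [last_batch] is due at [t']. No due batch
    stays pending; hence more than [last_batch] batches have been sent, unless everybody was asked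
    before. *)
Lemma all_asked i t r : correct i -> (GST <= t)%R -> recovery (at_time t i) = Some r ->
  let t' := (t + last_batch%:R * theta_interval P)%R in
  cur_view (at_time t' i) <= (tc_view (r_tc r)).+1 ->
  ~ issued i (tc_view (r_tc r)).+1 (at_time t' i) ->
  forall j, List.In (j, MProposalRequest payload (r_tc r)) (sent (at_time t' i)).
Proof.
move=> ci gt er t' low ni j.
have th0 := theta_interval_ge0 P.
have le : (t <= t')%R by rewrite lerDl mulr_ge0 // ler0n.
have [r' [er' et es]] := recovery_persists ci (upto_le adm le) er low ni.
have [_ _ _ [un sz asked]] := ok_rec (st_ok adm _ ci) er'.
rewrite -et; apply: asked.
suff full : size (r_asked r') = n_validators f.
  have := uniq_leq_size (enum_uniq (validator f)) (s2 := r_asked r').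
  have /(uniq_min_size un) : {subset r_asked r' <= enum (validator f)}.
    by move=> x _; rewrite mem_enum.
  by rewrite size_enum_ord full => /(_ (leqnn _)) [_ ->]; rewrite mem_enum.
case: sz => // sz; apply/eqP; rewrite eqn_leq.
have -> /= : size (r_asked r') <= n_validators f.
  rewrite -[X in _ <= X]card_ord -(card_uniqP un); exact: max_card.
case eK: (upto t') => [|K].
  by move: er'; rewrite eK (adm_init adm).
have b1 : (time K <= t')%R by rewrite -(ltn_upto adm) eK.
have b2 : (t' < time K.+1)%R by rewrite ltNge -(ltn_upto adm) eK ltnn.
have /andP [_ nd] := adm_timers adm ci b1 b2; move: nd.
rewrite /batch_due -eK er' negb_and -leqNgt => /orP [//|/negP nd].
have [k' lt estart] := recovery_start ci er.
have kt : (time k' <= t)%R by rewrite -(ltn_upto adm).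
have c1 := adm_clock adm i kt; have c2 := adm_clock_gst adm i gt le.
apply: leq_trans last_batch_ge (leq_trans _ sz); rewrite leq_mul2l; apply/orP; right.
rewrite ltnNge; apply/negP => leb; apply: nd.
have : ((r_batches r')%:R * theta_interval P <= last_batch%:R * theta_interval P)%R.
  by apply: ler_wpM2r => //; rewrite ler_nat.
by rewrite es estart; move: c1 c2; rewrite {2}/t'; lra.
Qed.

End LiveView.

(** * Recovery of a missing block, and liveness of a view *)

Section Recovery.

Variables (R : realType) (f : nat) (digest : eqType) (payload : Type).
Variable P : params R f digest payload.
Variable E : execution R f digest payload.
Hypothesis adm : admissible P E.

Local Notation st := (st E).
Local Notation correct := (correct E).
Local Notation ctx := (ctx P E).
Local Notation delta := (delta E).
Local Notation GST := (GST E).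
Local Notation upto := (upto adm).
Local Notation at_time t i := (st (upto t) i).

Implicit Types (tc : TC f digest) (q : QC f digest).
Implicit Types (p : proposal f digest payload) (vt : vote f digest).
Implicit Types (M : timeout f digest) (m : msg f digest payload).
Implicit Types (i j : validator f) (w k : nat) (t a : R).

(** Both requests belong to the one Recover that is still running. *)
Lemma request_unique k i j j' tc tc' : correct i ->
  List.In (j, MNERequest payload tc) (sent (st k i)) ->
  List.In (j', MNERequest payload tc') (sent (st k i)) ->
  tc_view tc = tc_view tc' -> cur_view (st k i) <= (tc_view tc).+1 ->
  ~ issued i (tc_view tc).+1 (st k i) -> tc = tc'.
Proof.
move=> ci i1 i2 ew le ni; case: (request_alive adm ci i1 le) => // -[r er <-].
rewrite ew in le ni; case: (request_alive adm ci i2 le) => // -[r' er' <-].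
by move: er'; rewrite er => -[->].
Qed.

(* Votes are cast in the current view only, and an identifier determines its view. *)
Lemma not_voted_stable k k' j b u : correct j -> k <= k' -> u < cur_view (st k j) ->
  ~ voted_for (proposal_id P b u) (st k j) -> ~ voted_for (proposal_id P b u) (st k' j).
Proof.
move=> cj + lt nv; elim: k' => [|k' IH]; first by rewrite leqn0 => /eqP <-.
rewrite leq_eqVlt => /orP [/eqP <- //|]; rewrite ltnS => le; have {}IH := IH le.
move=> /voted_forP [j' [vt [iv eid]]].
case: (ok_newvote (step_ok adm k' cj) iv) => /= [iv'|le'].
  by apply: IH; apply/voted_forP; exists j', vt.
have [[/andP [/eqP e _] _ _ _ _] _] := ok_sent (st_ok adm k'.+1 cj) iv.
move: eid; rewrite e => /proposal_id_inj [_ eu].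
by move: (leq_trans lt (st_cur adm cj le)); rewrite -eu ltnNge le'.
Qed.

(** The delicate point is that an answer takes effect only while Recover runs. A correct validator
    answers after the leader has asked, and as long as no proposal is issued in this view, the
    Recover that asked is still running when the answer comes in. *)
Lemma recovery_completes tc t : let L := leader f (tc_view tc).+1 in
  correct L -> (GST <= t)%R ->
  (forall j, List.In (j, MNERequest payload tc) (sent (at_time t L))) ->
  (forall j, List.In (j, MProposalRequest payload tc) (sent (at_time t L))) ->
  (forall j, correct j -> cur_view (at_time (t + delta + delta)%R j) <= (tc_view tc).+1) ->
  issued L (tc_view tc).+1 (at_time (t + delta + delta)%R L).
Proof.
move=> L; set w := (tc_view tc).+1 in L *; move=> cl gt ne_req p_req low.
have d0 := delta_ge0 adm.
have l1 : (t <= t + delta)%R by lra.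
have l2 : (t + delta <= t + delta + delta)%R by lra.
have l3 : (t <= t + delta + delta)%R by lra.
have gt1 : (GST <= t + delta)%R by apply: le_trans l1.
case: (boolP (issued _ _ _)) => // /negP ni; exfalso.
set K := upto (t + delta + delta)%R in low ni *.
have ni_before k : k <= K -> ~ issued L w (st k L).
  by move=> le /(issued_extends (st_extends adm cl le)).
have low_before k j : correct j -> k <= K -> cur_view (st k j) <= w.
  by move=> cj le; apply: leq_trans (st_cur adm cj le) (low j cj).
have [[vtc _ lt0 nT _] _] := ok_sent (st_ok adm _ cl) (ne_req L).
have [[q [e _ _ _]]|[T [eT _ vT leT]]] := valid_tcP vtc; first by rewrite e in nT.
have [_ eid _ _] := valid_tipP vT.
have sentK y : List.In y (sent (at_time t L)) -> List.In y (sent (st K L)).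
  by have [h _ _] := at_extends adm cl l3; apply: h.
(* Any request of [L] for this view is [tc], and the recovery runs on its tip. *)
have alive k j tc' : k <= K -> (tc_view tc').+1 = w ->
    List.In (j, MNERequest payload tc') (sent (st k L)) ->
    tc' = tc /\ exists r, [/\ recovery (st k L) = Some r, r_tc r = tc, r_tip r = T &
      cur_view (st k L) = w].
  move=> le [ew] ij; have iK : List.In (j, MNERequest payload tc') (sent (st K L)).
    by case: (st_extends adm cl le) => h _ _; apply: h.
  have etc : tc' = tc.
    apply: (request_unique cl iK (sentK _ (ne_req L)) ew); rewrite ew //; exact: low.
  rewrite etc in ij; split=> //.
  have [[_ _ lt _ _] _] := ok_sent (st_ok adm k cl) ij.
  have lek : cur_view (st k L) <= w by apply: low_before.
  case: (request_alive adm cl ij lek) => [/(ni_before k le) //|[r er ertc]].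
  exists r; split=> //; last by apply/eqP; rewrite eqn_leq lek.
  have [eT' _ _ _] := ok_rec (st_ok adm k cl) er.
  by move: eT'; rewrite ertc eT => -[].
have le1 : upto (t + delta)%R <= K by apply: upto_le.
(* A returned block would make the leader propose, so none is returned and [j] has not voted for it
   when the proposal request arrives; being then in a view above the tip, it does not vote for the
   tip later either. *)
have not_voted j : correct j -> ~ voted_for (tip_id T) (at_time (t + delta)%R j).
  move=> cj; have [k1 [ch1 [lt1 e1]]] := delivered cl cj gt (p_req j).
  have lek1 : k1.+1 <= K by apply: leq_trans le1.
  have own x : genuine (ctx k1 j) x -> x.1 = j -> origin P (st k1 j) x.
    by move=> gx ex; rewrite -ex; apply: gx; rewrite ex.
  have [_ _ _ /(_ vtc erefl T eT)] :=
    ok_on_proposal_request own (st_ok adm k1 cj) (st_counted adm k1 cj) (event_received adm e1).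
  have es1 := event_step adm e1; rewrite /= in es1 *; rewrite -es1.
  case; first by apply: low_before => //; apply: ltnW.
    case=> p [epid vp] inew.
    have [k2 [ch2 [lt12 lt2 e2]]] := delivered_new cj cl gt1 lt1 inew.
    have au := adm_authentic adm e1; rewrite cl in au.
    have [[_ _ _ _ al] _] := ok_sent (st_ok adm k1 cl) au.
    have iL2 : List.In (L, MNERequest payload tc) (sent (st k2 L)).
      by case: (st_extends adm cl (ltnW lt12)) => h _ _; apply: h.
    have [_ [r [er ertc ertip ecur]]] := alive k2 _ _ (ltnW lt2) erefl iL2.
    have [_ _ /(_ vp) [_ _ h3]] := ok_on_proposal (st_ok adm k2 cl) (event_received adm e2).
    have es2 := event_step adm e2; rewrite /= in es2 h3; rewrite -es2 in h3.
    have := h3 r er; rewrite ertip ertc => /(_ epid ecur); rewrite ecur.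
    by move=> /(ni_before k2.+1 lt2).
  move=> [ec nv]; rewrite eid; apply: (not_voted_stable cj lt1); last by rewrite -eid.
  by rewrite ec ltnS.
have answered j : correct j -> exists ne,
    [/\ List.In ne (ne_votes (st K L)), ne_view ne = w, ne_qc_view ne = q_view (tip_qc T) &
        (ne_sig ne).1 = j].
  move=> cj; have [_ /(_ T eT)] := deliver_ne_request cl cj gt (ne_req j).
  case; first by apply: low_before.
    by move=> /(not_voted j cj).
  move=> /sent_neP [j' [ne [ine ew]]].
  have [[vne ej edst nqw] _] := ok_sent (st_ok adm _ cj) ine.
  rewrite /= ew in edst nqw; rewrite edst in ine.
  (* A priori the NE vote could answer another TC of the same view; uniqueness of the request shows
     that it is on the pair given by [tc]. *)
  have [j2 [tc2 [T2 [i2 ew2 eT2 eq2]]]] := nqw cl.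
  have [etc _] := alive _ _ _ le1 ew2 i2.
  move: eT2; rewrite etc eT => -[eT2]; exists ne; split=> //; last by rewrite -eq2 eT2.
  exact: (deliver_ne cj cl gt1 ine).
(* The quorum is tested only on reception of an NE vote, so the event that completes it has to be
   isolated. *)
pose A k := quorum f <= size (ne_sigs w (q_view (tip_qc T)) (ne_votes (st k L))).
have AK : A K.
  apply: (size_ge_correct adm) => j /answered [ne [ine e1 e2 <-]].
  by apply: map_f; apply/ne_sigsP; exists ne.
have exA : exists k, A k by exists K.
case: (ex_minnP exA) => K0 AK0 minK.
have leK0 := minK _ AK.
case: K0 AK0 minK leK0 => [|k] Ak minK lek; first by move: Ak; rewrite /A (adm_init adm).
have nAk : ~ A k by move=> /minK; rewrite ltnn.
have nes : ne_votes (st k.+1 L) <> ne_votes (st k L) by move=> e; apply: nAk; rewrite /A -e.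
have hk := step_ok adm k cl.
case: (ok_nes hk) => [//|an]; have [j [ne [ch e]]] := an.
have [_ _ _ [post1 post2]] :=
  ok_on_ne ch (st_ok adm k cl) (st_counted adm k cl) an (event_received adm e).
have es := event_step adm e; rewrite /= in es post1 post2; rewrite -es in post1 post2.
case: (boolP (valid_ne ne)) => [vne|/post2 //].
have [ene iss] := post1 vne.
have hs x : x \in ne_sigs w (q_view (tip_qc T)) (ne_votes (st k.+1 L)) ->
    x.2 = SNE digest w (q_view (tip_qc T)) /\ origin_before P E k x.
  move=> /ne_sigsP [ne' [/(ok_ne hk) [/eqP vne' gne'] e1 e2 <-]].
  by rewrite vne' e1 e2.
have un : uniq [seq x.1 | x <- ne_sigs w (q_view (tip_qc T)) (ne_votes (st k.+1 L))].
  apply: (@mem_undup_uniq_fst _ _ _ (SNE digest w (q_view (tip_qc T)))); first exact: undup_uniq.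
  by move=> x /hs [].
(* A correct signer in the quorum was asked by the leader before this event, which shows that
   Recover is running when the quorum is completed. *)
have [x /hs [ex gx] cx] := some_correct adm (leq_trans (ltn_quorum f) Ak) un.
have := gx cx; rewrite /origin ex /= => /sent_neP [j' [ne' [ine' ew']]].
have [[_ _ _ nqw] _] := ok_sent (st_ok adm k cx) ine'.
rewrite /= ew' in nqw; have [j2 [tc2 [T2 [i2 ew2 _ _]]]] := nqw cl.
have [_ [r [er ertc ertip ecur]]] := alive k _ _ (ltnW lek) ew2 i2.
apply: (ni_before k.+1 lek); rewrite -ecur.
apply: (iss r er); rewrite ertc //.
by rewrite ertip -ene.
Qed.

(** The [6 delta] are two for the leader to act, two for Recover after its last batch, and two for
    proposal and votes. As [delta E <= Delta P], the sum leaves [2 Delta] to spare in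
    [theta_view]. *)
Lemma live_view v a : 0 < f -> 0 < v -> first_entry E v a -> (GST <= a)%R ->
  correct (leader f v) -> exists2 j, correct j &
    v < cur_view (at_time (a + 6%:R * delta + (last_batch P)%:R * theta_interval P)%R j).
Proof.
move=> f0 v0 ha ga cl; set t3 := (a + _ + _)%R.
have d0 := delta_ge0 adm; have dD := delta_le adm; have D0 := Delta_gt0 P.
have th0 : (0 <= (last_batch P)%:R * theta_interval P)%R.
  by rewrite mulr_ge0 ?ler0n //; exact: theta_interval_ge0.
case: (boolP [exists j, correct j && (v < cur_view (at_time t3 j))]).
  by case/existsP => j /andP [? ?]; exists j.
rewrite negb_exists => /forallP nex; exfalso.
have low j : correct j -> cur_view (at_time t3 j) <= v.
  by move=> cj; have := nex j; rewrite cj /= -leqNgt.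
set t1 := (a + 2%:R * delta)%R.
set t2 := (t1 + (last_batch P)%:R * theta_interval P)%R.
have e3 : (t2 + delta + delta + delta + delta = t3)%R.
  by rewrite /t2 /t1 /t3; lra.
have g1 : (GST <= t1)%R by rewrite /t1; lra.
have g2 : (GST <= t2)%R by rewrite /t2; lra.
have g3 : (GST <= t2 + delta + delta)%R by lra.
have l12 : (t1 <= t2)%R by rewrite /t2; lra.
have l13 : (t1 <= t2 + delta + delta)%R by lra.
have low' t j : correct j -> (t <= t3)%R -> cur_view (at_time t j) <= v.
  by move=> cj le; apply: leq_trans (at_cur adm cj le) (low j cj).
have ac := leader_acts adm v0 f0 ha ga cl; rewrite -/t1 in ac.
have iss : issued (leader f v) v (at_time (t2 + delta + delta)%R (leader f v)).
  case: (boolP (issued _ _ _)) => // /negP ni; exfalso.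
  have ni1 : ~ issued (leader f v) v (at_time t1 (leader f v)).
    by move=> /(issued_extends (at_extends adm cl l13)).
  case: ac => [//|[j [tc [ij ew]]]].
  case: (request_alive adm cl ij); rewrite ?ew.
  - by apply: low' => //; rewrite -e3; lra.
  - exact: ni1.
  move=> [r er ertc].
  have preq : forall j', List.In (j', MProposalRequest payload tc) (sent (at_time t2 (leader f v))).
    rewrite -ertc; apply: (all_asked cl g1 er); rewrite ertc ew.
      by apply: low' => //; rewrite -/t2 -e3; lra.
    rewrite -/t2 => iss2; apply: ni.
    have l2 : (t2 <= t2 + delta + delta)%R by lra.
    exact: issued_extends (at_extends adm cl l2) iss2.
  have [[_ _ _ _ al] _] := ok_sent (st_ok adm _ cl) ij.
  have nreq : forall j', List.In (j', MNERequest payload tc) (sent (at_time t2 (leader f v))).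
    exact: to_all_extends (at_extends adm cl l12) al.
  apply: ni; have := @recovery_completes tc t2; rewrite ew; apply=> //.
  by move=> j' cj'; apply: low' => //; rewrite -e3; lra.
apply: (issued_progress cl v0 g3 iss).
  move=> j cj; apply: (no_timeout ha ga cj).
  have : (t2 + delta + delta + delta <= t3)%R by rewrite -e3; lra.
  move=> /le_lt_trans; apply; rewrite /t3 /theta_view /theta_recovery -/(last_batch P); lra.
by move=> j cj; rewrite e3; apply: low.
Qed.

End Recovery.

(** * The bound *)

Section Conclusion.

Variables (R : realType) (f : nat) (digest : eqType) (payload : Type).
Variable P : params R f digest payload.
Variable E : execution R f digest payload.
Hypothesis adm : admissible P E.

Local Notation st := (st E).
Local Notation time := (time E).
Local Notation correct := (correct E).
Local Notation ctx := (ctx P E).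
Local Notation delta := (delta E).
Local Notation GST := (GST E).
Local Notation upto := (upto adm).
Local Notation at_time t i := (st (upto t) i).

Implicit Types (q : QC f digest) (i j : validator f) (w v k : nat) (t a b : R).

(* As view [v] is live, its first exit at time [b] precedes all timeouts of [v], so it is
   due to a quorum certificate, which the leader of [v] spreads. *)
Lemma entry_spreads v a b : 0 < f -> 0 < v -> first_entry E v a -> (GST <= a)%R ->
  correct (leader f v) -> first_entry E v.+1 b -> (GST <= b)%R ->
  (forall j, correct j -> v < cur_view (at_time (b + 2%:R * delta)%R j)) \/
  exists2 j, correct j & v.+1 < cur_view (at_time (b + 2%:R * delta)%R j).
Proof.
move=> f0 v0 ha ga cl hb gb.
have d0 := delta_ge0 adm; have dD := delta_le adm; have D0 := Delta_gt0 P.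
have e2 : (b + delta + delta = b + 2%:R * delta)%R by lra.
have b1 : (b <= b + delta)%R by lra.
have b2 : (b + delta <= b + 2%:R * delta)%R by lra.
have gb1 : (GST <= b + delta)%R by lra.
case: (boolP [exists j, correct j && (v.+1 < cur_view (at_time (b + 2%:R * delta)%R j))]).
  by case/existsP => j /andP [? ?]; right; exists j.
rewrite negb_exists => /forallP nex; left.
have low j : correct j -> cur_view (at_time (b + 2%:R * delta)%R j) <= v.+1.
  by move=> cj; have := nex j; rewrite cj /= -leqNgt.
have [j0 cj0 lt0] := live_view adm f0 v0 ha ga cl.
have lb := first_entry_le hb cj0 (ltn0Sn v) lt0.
(* The bound of [live_view] applies to [b], and what it leaves to spare in [theta_view] pays for one
   more delay. *)
have lta : (b + delta < a + theta_view P)%R.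
  by rewrite /theta_view /theta_recovery -/(last_batch P); move: lb; lra.
have unseen n i k : f < n -> k < upto (b + delta)%R -> ~ timeouts_seen (ctx k i) n v.
  move=> ltn ltk /(timeouts_seen_some adm ltn) [j [cj sj _]].
  apply: (no_timeout ha ga cj lta).
  exact: sent_timeout_extends (st_extends adm cj (ltnW ltk)) sj.
have spread q t j : correct j -> (GST <= t)%R -> q_view q = v ->
    to_all (MQC payload q) (at_time t (leader f v)) -> v < cur_view (at_time (t + delta)%R j).
  move=> cj gt ev al; have [h _] := deliver_qc cl cj gt (al j).
  by rewrite -ev; apply: h; left; rewrite ev.
(* Either everybody leaves [v] within one delay, thanks to a leader that has acted in [v.+1] or has
   sent the QC to all, or at least the QC has been sent to the leader of [v]. *)
have key i t : correct i -> (b <= t)%R -> (t <= b + delta)%R -> v.+1 \in entered (at_time t i) ->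
    (forall j, correct j -> v < cur_view (at_time (t + delta)%R j)) \/
    exists2 q, q_view q = v & List.In (leader f v, MQC payload q) (sent (at_time t i)).
  move=> ci lbt ltb we; have gt : (GST <= t)%R by apply: le_trans lbt.
  have [k0 [lt wn cw we0 [jw _]]] := entry_event adm ci we.
  have ltk : k0 < upto (b + delta)%R by apply: leq_trans lt (upto_le adm ltb).
  have ex := st_extends adm ci lt; have [exs _ _] := ex.
  have us := unseen _ i k0 (ltn_quorum f) ltk.
  case: jw => //=.
  - by move=> [e]; move: v0; rewrite e.
  - move=> [/= il ac]; left=> j cj; rewrite il in ci ex ac.
    exact: acts_all ci gt (acts_extends ex ac) j cj.
  - by move=> _ [//|[q [vq [ew] iq]]]; right; exists q => //; apply: exs.
  - move=> q vq [ew] iL [iq|fw]; [right|left].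
      by exists q => //; apply: exs.
    move=> j cj; rewrite /= ew in fw; apply: (spread q) => //.
    exact: to_all_extends (st_extends adm cl (ltnW lt)) (fw cl).
have later t j : (t <= b + delta)%R -> v < cur_view (at_time (t + delta)%R j) -> correct j ->
    v < cur_view (at_time (b + 2%:R * delta)%R j).
  by move=> le lv cj; apply: leq_trans lv (at_cur adm cj _); lra.
have [i0 ci0 we0] := first_entry_at adm hb.
case: (key _ _ ci0 (lexx b) b1 we0) => [h j cj|[q ev iq]].
  by apply: (later b) => //; apply: h.
have [_ /(_ _)] := deliver_qc ci0 cl gb iq; rewrite ev => -[//|lv|al j cj]; last first.
  by rewrite -e2; apply: (spread q).
(* The leader of [v] may have ignored [q] because it had left [v] before. It is then exactly in
   [v.+1], and [key] applies to its own entry: a QC of [v] sent by this leader has gone to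
   everybody. *)
have we : v.+1 \in entered (at_time (b + delta)%R (leader f v)).
  have le := leq_trans (at_cur adm cl b2) (low _ cl).
  have <- : cur_view (at_time (b + delta)%R (leader f v)) = v.+1 by apply/eqP; rewrite eqn_leq le.
  by apply: (ok_cur (st_ok adm _ cl)); apply: leq_trans lv.
case: (key _ _ cl b1 (lexx _) we) => [h j cj|[q' ev' iq'] j cj].
  by rewrite -e2; apply: h.
have [[_ al] _] := ok_sent (st_ok adm _ cl) iq'.
by rewrite -e2; apply: (spread q') => //; apply: al; rewrite /= ev'.
Qed.

(** States change at events only, so the earliest time is that of the first event after which all
    correct validators are above [w]. *)
Lemma earliest_exists w t : (forall j, correct j -> w < cur_view (at_time t j)) ->
  exists t', earliest_all_above E w t' /\ (t' <= t)%R.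
Proof.
move=> h; pose A k := [forall j, correct j ==> (w < cur_view (st k j))].
have At : A (upto t) by apply/forallP => j; apply/implyP; apply: h.
have exA : exists k, A k by exists (upto t).
case: (ex_minnP exA) => K AK minK.
case: K AK minK => [|K] /forallP AK minK.
  have [j cj] : exists j, correct j.
    have : 0 < #|[set j : validator f | correct j]| by apply: leq_trans (card_correct adm).
    by case/card_gt0P => j; rewrite inE; exists j.
  by have := AK j; rewrite cj (adm_init adm).
have above j : correct j -> w < cur_view (st K.+1 j) by move=> cj; have := AK j; rewrite cj.
exists (time K); split; last by rewrite -(ltn_upto adm); apply: minK.
split.
  move=> i ci; have lt := above i ci.
  have we := ok_cur (st_ok adm K.+1 ci) (leq_trans (ltn0Sn w) lt).
  have [k0 [lt0 wn _ we0 _]] := entry_event adm ci we.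
  exists k0, (cur_view (st K.+1 i)); split=> //; first by apply/and3P.
  exact: (time_le adm).
move=> t' h'; rewrite leNgt; apply/negP => lt.
suff /minK : A K by rewrite ltnn.
apply/forallP => j; apply/implyP => cj; have [k [w' [/and3P [_ _ we] lw le]]] := h' j cj.
have ltk : k < K.
  by rewrite ltnNge; apply/negP => /(time_le adm) le'; move: lt le le'; lra.
apply: leq_trans lw (leq_trans _ (st_cur adm cj ltk)).
by have /andP [] := entered_cur adm cj we.
Qed.

End Conclusion.


Theorem theorem6 :
  exists C : nat,
  forall (R : realType) (f : nat) (digest : eqType) (payload : Type)
    (P : params R f digest payload) (E : execution R f digest payload),
    admissible P E ->
  forall v : nat, 0 < v ->
    post_gst E v -> post_gst E v.+1 -> post_gst E v.+2 ->
    correct E (leader f v) -> correct E (leader f v.+2) ->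
  forall t1 : R, first_entry E v.+1 t1 ->
  exists t : R,
    earliest_all_above E v.+1 t /\
    (t - t1 <= C%:R * delta E + theta_view P)%R.
Proof.
exists 5 => R f digest payload P E adm v v0 gv gv1 gv2 cl cl2 b hb.
have d0 := delta_ge0 adm; have dD := delta_le adm; have D0 := Delta_gt0 P.
have th0 : (0 <= theta_view P)%R.
  by rewrite /theta_view; have := theta_recovery_ge P; lra.
have gb := gv1 _ hb.
have [i0 ci0 we0] := first_entry_at adm hb.
have /andP [_ le0] := entered_cur adm ci0 we0.
set T := (b + 5%:R * delta E + theta_view P)%R.
set T4 := (b + 2%:R * delta E + theta_view P)%R.
have l4 : (T4 + delta E <= T)%R by rewrite /T4 /T; lra.
have g4 : (GST E <= T4)%R by rewrite /T4; lra.
have b2 : (b <= b + 2%:R * delta E)%R by lra.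
have g2 : (GST E <= b + 2%:R * delta E)%R by lra.
have l24 : (b + 2%:R * delta E <= T4)%R by rewrite /T4; lra.
suff above j : correct E j -> v.+1 < cur_view (st E (upto adm T) j).
  have [t [et le]] := earliest_exists above.
  by exists t; split=> //; move: le; rewrite /T; lra.
case: (boolP [exists i, correct E i && (v.+1 < cur_view (st E (upto adm T4) i))]).
  case/existsP => i /andP [ci lti] cj.
  (* For [f = 0] the validator already above [v.+1] is the only one; [all_enter] is available for
     [0 < f]. *)
  case: (posnP f) => [f0|f0].
    rewrite (single_validator j i f0).
    by apply: leq_trans lti (at_cur adm ci _); apply: le_trans l4; lra.
  have [a2 ha2] := first_entryP adm ci (ltn0Sn _) lti.
  have le2 := first_entry_le ha2 ci (ltn0Sn _) lti.
  have := all_enter adm (ltn0Sn _) f0 ha2 (gv2 _ ha2) cl2 cj.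
  move=> /leq_trans; apply; apply: at_cur => //; move: le2; rewrite /T4 /T; lra.
rewrite negb_exists => /forallP nex cj.
have low i : correct E i -> cur_view (st E (upto adm T4) i) <= v.+1.
  by move=> ci; have := nex i; rewrite ci /= -leqNgt.
have reached i : correct E i -> v < cur_view (st E (upto adm (b + 2%:R * delta E)%R) i).
  move=> ci; case: (posnP f) => [f0|f0].
    rewrite (single_validator i i0 f0).
    exact: leq_trans le0 (at_cur adm ci0 b2).
  have [a ha] := first_entryP adm ci0 v0 (leq_trans (leqnSn v) le0).
  case: (entry_spreads adm f0 v0 ha (gv _ ha) cl hb gb) => [h|[j' cj' lt]]; first exact: h.
  by have := leq_trans lt (leq_trans (at_cur adm cj' l24) (low _ cj')); rewrite ltnn.
apply: leq_trans (at_cur adm cj l4); apply: all_timed_out => // i ci.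
have := view_timeout ci (ltn0Sn v) g2 (reached i ci) th0.
by rewrite -/T4 => -[lt|//]; have := leq_trans lt (low i ci); rewrite ltnn.
Qed.
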